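(* Let $0<q<p<\infty$, let $\psi\in\mathcal F^q(\mathbb C)$ be a nonzero function, and let $\varphi(z)=az+b$ with $a,b\in\mathbb C$ and $0<|a|\le 1$. The following assertions are equivalent: (i) The operator $W_{\psi,\varphi}:\mathcal F^p(\mathbb C)\to\mathcal F^q(\mathbb C)$ is bounded. (ii) The operator $W_{\psi,\varphi}:\mathcal F^p(\mathbb C)\to\mathcal F^q(\mathbb C)$ is compact. (iii) The function $z\mapsto m_z(\psi,\varphi)$ belongs to $L^{\frac{pq}{p-q}}(\mathbb C,dA)$. In this case, $$\|W_{\psi,\varphi}\|\simeq \|m_z(\psi,\varphi)\|_{L^{\frac{pq}{p-q}}(\mathbb C,dA)},$$ that is, each side is bounded by a positive constant, depending only on $p$, $q$ and $|a|$, times the other side.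
   Context: $dA$ is Lebesgue measure on $\mathbb C$. For $0<p<\infty$, the Fock space $\mathcal F^p(\mathbb C)$ is the set of entire functions $f$ with $\|f\|_p=\left(\frac{p}{2\pi}\int_{\mathbb C}|f(z)|^pe^{-\frac{p|z|^2}{2}}\,dA(z)\right)^{1/p}<\infty$ (a Banach space if $p\ge1$; a complete metric space with distance $\|f-g\|_p^p$ if $0<p<1$). For entire functions $\psi,\varphi$, the weighted composition operator is $W_{\psi,\varphi}f=\psi\cdot(f\circ\varphi)$. A linear operator $T:\mathcal F^p(\mathbb C)\to\mathcal F^q(\mathbb C)$ is bounded if it maps $\mathcal F^p(\mathbb C)$ into $\mathcal F^q(\mathbb C)$ and $\|T\|=\sup_{\|f\|_p\le1}\|Tf\|_q<\infty$; it is compact if it maps bounded sets to relatively compact sets. For $z\in\mathbb C$, $m_z(\psi,\varphi)=|\psi(z)|e^{\frac{|\varphi(z)|^2-|z|^2}{2}}$. *)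

(* Defs.v *)
From HB Require Import structures.
From mathcomp Require Import all_boot all_order all_algebra.
From mathcomp Require Import all_classical all_reals all_analysis.
From mathcomp Require Import complex.
Set Implicit Arguments.
Unset Strict Implicit.
Unset Printing Implicit Defensive.
Import Order.TTheory GRing.Theory Num.Theory.
Import numFieldNormedType.Exports.
Import ComplexField.Normc.

Local Open Scope classical_set_scope.
Local Open Scope ring_scope.

(* [normc : R[i] -> R] is the real-valued modulus (the norm [`|z|] of MathComp
   has values in R[i]).
   The measurable space of complex numbers is R * R with its Borel sigma-algebra,
   through the identification (x, y) |-> x + i y; then dA is the product
   measure. *)
Definition plane (R : realType) : Type :=
  (measurableTypeR R * measurableTypeR R)%type.

Definition dA (R : realType) :
    {measure set (measurableTypeR R * measurableTypeR R) -> \bar R} :=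
  (@lebesgue_measure R \x @lebesgue_measure R)%E.

Definition to_C (R : realType) (w : plane R) : R[i] := Complex w.1 w.2.

(* R[i]^o is the field R[i] seen as a normed space over itself, so that
   [derivable _ z 1] is complex differentiability at z. *)
Definition entire (R : realType) (f : R[i] -> R[i]) : Prop :=
  forall z : R[i], derivable (f : R[i]^o -> R[i]^o) z 1.

Definition fock_norm (R : realType) (p : R) (f : R[i] -> R[i]) : \bar R :=
  (((p / (2 * pi))%:E *
    \int[@dA R]_(w in setT)
      (normc (f (to_C w)) `^ p * expR (- (p * normc (to_C w) ^+ 2 / 2)))%:E)
    `^ p^-1)%E.

Definition fock (R : realType) (p : R) : set (R[i] -> R[i]) :=
  [set f | entire f /\ (fock_norm p f < +oo)%E].

Definition fock_dist (R : realType) (p : R) (f g : R[i] -> R[i]) : \bar R :=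
  if 1 <= p then fock_norm p (fun z => f z - g z)
  else (fock_norm p (fun z => (f z - g z)%R) `^ p)%E.

Record fockType (R : realType) (p : R) := FockType {
  fock_fun :> R[i] -> R[i];
  fock_funP : fock p fock_fun }.

HB.instance Definition _ (R : realType) (p : R) := gen_eqMixin (fockType p).
HB.instance Definition _ (R : realType) (p : R) := gen_choiceMixin (fockType p).

(* The topology of F^p: open sets of the distance [fock_dist]. *)
Definition fock_open (R : realType) (p : R) : set_system (fockType p) :=
  [set U | forall f : fockType p, U f -> exists2 e : R, 0 < e &
             forall g : fockType p, (fock_dist p f g < e%:E)%E -> U g].

Lemma fock_openT (R : realType) (p : R) : fock_open [set: fockType p].
Proof. by move=> f _; exists 1. Qed.

Lemma fock_openI (R : realType) (p : R) : setI_closed (@fock_open R p).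
Proof.
move=> U V oU oV f [/oU[d d0 dU] /oV[e e0 eV]].
exists (Num.min d e); first by rewrite lt_min d0.
move=> g; rewrite EFin_min lt_min => /andP[gd ge].
by split; [exact: dU | exact: eV].
Qed.

Lemma fock_open_bigU (R : realType) (p : R) (I : Type)
    (F : I -> set (fockType p)) :
  (forall i, fock_open (F i)) -> fock_open (\bigcup_i F i).
Proof.
move=> oF f [i _ /oF[e e0 eF]]; exists e => // g /eF Fg.
by exists i.
Qed.

HB.instance Definition _ (R : realType) (p : R) :=
  isOpenTopological.Build (fockType p)
    (@fock_openT R p) (@fock_openI R p) (@fock_open_bigU R p).

Definition weighted_comp (R : realType) (psi phi : R[i] -> R[i])
    (f : R[i] -> R[i]) : R[i] -> R[i] :=
  fun z => psi z * f (phi z).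

Definition maps_fock (R : realType) (p q : R)
    (T : (R[i] -> R[i]) -> (R[i] -> R[i])) : Prop :=
  forall f, fock p f -> fock q (T f).

Definition opnorm (R : realType) (p q : R)
    (T : (R[i] -> R[i]) -> (R[i] -> R[i])) : \bar R :=
  ereal_sup [set fock_norm q (T f) |
              f in [set f | fock p f /\ (fock_norm p f <= 1)%E]].

Definition bounded_op (R : realType) (p q : R)
    (T : (R[i] -> R[i]) -> (R[i] -> R[i])) : Prop :=
  maps_fock p q T /\ (opnorm p q T < +oo)%E.

Definition fock_bounded (R : realType) (p : R) (B : set (fockType p)) : Prop :=
  exists M : R, forall f, B f -> (fock_norm p f <= M%:E)%E.

Definition compact_op (R : realType) (p q : R)
    (T : (R[i] -> R[i]) -> (R[i] -> R[i])) : Prop :=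
  maps_fock p q T /\
  forall B : set (fockType p), fock_bounded B ->
    precompact [set g : fockType q |
                 exists2 f : fockType p, B f & fock_fun g = T f].

Definition m_fun (R : realType) (psi phi : R[i] -> R[i]) (z : R[i]) : R :=
  normc (psi z) * expR ((normc (phi z) ^+ 2 - normc z ^+ 2) / 2).

(* The exponent r may be smaller than 1; [Lfun] and [Lnorm] are given by the
   usual formulas for every r > 0. *)
Definition in_Lr (R : realType) (r : R) (u : R[i] -> R) : Prop :=
  (fun w : plane R => u (to_C w)) \in Lfun (@dA R) r%:E.

Definition Lr_norm (R : realType) (r : R) (u : R[i] -> R) : \bar R :=
  Lnorm (@dA R) r%:E (fun w : plane R => (u (to_C w))%:E).

(* Main.v *)
Require Import Defs.
From HB Require Import structures.
From mathcomp Require Import all_boot all_order all_algebra.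
From mathcomp Require Import all_classical all_reals all_analysis.
From mathcomp Require Import complex.
From mathcomp Require Import measurable_realfun ring lra.
Set Implicit Arguments.
Unset Strict Implicit.
Unset Printing Implicit Defensive.
Import Order.TTheory GRing.Theory Num.Theory.
Import numFieldNormedType.Exports.
Import ComplexField.Normc.
Local Open Scope classical_set_scope.
Local Open Scope ring_scope.

(** Let m be the function of the statement, r = pq / (p - q), and write
    k(f)(z) = |f(z)| e^(-|z|^2/2). Up to a constant, the norm of F^p is the L^p norm
    of k(f), and k(W f) = m (k(f) o phi) ([kf_W]). So the theorem compares the
    operator with the multiplication by m from L^p to L^q.

    If m is in L^r, the inequality of Hoelder bounds the operator norm by the norm of
    m, since phi multiplies areas by |a|^2 ([fock_norm_W_le]).

    Conversely, let z_j be the points of a square lattice and k_j the normalized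
    reproducing kernels at these points. For c_j >= 0 and any signs, the function
    f = sum of +- c_j k_j satisfies |f|_p^p <= C sum of c_j^p ([ipow_tfun]), because
    the weighted moduli of the k_j are translated Gaussians. Averaging
    the q-th power of the norm of W f over the signs gives
      sum of c_j^q I_j <= C |W|^q (sum of c_j^p)^(q/p),
    where I_j is the mass of m^q near phi^-1(z_j) ([test_inequality]). The best
    choice of the c_j turns this into a bound for the sum of the I_j^(p/(p-q))
    ([cell_mass_sum]). As |a| <= 1, m is locally comparable to the modulus of a
    holomorphic function, so m^q has a sub-mean value property ([mw_submean]) and is
    at most C I_j on the cell of z_j; since r = q p / (p - q), the integral of m^r is
    bounded by the sum above ([Lr_lower]).

    The sub-mean value property for all exponents q > 0 rests on the formula of
    Cauchy ([cauchy_formula]) and on an argument of Hardy and Littlewood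
    ([submean_le1]). The formula of Cauchy is proved on squares, from the theorem of
    Goursat for closed real forms P dx + Q dy.

    For compactness, take an ultrafilter on the image of a ball. By Montel's theorem
    ([montel]) the preimages have a locally uniform limit G in the ball. Functions of
    a ball that are small on a large square have small images, because psi is in F^q
    and the integral of m^r has a small tail ([W_small]); so the images converge to
    W G, and the image of the ball is compact ([image_ball_compact]). A compact
    operator is bounded because the image of the unit ball lies in a compact subset
    of a metric space ([compact_op_bounded]). *)

(** * The real modulus and complex differentiability *)

(** Complex differentiability with real epsilons and deltas: in [derivable] the
    norms, and so the epsilons, are elements of [R[i]]. *)
Definition holomorphic_at (R : realType) (f : R[i] -> R[i]) (z : R[i]) : Prop :=
  exists d : R[i], forall e : R, 0 < e -> exists2 del : R, 0 < del &
    forall h, normc h < del -> normc (f (z + h) - f z - d * h) <= e * normc h.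

Lemma eqW d (T : porderType d) (x y : T) : x = y -> (x <= y)%O.
Proof. by move=> ->. Qed.

Section basics.
Context {R : realType}.
Implicit Types (x y z w : R[i]) (f g : R[i] -> R[i]).

Lemma normc_ge0 z : 0 <= normc z.
Proof. by case: z => a b; rewrite /normc sqrtr_ge0. Qed.

Lemma normc_gt0 z : (0 < normc z) = (z != 0).
Proof.
rewrite lt0r normc_ge0 andbT; congr (~~ _).
by apply/eqP/eqP => [/eq0_normc//|->]; rewrite normc0.
Qed.

Lemma normE z : `|z| = (normc z)%:C%C.
Proof. by []. Qed.

Lemma gt0_real (e : R[i]) : 0 < e -> e = (complex.Re e)%:C%C /\ 0 < complex.Re e.
Proof. by case: e => a b; rewrite ltcE /= => /andP[/eqP -> ->]. Qed.

Lemma normc_sub z w : normc (z - w) <= normc z + normc w.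
Proof. by rewrite -[normc w]normcN; exact: le_normcD. Qed.

Lemma normc_subC z w : normc (z - w) = normc (w - z).
Proof. by rewrite -normcN opprB. Qed.

Lemma derivable_holomorphic f z :
  derivable (f : R[i]^o -> R[i]^o) z 1 <-> holomorphic_at f z.
Proof.
split=> [/cvg_ex[/= d dd]|[d dP]].
  exists d => e e0; move/cvgrPdist_lt : dd => /(_ (e%:C)%C).
  rewrite ltcR => /(_ e0); rewrite /dnbhs near_withinE.
  move=> /nbhs_normP[del /= del0 H].
  have [dr {}del0] := gt0_real del0.
  exists (complex.Re del) => //.
  move=> h hd; have [->|h0] := eqVneq h 0.
    by rewrite addr0 mulr0 !subr0 subrr normc0 mulr0.
  have := H h; rewrite /ball_ /= sub0r normrN normE dr ltcR => /(_ hd h0).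
  rewrite normE ltcR /= => H1.
  rewrite -ler_pdivrMr ?normc_gt0// -normcV -normcM.
  rewrite -normcN; apply: ltW; move: H1; congr (normc _ < _).
  rewrite /GRing.scale /= mulr1 [h + z]addrC mulrBl opprB mulfK//.
  by rewrite [(_ - _) / _]mulrC.
apply/cvg_ex; exists d; apply/cvgrPdist_lt => /= e e0.
have [er e1] := gt0_real e0; have e0' : 0 < complex.Re e / 2 by rewrite divr_gt0.
have [del del0 H] := dP _ e0'.
rewrite /dnbhs near_withinE; apply/nbhs_normP.
exists (del%:C)%C; first by rewrite /= ltcR.
move=> h; rewrite /ball_ /= sub0r normrN normE ltcR => hd h0.
rewrite normE er ltcR.
have := H h hd; rewrite -ler_pdivrMr ?normc_gt0// -normcV -normcM.
rewrite -normcN => H1; apply: le_lt_trans (_ : complex.Re e / 2 < _); last first.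
  lra.
move: H1; congr (normc _ <= _).
rewrite /GRing.scale /= mulr1 [h + z]addrC mulrBl opprB mulfK//.
by rewrite [(_ - _) / _]mulrC.
Qed.

Lemma entireP f : entire f <-> forall z, holomorphic_at f z.
Proof. by split=> H z; apply/derivable_holomorphic. Qed.

End basics.

(** * Entire functions and the complex exponential *)

Section entire_closure.
Context {R : realType}.
Implicit Types (x y z w : R[i]) (f g : R[i] -> R[i]).

Lemma entire_cst (c : R[i]) : entire (fun=> c).
Proof. by move=> z; exact: derivable_cst. Qed.

Lemma entire_id : entire (fun z : R[i] => z).
Proof. by move=> z; exact: derivable_id. Qed.

Lemma entireD f g : entire f -> entire g -> entire (fun z => f z + g z).
Proof. by move=> ef eg z; exact: (derivableD (ef z) (eg z)). Qed.

Lemma entireB f g : entire f -> entire g -> entire (fun z => f z - g z).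
Proof. by move=> ef eg z; exact: (derivableB (ef z) (eg z)). Qed.

Lemma entireM f g : entire f -> entire g -> entire (fun z => f z * g z).
Proof. by move=> ef eg z; exact: (derivableM (ef z) (eg z)). Qed.

Lemma entireX f n : entire f -> entire (fun z => f z ^+ n).
Proof.
move=> ef; elim: n => [|n IH]; first exact: entire_cst.
rewrite (_ : (fun z => _) = (fun z => f z * f z ^+ n)); first exact: entireM.
by apply/funext => z; rewrite exprS.
Qed.

Lemma entire_sum (I : Type) (s : seq I) (P : pred I) (F : I -> R[i] -> R[i]) :
  (forall i, entire (F i)) -> entire (fun z => \sum_(i <- s | P i) F i z).
Proof.
move=> eF; elim: s => [|i s IH].
  rewrite (_ : (fun z => _) = (fun=> 0)); first exact: entire_cst.
  by apply/funext => z; rewrite big_nil.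
case Pi: (P i); last first.
  rewrite (_ : (fun z => _) = (fun z => \sum_(j <- s | P j) F j z)); first exact: IH.
  by apply/funext => z; rewrite big_cons Pi.
rewrite (_ : (fun z => _) = (fun z => F i z + \sum_(j <- s | P j) F j z)).
  exact: entireD (eF i) IH.
by apply/funext => z; rewrite big_cons Pi.
Qed.

Lemma entire_affine f (a b : R[i]) : entire f -> entire (fun z => f (a * z + b)).
Proof.
move=> /entireP ef; apply/entireP => z; have [d dP] := ef (a * z + b).
exists (d * a) => e e0.
have na : 0 < normc a + 1 by rewrite ltr_wpDl// normc_ge0.
have [del del0 H] := dP (e / (normc a + 1)) (divr_gt0 e0 na).
exists (del / (normc a + 1)); first exact: divr_gt0.
move=> h hd; have an : normc (a * h) <= (normc a + 1) * normc h.
  by rewrite normcM ler_wpM2r ?normc_ge0// lerDl.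
have := H (a * h) (le_lt_trans an _).
rewrite mulrC -ltr_pdivlMr// => /(_ hd).
rewrite (_ : _ + a * h = a * (z + h) + b); last by rewrite mulrDr addrAC.
rewrite mulrA => /le_trans; apply.
rewrite mulrAC ler_pdivrMr// -mulrA ler_wpM2l ?(ltW e0)//.
by rewrite mulrC; rewrite mulrC in an; rewrite [leRHS]mulrC.
Qed.
End entire_closure.

Lemma derive_eps (R : realType) (f : R -> R) (x d : R) : is_derive x 1 f d ->
  forall e, 0 < e -> exists2 del : R, 0 < del &
  forall h, `|h| < del -> `|f (x + h) - f x - d * h| <= e * `|h|.
Proof.
move=> df e e0.
have : (fun h => h^-1 *: ((f \o shift x) (h *: 1) - f x)) h @[h --> 0^'] --> d.
  by have [/cvg_ex[/= l ll] <-] := df; rewrite /derive (cvg_lim _ ll).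
move/cvgrPdist_lt => /(_ e e0); rewrite /dnbhs near_withinE => /nbhs_normP[del /= del0 H].
exists del => // h hd; have [->|h0] := eqVneq h 0.
  by rewrite addr0 mulr0 !subr0 subrr normr0 mulr0.
have := H h; rewrite /ball_ /= sub0r normrN => /(_ hd h0) H1.
rewrite -ler_pdivrMr ?normr_gt0// -normfV -normrM distrC in H1 *.
apply: ltW; move: H1; congr (`|_| < _).
rewrite /GRing.scale /= mulr1 [h + x]addrC [RHS]mulrBl mulfK//.
by rewrite [(_ - _) / _]mulrC.
Qed.

Definition cexp (R : realType) (z : R[i]) : R[i] :=
  (Complex (expR (complex.Re z) * cos (complex.Im z)) (expR (complex.Re z) * sin (complex.Im z))).

Section cexp.
Context {R : realType}.
Implicit Types (z w : R[i]).

Lemma cexpD z w : cexp (z + w) = cexp z * cexp w.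
Proof.
case: z => a b; case: w => c d; rewrite /cexp /=.
rewrite expRD cosD sinD; apply/eqP; rewrite eq_complex /=.
by apply/andP; split; apply/eqP; ring.
Qed.

Lemma normc_cexp z : normc (cexp z) = expR (complex.Re z).
Proof.
rewrite /cexp /normc /= !exprMn -mulrDr cos2Dsin2 mulr1 sqrtr_sqr.
by rewrite ger0_norm// expR_ge0.
Qed.

Lemma normc_le_ReIm z : normc z <= `|complex.Re z| + `|complex.Im z|.
Proof.
case: z => a b; rewrite /normc /= -[leRHS]ger0_norm ?addr_ge0// -sqrtr_sqr ler_sqrt ?sqr_ge0//.
by rewrite sqrrD !real_normK ?num_real//; have := mulr_ge0 (normr_ge0 a) (normr_ge0 b); lra.
Qed.

Lemma Re_le_normc z : `|complex.Re z| <= normc z.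
Proof.
by case: z => a b; rewrite /normc /= -sqrtr_sqr ler_sqrt ?addr_ge0 ?sqr_ge0// lerDl sqr_ge0.
Qed.

Lemma Im_le_normc z : `|complex.Im z| <= normc z.
Proof.
by case: z => a b; rewrite /normc /= -sqrtr_sqr ler_sqrt ?addr_ge0 ?sqr_ge0// lerDr sqr_ge0.
Qed.

(** The exponential law reduces the derivative of [cexp] to the one at the origin,
    which comes from the real functions exp, cos and sin. *)
Lemma cexp_deriv0 (e : R) : 0 < e -> exists2 del : R, 0 < del &
  forall h : R[i], normc h < del -> normc (cexp h - 1 - h) <= e * normc h.
Proof.
move=> e0; pose e' := Num.min (e / 8) 1.
have e'0 : 0 < e' by rewrite lt_min ltr01 divr_gt0.
have e'1 : e' <= 1 by rewrite ge_min lexx orbT.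
have e'e : e' <= e / 8 by rewrite ge_min lexx.
have [d1 d10 H1] := derive_eps (is_derive_expR (0 : R)) e'0.
have [d2 d20 H2] := derive_eps (is_derive_sin (0 : R)) e'0.
have [d3 d30 H3] := derive_eps (is_derive_cos (0 : R)) e'0.
exists (Num.min (Num.min d1 d2) (Num.min d3 (e' / 2))).
  by rewrite !lt_min d10 d20 d30 divr_gt0.
move=> h; rewrite !lt_min => /andP[/andP[hd1 hd2] /andP[hd3 hd4]].
have := Re_le_normc h; have := Im_le_normc h.
set a := complex.Re h; set b := complex.Im h.
have -> : cexp h - 1 - h = Complex (expR a * cos b - 1 - a) (expR a * sin b - 0 - b).
  by rewrite /cexp -/a -/b [in X in _ - X](_ : h = Complex a b)//; rewrite /a /b; case: (h).
move: hd1 hd2 hd3 hd4; move: (normc_ge0 h); move: (normc h) => N N0 hd1 hd2 hd3 hd4 bN aN.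
have := H1 a (le_lt_trans aN hd1); have := H2 b (le_lt_trans bN hd2); have := H3 b (le_lt_trans bN hd3).
rewrite !add0r expR0 sin0 cos0 oppr0 mul0r ?addr0 ?subr0 !mul1r => C S E.
have Ea : `|expR a - 1| <= 2 * N.
  rewrite (_ : expR a - 1 = (expR a - 1 - a) + a); last by ring.
  apply: (le_trans (ler_normD _ _)); rewrite (_ : 2 * N = N + N); last by ring.
  by apply: lerD => //; apply: (le_trans E); rewrite (le_trans _ aN)// ler_piMl.
have E3 : expR a <= 3.
  rewrite -(ger0_norm (expR_ge0 a)) (_ : expR a = (expR a - 1) + 1); last by ring.
  apply: (le_trans (ler_normD _ _)); rewrite normr1; lra.
apply: (le_trans (normc_le_ReIm _)) => /=.
rewrite (_ : expR a * cos b - 1 - a = expR a * (cos b - 1) + (expR a - 1 - a)); last by ring.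
rewrite ?addr0 ?subr0 (_ : expR a * sin b - b = expR a * (sin b - b) + (expR a - 1) * b); last by ring.
have T1 : `|expR a * (cos b - 1) + (expR a - 1 - a)| <= 3 * (e' * N) + e' * N.
  apply: (le_trans (ler_normD _ _)); rewrite normrM (ger0_norm (expR_ge0 _)).
  apply: lerD; last by apply: (le_trans E); rewrite ler_wpM2l// ltW.
  by rewrite ler_pM ?expR_ge0//; apply: (le_trans C); rewrite ler_wpM2l// ltW.
have T2 : `|expR a * (sin b - b) + (expR a - 1) * b| <= 3 * (e' * N) + e' * N.
  apply: (le_trans (ler_normD _ _)); rewrite !normrM (ger0_norm (expR_ge0 _)).
  apply: lerD; last first.
    apply: le_trans (_ : (2 * N) * N <= _); first exact: ler_pM.
    rewrite ler_wpM2r//; lra.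
  by rewrite ler_pM ?expR_ge0//; apply: (le_trans S); rewrite ler_wpM2l// ltW.
apply: (le_trans (lerD T1 T2)).
apply: le_trans (_ : (8 * e') * N <= _); first by apply: eqW; ring.
by rewrite ler_wpM2r//; lra.
Qed.

Lemma entire_cexp : entire (@cexp R).
Proof.
apply/entireP => z; exists (cexp z) => e e0.
have n0 : 0 < normc (cexp z) by rewrite normc_cexp expR_gt0.
have [del del0 H] := cexp_deriv0 (divr_gt0 e0 n0).
exists del => // h /H; rewrite mulrAC ler_pdivlMr// mulrC -normcM.
by rewrite cexpD !mulrBr mulr1.
Qed.
End cexp.

(** * Borel measurability of continuous functions on the plane *)

Section plane_measurability.
Context {R : realType}.

(** The sigma-algebra of the plane is generated by products of Borel sets; an open
    set is a countable union of rectangles with rational end points. *)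
Lemma open_measurable_plane (U : set (R * R)) : open U ->
  measurable (U : set (measurableTypeR R * measurableTypeR R)).
Proof.
move=> oU.
pose box (a b c d : rat) : set (R * R) := `]ratr a, ratr b[ `*` `]ratr c, ratr d[.
pose B a b c d := if `[< box a b c d `<=` U >] then box a b c d else set0.
rewrite (_ : U = \bigcup_(a : rat) \bigcup_(b : rat) \bigcup_(c : rat) \bigcup_(d : rat) B a b c d).
  do 4 (apply: bigcupT_measurable_rat => ?); rewrite /B; case: ifP => // _.
  exact: measurableX.
apply/seteqP; split => [[x y] Uxy|w [a _ [b _ [c _ [d _]]]]]; last first.
  by rewrite /B; case: ifPn => // /asboolP BU /BU.
have /nbhs_ballP[e /= e0 eU] : nbhs (x, y) U by exact: open_nbhs_nbhs.
have lt1 : x - e < x by rewrite ltrBlDr ltrDl.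
have lt2 : x < x + e by rewrite ltrDl.
have lt3 : y - e < y by rewrite ltrBlDr ltrDl.
have lt4 : y < y + e by rewrite ltrDl.
have [a] := rat_in_itvoo lt1; have [b] := rat_in_itvoo lt2.
have [c] := rat_in_itvoo lt3; have [d] := rat_in_itvoo lt4.
rewrite !in_itv /= => /andP[d1 d2] /andP[c1 c2] /andP[b1 b2] /andP[a1 a2].
exists a => //; exists b => //; exists c => //; exists d => //.
rewrite /B ifT; first by split; rewrite /= in_itv /= ?a2 ?c2.
apply/asboolP => -[u v] [/=]; rewrite !in_itv /= => /andP[u1 u2] /andP[v1 v2].
apply: eU; split; rewrite /ball /= ltr_norml; apply/andP; split; lra.
Qed.

Lemma continuous_measurable_plane (F : R * R -> R) : continuous F ->
  measurable_fun setT (F : plane R -> R).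
Proof.
move=> /continuousP cF; apply: (measurability _ (measurable_realfun.RGenOpens.measurableE R)).
move=> _ [_ [a [b ->] <-]]; rewrite setTI; apply: open_measurable_plane.
exact/cF/interval_open.
Qed.

End plane_measurability.

Section complex_continuity.
Context {R : realType}.

Lemma to_C_continuous : continuous (@to_C R : R * R -> R[i]^o).
Proof.
move=> [x y]; apply/cvgrPdist_lt => /= e e0; have [er e1] := gt0_real e0.
apply: (filterS _ (nbhsx_ballx ((x, y) : R * R) _ (_ : 0 < complex.Re e / 2))); last by rewrite divr_gt0.
move=> [u v] [/= xu yv]; rewrite normE er ltcR.
apply: (le_lt_trans (normc_le_ReIm _)) => /=.
by rewrite [ltRHS](splitr (complex.Re e)); exact: ltrD.
Qed.

Lemma normc_continuous : continuous (@normc R : R[i]^o -> R).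
Proof.
move=> z; have ? := nbhs_filter (z : R[i]^o).
apply: (cvgrPdist_lt _ _).2 => e e0; have e0' : 0 < (e%:C)%C by rewrite ltcR.
exists (e%:C)%C => // w; rewrite /ball_ /= normE ltcR ltr_distl => zw.
have := le_normcD (z - w) w; have := le_normcD (w - z) z; rewrite !subrK normc_subC.
by move=> *; apply/andP; split; lra.
Qed.

Lemma entire_continuous (f : R[i] -> R[i]) : entire f -> continuous (f : R[i]^o -> R[i]^o).
Proof. by move=> ef z; apply: differentiable_continuous; apply/derivable1_diffP; exact: ef. Qed.

Lemma entire_normc_continuous (f : R[i] -> R[i]) : entire f ->
  continuous (fun w : R * R => normc (f (to_C w))).
Proof.
move=> ef w.
apply: (@continuous_comp _ R[i]^o _ (fun w => f (to_C w) : R[i]^o) (@normc R)).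
  apply: (@continuous_comp _ R[i]^o R[i]^o (@to_C R) f).
    exact: to_C_continuous.
  exact: entire_continuous.
exact: normc_continuous.
Qed.

Lemma measurable_normc_entire (f : R[i] -> R[i]) : entire f ->
  measurable_fun setT (fun w : plane R => normc (f (to_C w))).
Proof. by move=> ef; apply: continuous_measurable_plane; exact: entire_normc_continuous. Qed.

Lemma measurable_normc_toC :
  measurable_fun setT (fun w : plane R => normc (to_C w)).
Proof. exact: (measurable_normc_entire entire_id). Qed.
End complex_continuity.

(** * Affine changes of variables in the plane *)

Section affine_change.
Context {R : realType}.
Notation mu := (@lebesgue_measure R).
Notation TR := (measurableTypeR R).
Local Open Scope ereal_scope.

Definition affR (c d : R) : TR -> TR := fun x => (c * x + d)%R.

Lemma measurable_affR c d : measurable_fun setT (affR c d).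
Proof. by apply: measurable_funD => //; exact: measurable_funM. Qed.

(** Lebesgue measure is determined by the lengths of half-open intervals, so it is
    the image measure rescaled by |c|. *)
Lemma lebesgue_measure_affR (c d : R) : c != 0%R -> forall A : set TR, measurable A ->
  mu (affR c d @^-1` A) = (`|c|^-1)%:E * mu A.
Proof.
move=> c0 A mA.
have nc0 : (0 <= `|c|)%R by [].
pose nu' : {measure set TR -> \bar R} :=
  mscale (NngNum nc0) (pushforward mu (affR c d)).
pose nu := nu' (measurable_affR c d).
have : mu A = nu A.
  apply: lebesgue_measure_unique => // _ [[a b]] _ <- /=.
  rewrite /nu /nu' /= /mscale /= /pushforward /=.
  have [cp|cn] : (0 < c \/ c < 0)%R by apply/orP; rewrite -neq_lt eq_sym.
  - rewrite (_ : affR c d @^-1` _ = `]((a - d) / c)%R, ((b - d)%R / c)%R]%classic); last first.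
      apply/seteqP; split => x /=; rewrite !in_itv /= /affR;
      by rewrite ltr_pdivrMr// ler_pdivlMr// ltrBlDr lerBrDr mulrC.
    rewrite !lebesgue_measure_itv /= !lte_fin ltr_pM2r ?invr_gt0// ltrD2r.
    case: ifP => _; last by rewrite mule0.
    by rewrite !EFinN -!EFinB -EFinM gtr0_norm//; congr EFin; field; rewrite gt_eqF.
  - rewrite (_ : affR c d @^-1` _ = `[((b - d) / c)%R, ((a - d) / c)%R[%classic); last first.
      apply/seteqP; split => x /=; rewrite !in_itv /= /affR;
      by rewrite ltr_ndivlMr// ler_ndivrMr// ltrBlDr lerBrDr andbC mulrC.
    rewrite !lebesgue_measure_itv /= !lte_fin ltr_nM2r ?invr_lt0// ltrD2r.
    case: ifP => _; last by rewrite mule0.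
    by rewrite !EFinN -!EFinB -EFinM ltr0_norm//; congr EFin; field; rewrite lt_eqF.
move=> ->; rewrite /nu /nu' /= /mscale /= muleA -EFinM mulVf ?normr_eq0// mul1e.
by [].
Qed.

Lemma ge0_integral_affR (c d : R) (f : TR -> \bar R) : c != 0%R ->
  measurable_fun setT f -> (forall x, 0 <= f x) ->
  \int[mu]_x f (c * x + d)%R = (`|c|^-1)%:E * \int[mu]_x f x.
Proof.
move=> c0 mf f0.
have := @ge0_integral_pushforward _ _ _ _ _ _ (measurable_affR c d) mu setT f measurableT mf.
rewrite preimage_setT => /(_ _)<-; last by move=> y _; exact: f0.
have nc0 : (0 <= `|c|^-1)%R by rewrite invr_ge0.
rewrite -(@ge0_integral_mscale _ _ _ mu setT _ (NngNum nc0) f)//.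
apply: eq_measure_integral => [|mm A mA _]; first exact: measurable_affR.
by rewrite /mscale /=; exact: lebesgue_measure_affR.
Qed.

Lemma measurable_shear2 (a b c : R) :
  measurable_fun setT (fun w : TR * TR => ((w.1, (a * w.1 + b * w.2 + c)%R) : TR * TR)).
Proof.
apply/measurable_fun_pair => //.
apply: measurable_funD => //; apply: measurable_funD; exact: measurable_funM.
Qed.

Lemma measurable_shear1 (a b c : R) :
  measurable_fun setT (fun w : TR * TR => (((a * w.1 + b * w.2 + c)%R, w.2) : TR * TR)).
Proof.
apply/measurable_fun_pair => //.
apply: measurable_funD => //; apply: measurable_funD; exact: measurable_funM.
Qed.

Variables (g : TR * TR -> \bar R).
Hypotheses (mg : measurable_fun setT g) (g0 : forall w, 0 <= g w).

Lemma integral_shear2 (a b c : R) : b != 0%R ->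
  \int[@dA R]_w g (w.1, (a * w.1 + b * w.2 + c)%R) = (`|b|^-1)%:E * \int[@dA R]_w g w.
Proof.
move=> b0; have mS := measurableT_comp mg (measurable_shear2 a b c).
rewrite /dA [LHS](fubini_tonelli1 _ mS (fun=> g0 _)).
rewrite fubini_tonelli1//= -ge0_integralZl//; first last.
- by move=> x _; apply: integral_ge0.
- exact: measurable_fun_fubini_tonelli_F.
apply: eq_integral => x _; rewrite /fubini_F /=.
rewrite -(@ge0_integral_affR b (a * x + c)%R (fun y => g (x, y)))//; last first.
  by apply: (measurableT_comp mg).
by apply: eq_integral => y _; congr (g (_, _)); ring.
Qed.

Lemma integral_shear1 (a b c : R) : a != 0%R ->
  \int[@dA R]_w g ((a * w.1 + b * w.2 + c)%R, w.2) = (`|a|^-1)%:E * \int[@dA R]_w g w.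
Proof.
move=> a0; have mS := measurableT_comp mg (measurable_shear1 a b c).
rewrite /dA [LHS](fubini_tonelli2 _ mS (fun=> g0 _)).
rewrite fubini_tonelli2//= -ge0_integralZl//; first last.
- by move=> x _; apply: integral_ge0.
- exact: measurable_fun_fubini_tonelli_G.
apply: eq_integral => y _; rewrite /fubini_G /=.
rewrite -(@ge0_integral_affR a (b * y + c)%R (fun x => g (x, y)))//; last first.
  by apply: (measurableT_comp mg).
by apply: eq_integral => x _; congr (g (_, _)); ring.
Qed.

Lemma integral_swap_plane : \int[@dA R]_w g (w.2, w.1) = \int[@dA R]_w g w.
Proof.
have mS : measurable_fun setT (fun w : TR * TR => (w.2, w.1)) by exact/measurable_fun_pair.
rewrite /dA [LHS](fubini_tonelli2 _ (measurableT_comp mg mS) (fun=> g0 _)).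
by rewrite fubini_tonelli1.
Qed.
End affine_change.

Section complex_change.
Context {R : realType}.
Local Open Scope ereal_scope.

Lemma normcE (z : R[i]) : (normc z ^+ 2 = complex.Re z ^+ 2 + complex.Im z ^+ 2)%R.
Proof. by case: z => x y; rewrite /normc /= sqr_sqrtr// addr_ge0// sqr_ge0. Qed.

Definition of_C (z : R[i]) : plane R := (complex.Re z, complex.Im z).

Lemma of_CK (z : R[i]) : to_C (of_C z) = z. Proof. by case: z. Qed.

(** Multiplication by a complex number is a product of two shears, one along each
    axis, when its real part is not 0, and of a swap and two rescalings of the
    coordinates otherwise. Tonelli and the substitution on the line give the factor
    of each of them. *)
Lemma integral_affine (a b : R[i]) (g : plane R -> \bar R) : a != 0%R ->
  measurable_fun setT g -> (forall w, 0 <= g w) ->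
  \int[@dA R]_w g (of_C (a * to_C w + b)%R) = (normc a ^- 2)%:E * \int[@dA R]_w g w.
Proof.
case: a => u v; case: b => e f; move=> a0 mg g0.
have E w : of_C (Complex u v * to_C w + Complex e f)%R =
    ((u * w.1 - v * w.2 + e)%R, (v * w.1 + u * w.2 + f)%R).
  by rewrite /of_C /=; congr (_, _); ring.
rewrite normcE /=.
under eq_integral do rewrite E.
have uv0 : (u ^+ 2 + v ^+ 2 != 0)%R.
  apply: contra a0; rewrite paddr_eq0 ?sqr_ge0// !sqrf_eq0 => /andP[/eqP -> /eqP ->].
  exact/eqP.
have [u0|u0] := eqVneq u 0%R.
  have v0 : (v != 0)%R by apply: contra uv0 => /eqP ->; rewrite u0 !expr0n addr0.
  have v0' : (- v != 0)%R by rewrite oppr_eq0.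
  pose g1 (w : plane R) := g ((- v * w.1 + 0 * w.2 + e)%R, w.2).
  have m1 : measurable_fun setT g1 := measurableT_comp mg (measurable_shear1 _ _ _).
  pose g2 (w : plane R) := g1 (w.1, (0 * w.1 + v * w.2 + f)%R).
  have m2 : measurable_fun setT g2 := measurableT_comp m1 (measurable_shear2 _ _ _).
  transitivity (\int[@dA R]_w g2 (w.2, w.1)).
    by apply: eq_integral => w _; rewrite /g2 /g1 /= u0; congr (g (_, _)); ring.
  rewrite (integral_swap_plane m2 (fun=> g0 _)).
  transitivity ((`|v|^-1)%:E * ((`|- v|^-1)%:E * \int[@dA R]_w g w)).
    rewrite -(integral_shear1 mg g0 0 e v0'); exact: (integral_shear2 m1 (fun=> g0 _) 0%R f v0).
  by rewrite muleA -EFinM normrN -invfM -normrM -expr2 u0 expr0n add0r ger0_norm// sqr_ge0.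
pose g1 (w : plane R) := g (w.1, (v / u * w.1 + (u ^+ 2 + v ^+ 2) / u * w.2 + (f - v * e / u))%R).
have m1 : measurable_fun setT g1 := measurableT_comp mg (measurable_shear2 _ _ _).
transitivity (\int[@dA R]_w g1 ((u * w.1 + - v * w.2 + e)%R, w.2)).
  apply: eq_integral => w _; rewrite /g1 /=; congr (g (_, _)); first by ring.
  by field.
have c0 : ((u ^+ 2 + v ^+ 2) / u != 0)%R by rewrite mulf_neq0// invr_eq0.
rewrite (integral_shear1 m1 (fun=> g0 _) _ _ u0).
rewrite [X in _ * X](integral_shear2 mg g0 (v / u) (f - v * e / u) c0).
rewrite muleA -EFinM; congr (_%:E * _).
rewrite normrM normfV (ger0_norm (addr_ge0 (sqr_ge0 _) (sqr_ge0 _))).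
by rewrite invfM invrK mulrCA mulVf ?mulr1// normr_eq0.
Qed.
End complex_change.

(** * Integrals over segments *)

Section segment_integral.
Context {R : realType}.
Implicit Types (a b c : R) (f g : R -> R).
Notation mu := (@lebesgue_measure R).

Definition seg_int a b f : R := (\int[mu]_(x in `[a, b]) f x)%R.
Definition cont_on a b f := forall x, a <= x <= b -> {for x, continuous f}.

Lemma cont_on_cst a b (k : R) : cont_on a b (fun=> k).
Proof. by move=> x _; exact: cst_continuous. Qed.

Lemma cont_onD a b f g : cont_on a b f -> cont_on a b g -> cont_on a b (fun x => f x + g x).
Proof. by move=> cf cg x xab; apply: cvgD; [exact: cf|exact: cg]. Qed.

Lemma cont_onB a b f g : cont_on a b f -> cont_on a b g -> cont_on a b (fun x => f x - g x).
Proof. by move=> cf cg x xab; apply: cvgB; [exact: cf|exact: cg]. Qed.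

Lemma cont_onM a b f g : cont_on a b f -> cont_on a b g -> cont_on a b (fun x => f x * g x).
Proof. by move=> cf cg x xab; apply: cvgM; [exact: cf|exact: cg]. Qed.

Lemma cont_on_integrable a b f : cont_on a b f -> mu.-integrable `[a, b] (EFin \o f).
Proof.
move=> cf; apply: continuous_compact_integrable; first exact: segment_compact.
apply: continuous_in_subspaceT => x; rewrite inE /= in_itv /=; exact: cf.
Qed.

Lemma seg_int_split a b c f : a <= c -> c <= b -> cont_on a b f ->
  seg_int a b f = seg_int a c f + seg_int c b f.
Proof.
move=> ac cb cf; rewrite /seg_int.
have /cont_on_integrable fi := cf.
have := @Rintegral_itvB _ f (BLeft a) (BRight b) c fi.
rewrite !bnd_simp => /(_ ac cb); rewrite Rintegral_itv_obnd_cbnd.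
  by move=> <-; rewrite addrC subrK.
apply: integrableS fi => //.
by apply: subset_itvr; rewrite bnd_simp.
Qed.

Lemma seg_intD a b f g : cont_on a b f -> cont_on a b g ->
  seg_int a b (fun x => f x + g x) = seg_int a b f + seg_int a b g.
Proof. by move=> /cont_on_integrable fi /cont_on_integrable gi; rewrite /seg_int RintegralD. Qed.

Lemma seg_intB a b f g : cont_on a b f -> cont_on a b g ->
  seg_int a b (fun x => f x - g x) = seg_int a b f - seg_int a b g.
Proof. by move=> /cont_on_integrable fi /cont_on_integrable gi; rewrite /seg_int RintegralB. Qed.

Lemma seg_intZ a b k f : cont_on a b f ->
  seg_int a b (fun x => k * f x) = k * seg_int a b f.
Proof. by move=> /cont_on_integrable fi; rewrite /seg_int RintegralZl. Qed.

Lemma eq_seg_int a b f g : (forall x, a <= x <= b -> f x = g x) -> seg_int a b f = seg_int a b g.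
Proof.
by move=> fg; apply: eq_Rintegral => x; rewrite inE /= in_itv /= => /fg.
Qed.

Lemma seg_int_cst a b k : a <= b -> seg_int a b (fun=> k) = k * (b - a).
Proof.
move=> ab; rewrite /seg_int Rintegral_cst//; congr (_ * _).
rewrite [X in fine X](_ : _ = (b - a)%:E)//.
rewrite [LHS](lebesgue_measure_itv `[a, b]) /= lte_fin.
by case: ltgtP ab => // -> _; rewrite subrr.
Qed.

Lemma le_seg_int a b f g : cont_on a b f -> cont_on a b g ->
  (forall x, a <= x <= b -> f x <= g x) -> seg_int a b f <= seg_int a b g.
Proof.
move=> /cont_on_integrable fi /cont_on_integrable gi fg.
by apply: le_Rintegral => // x; rewrite /= in_itv /=; exact: fg.
Qed.

Lemma le_norm_seg_int a b f : cont_on a b f ->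
  `|seg_int a b f| <= seg_int a b (fun x => `|f x|).
Proof. by move=> /cont_on_integrable fi; exact: le_normr_Rintegral. Qed.

Lemma cont_on_norm a b f : cont_on a b f -> cont_on a b (fun x => `|f x|).
Proof. by move=> cf x xab; apply: (continuous_comp (cf x xab)); exact: norm_continuous. Qed.

Lemma seg_int_bound a b f (M : R) : a <= b -> cont_on a b f ->
  (forall x, a <= x <= b -> `|f x| <= M) -> `|seg_int a b f| <= M * (b - a).
Proof.
move=> ab cf fM; apply: (le_trans (le_norm_seg_int cf)).
rewrite -seg_int_cst//; apply: le_seg_int => //; [exact: cont_on_norm|exact: cont_on_cst].
Qed.

End segment_integral.

(** * Circulation around rectangles and the theorem of Goursat *)

Section goursat.
Context {R : realType}.
Implicit Types (P Q : R -> R -> R).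

(** Total differentiability at (a, b), with [A] and [B] the partial derivatives. *)
Definition dif2 P (a b A B : R) := forall e, 0 < e -> exists2 d, 0 < d &
  forall x y, `|x - a| < d -> `|y - b| < d ->
    `|P x y - P a b - A * (x - a) - B * (y - b)| <= e * (`|x - a| + `|y - b|).

(** The shared coefficient [B] says that the form P dx + Q dy is closed at (a, b). *)
Definition closed_at P Q (a b : R) := exists A B C : R, dif2 P a b A B /\ dif2 Q a b B C.

(** The integral of P dx + Q dy along the boundary, counterclockwise. Working with
    real forms lets the real and the imaginary part of f(z) dz use the same lemmas. *)
Definition circ P Q (x0 x1 y0 y1 : R) :=
  seg_int x0 x1 (fun x => P x y0 - P x y1) + seg_int y0 y1 (fun y => Q x1 y - Q x0 y).

Lemma dif2_cont1 P a b A B : dif2 P a b A B -> {for a, continuous (P ^~ b)}.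
Proof.
move=> dP; apply/cvgrPdist_le => /= e e0.
have [d d0 H] := dP 1 ltr01.
have K0 : 0 < 1 + `|A| by rewrite ltr_pwDl.
have d'0 : 0 < Num.min d (e / (1 + `|A|)) by rewrite lt_min d0 divr_gt0.
near=> x.
have : `|a - x| < Num.min d (e / (1 + `|A|)) by near: x; exact: cvgr_dist_lt.
rewrite lt_min distrC ltr_pdivlMr// => /andP[xd xe].
have := H x b xd; rewrite subrr normr0 mulr0 subr0 addr0 mul1r => /(_ d0) h.
rewrite distrC (_ : P x b - P a b = (P x b - P a b - A * (x - a)) + A * (x - a)); last by ring.
apply: (le_trans (ler_normD _ _)); rewrite normrM; apply: le_trans (ltW xe); lra.
Unshelve. all: by end_near. Qed.

Lemma dif2_cont2 P a b A B : dif2 P a b A B -> {for b, continuous (P a)}.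
Proof.
move=> dP; apply: (@dif2_cont1 (fun x y => P y x) b a B A) => e e0.
have [d d0 H] := dP e e0; exists d => // x y xb ya.
by have := H y x ya xb; rewrite [X in e * X]addrC addrAC.
Qed.

Lemma circ_splitx P Q x0 x1 y0 y1 c : x0 <= c -> c <= x1 ->
  cont_on x0 x1 (P ^~ y0) -> cont_on x0 x1 (P ^~ y1) ->
  cont_on y0 y1 (Q x0) -> cont_on y0 y1 (Q c) -> cont_on y0 y1 (Q x1) ->
  circ P Q x0 x1 y0 y1 = circ P Q x0 c y0 y1 + circ P Q c x1 y0 y1.
Proof.
move=> x0c cx1 cp0 cp1 cq0 cqc cq1; rewrite /circ.
rewrite (seg_int_split x0c cx1); last exact: cont_onB.
by rewrite (seg_intB cq1 cq0) (seg_intB cqc cq0) (seg_intB cq1 cqc); ring.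
Qed.

Lemma circ_splity P Q x0 x1 y0 y1 c : y0 <= c -> c <= y1 ->
  cont_on y0 y1 (Q x0) -> cont_on y0 y1 (Q x1) ->
  cont_on x0 x1 (P ^~ y0) -> cont_on x0 x1 (P ^~ c) -> cont_on x0 x1 (P ^~ y1) ->
  circ P Q x0 x1 y0 y1 = circ P Q x0 x1 y0 c + circ P Q x0 x1 c y1.
Proof.
move=> y0c cy1 cq0 cq1 cp0 cpc cp1; rewrite /circ.
rewrite (seg_int_split y0c cy1); last exact: cont_onB.
by rewrite (seg_intB cp0 cp1) (seg_intB cp0 cpc) (seg_intB cpc cp1); ring.
Qed.

(** The affine part of the form at a point where it is closed has no circulation,
    and the first-order remainder is small compared with the size of the rectangle,
    which gives a quadratic bound after integration. *)
Lemma circ_local P Q a b (e : R) : closed_at P Q a b -> 0 < e ->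
  exists2 d, 0 < d & forall x0 x1 y0 y1, x0 <= a <= x1 -> y0 <= b <= y1 ->
    x1 - x0 < d -> y1 - y0 < d ->
    cont_on x0 x1 (P ^~ y0) -> cont_on x0 x1 (P ^~ y1) ->
    cont_on y0 y1 (Q x0) -> cont_on y0 y1 (Q x1) ->
    `|circ P Q x0 x1 y0 y1| <= 2 * e * ((x1 - x0) + (y1 - y0)) ^+ 2.
Proof.
move=> [A [B [C [dP dQ]]]] e0.
have [d1 d10 H1] := dP e e0; have [d2 d20 H2] := dQ e e0.
exists (Num.min d1 d2); first by rewrite lt_min d10.
move=> x0 x1 y0 y1 /andP[x0a ax1] /andP[y0b by1].
rewrite !lt_min => /andP[hx1 hx2] /andP[hy1 hy2] cp0 cp1 cq0 cq1.
set hx := x1 - x0 in hx1 hx2 *; set hy := y1 - y0 in hy1 hy2 *.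
have hx0 : 0 <= hx by rewrite /hx; lra.
have hy0 : 0 <= hy by rewrite /hy; lra.
have bx x : x0 <= x <= x1 -> `|x - a| <= hx.
  by move=> /andP[? ?]; rewrite ler_norml /hx; apply/andP; split; lra.
have bY y : y0 <= y <= y1 -> `|y - b| <= hy.
  by move=> /andP[? ?]; rewrite ler_norml /hy; apply/andP; split; lra.
have i0 : y0 <= y0 <= y1 by rewrite lexx /=; lra.
have i1 : y0 <= y1 <= y1 by rewrite lexx andbT; lra.
have j0 : x0 <= x0 <= x1 by rewrite lexx /=; lra.
have j1 : x0 <= x1 <= x1 by rewrite lexx andbT; lra.
have EP x y : x0 <= x <= x1 -> y0 <= y <= y1 ->
    `|P x y - P a b - A * (x - a) - B * (y - b)| <= e * (hx + hy).
  move=> xi yi; apply: (le_trans (H1 _ _ (le_lt_trans (bx _ xi) hx1) (le_lt_trans (bY _ yi) hy1))).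
  by rewrite ler_wpM2l ?(ltW e0)// lerD ?bx ?bY.
have EQ x y : x0 <= x <= x1 -> y0 <= y <= y1 ->
    `|Q x y - Q a b - B * (x - a) - C * (y - b)| <= e * (hx + hy).
  move=> xi yi; apply: (le_trans (H2 _ _ (le_lt_trans (bx _ xi) hx2) (le_lt_trans (bY _ yi) hy2))).
  by rewrite ler_wpM2l ?(ltW e0)// lerD ?bx ?bY.
have x01 : x0 <= x1 by lra.
have y01 : y0 <= y1 by lra.
(* adding [B * hy] and subtracting [B * hx] cancels the linear terms of each
   integrand; both corrections integrate to the same number *)
have -> : circ P Q x0 x1 y0 y1 = seg_int x0 x1 (fun x => P x y0 - P x y1 + B * hy) +
    seg_int y0 y1 (fun y => Q x1 y - Q x0 y - B * hx).
  rewrite /circ (seg_intD (cont_onB cp0 cp1) (@cont_on_cst R x0 x1 (B * hy))).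
  rewrite (seg_intB (cont_onB cq1 cq0) (@cont_on_cst R y0 y1 (B * hx))).
  by rewrite !seg_int_cst// -/hx -/hy; ring.
apply: (le_trans (ler_normD _ _)).
rewrite (_ : 2 * e * _ = 2 * e * (hx + hy) * hx + 2 * e * (hx + hy) * hy); last by ring.
apply: lerD; apply: seg_int_bound => //.
- by apply: cont_onD; [exact: cont_onB|exact: cont_on_cst].
- move=> x xi; have E0 := EP _ _ xi i0; have E1 := EP _ _ xi i1.
  rewrite (_ : _ + B * hy = (P x y0 - P a b - A * (x - a) - B * (y0 - b)) -
     (P x y1 - P a b - A * (x - a) - B * (y1 - b))); last by rewrite /hy; ring.
  by apply: (le_trans (ler_normB _ _)); lra.
- by apply: cont_onB; [exact: cont_onB|exact: cont_on_cst].
- move=> y yi; have E0 := EQ _ _ j0 yi; have E1 := EQ _ _ j1 yi.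
  rewrite (_ : _ - B * hx = (Q x1 y - Q a b - B * (x1 - a) - C * (y - b)) -
     (Q x0 y - Q a b - B * (x0 - a) - C * (y - b))); last by rewrite /hx; ring.
  by apply: (le_trans (ler_normB _ _)); lra.
Qed.

End goursat.

Section goursat_theorem.
Context {R : realType}.
Implicit Types (P Q : R -> R -> R).

Record rect := Rect { rx0 : R; rx1 : R; ry0 : R; ry1 : R }.
Definition rcirc P Q (r : rect) := circ P Q (rx0 r) (rx1 r) (ry0 r) (ry1 r).
Definition rok (r : rect) := rx0 r <= rx1 r /\ ry0 r <= ry1 r.
Definition rsub (s r : rect) :=
  [/\ rx0 r <= rx0 s, rx1 s <= rx1 r, ry0 r <= ry0 s & ry1 s <= ry1 r].
Definition rclosed P Q (r : rect) := forall a b,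
  rx0 r <= a <= rx1 r -> ry0 r <= b <= ry1 r -> closed_at P Q a b.

Lemma rsub_closed P Q r s : rsub s r -> rclosed P Q r -> rclosed P Q s.
Proof.
move=> [h1 h2 h3 h4] cr a b /andP[a1 a2] /andP[b1 b2].
by apply: cr; apply/andP; split; lra.
Qed.

Lemma closed_contP P Q x0 x1 b : (forall a, x0 <= a <= x1 -> closed_at P Q a b) ->
  cont_on x0 x1 (P ^~ b).
Proof. by move=> H a /H [A [B [C [dP _]]]]; exact: dif2_cont1 dP. Qed.

Lemma closed_contQ P Q y0 y1 a : (forall b, y0 <= b <= y1 -> closed_at P Q a b) ->
  cont_on y0 y1 (Q a).
Proof. by move=> H b /H [A [B [C [_ dQ]]]]; exact: dif2_cont2 dQ. Qed.

(** The circulation is the sum of those around the four quarters, so one of the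
    quarters carries at least a fourth of it. *)
Lemma quarter P Q r : rok r -> rclosed P Q r -> exists s, [/\ rok s, rsub s r,
  rx1 s - rx0 s = (rx1 r - rx0 r) / 2, ry1 s - ry0 s = (ry1 r - ry0 r) / 2 &
  `|rcirc P Q r| <= 4 * `|rcirc P Q s| ].
Proof.
case: r => x0 x1 y0 y1 [/= hx hy] cr.
pose c := (x0 + x1) / 2; pose d := (y0 + y1) / 2.
have xc : x0 <= c by rewrite /c; lra.
have cx : c <= x1 by rewrite /c; lra.
have yd : y0 <= d by rewrite /d; lra.
have dy : d <= y1 by rewrite /d; lra.
have cP u v b : x0 <= u -> v <= x1 -> y0 <= b <= y1 -> cont_on u v (P ^~ b).
  move=> h1 h2 h3; apply: (@closed_contP P Q) => a /andP[a1 a2].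
  by apply: cr => //=; apply/andP; split; lra.
have cQ u v a : y0 <= u -> v <= y1 -> x0 <= a <= x1 -> cont_on u v (Q a).
  move=> h1 h2 h3; apply: (@closed_contQ P Q) => b /andP[b1 b2].
  by apply: cr => //=; apply/andP; split; lra.
have i0 : y0 <= y0 <= y1 by rewrite lexx.
have i1 : y0 <= y1 <= y1 by rewrite lexx andbT.
have i2 : y0 <= d <= y1 by rewrite yd.
have j0 : x0 <= x0 <= x1 by rewrite lexx.
have j1 : x0 <= x1 <= x1 by rewrite lexx andbT.
have j2 : x0 <= c <= x1 by rewrite xc.
have E : rcirc P Q (Rect x0 x1 y0 y1) =
   (rcirc P Q (Rect x0 c y0 d) + rcirc P Q (Rect x0 c d y1)) +
   (rcirc P Q (Rect c x1 y0 d) + rcirc P Q (Rect c x1 d y1)).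
  rewrite /rcirc /= (@circ_splitx _ P Q x0 x1 y0 y1 c)//; try exact: cP; try exact: cQ.
  rewrite (@circ_splity _ P Q x0 c y0 y1 d)//; try exact: cP; try exact: cQ.
  by rewrite (@circ_splity _ P Q c x1 y0 y1 d)//; try exact: cP; try exact: cQ.
have [|h1] := lerP `|rcirc P Q (Rect x0 x1 y0 y1)| (4 * `|rcirc P Q (Rect x0 c y0 d)|).
  by exists (Rect x0 c y0 d); split; [split|split| | |] => //=; rewrite ?/c ?/d; lra.
have [|h2] := lerP `|rcirc P Q (Rect x0 x1 y0 y1)| (4 * `|rcirc P Q (Rect x0 c d y1)|).
  by exists (Rect x0 c d y1); split; [split|split| | |] => //=; rewrite ?/c ?/d; lra.
have [|h3] := lerP `|rcirc P Q (Rect x0 x1 y0 y1)| (4 * `|rcirc P Q (Rect c x1 y0 d)|).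
  by exists (Rect c x1 y0 d); split; [split|split| | |] => //=; rewrite ?/c ?/d; lra.
exists (Rect c x1 d y1); split; [split|split| | |] => //=; try (rewrite /c; lra); try (rewrite /d; lra).
move: E h1 h2 h3; move: (rcirc _ _ _) => S; move: (rcirc _ _ _) => A1.
move: (rcirc _ _ _) => A2; move: (rcirc _ _ _) => A3; move: (rcirc _ _ _) => A4.
move=> E h1 h2 h3; have g1 := ler_normD (A1 + A2) (A3 + A4).
have g2 := ler_normD A1 A2; have g3 := ler_normD A3 A4; rewrite -E in g1.
lra.
Qed.

(** Iterated quartering shrinks to a point, where [circ_local] bounds the
    circulation by an arbitrarily small multiple of 4^-n; this is the factor that
    n quarterings may lose. *)
Theorem goursat P Q r : rok r -> rclosed P Q r -> rcirc P Q r = 0.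
Proof.
move=> okr clr.
have /choice[q qP] : forall s, exists t, rok s -> rsub s r -> [/\ rok t, rsub t s,
     rx1 t - rx0 t = (rx1 s - rx0 s) / 2, ry1 t - ry0 t = (ry1 s - ry0 s) / 2 &
    `|rcirc P Q s| <= 4 * `|rcirc P Q t| ].
  move=> s; have [[oks ssr]|n] := pselect (rok s /\ rsub s r); last by exists s => ? ?; exfalso; apply: n.
  by have [t tP] := quarter oks (rsub_closed ssr clr); exists t.
pose s n := iter n q r.
have sP n : rok (s n) /\ rsub (s n) r.
  elim: n => [|n [ok sub]]; first by split=> //; split.
  have [ok' [a1 a2 a3 a4] _ _ _] := qP _ ok sub; split=> //.
  by case: sub => b1 b2 b3 b4; split; rewrite /s iterS -/(s n); lra.
have sS n : rsub (s n.+1) (s n) by have [ok sub] := sP n; have [] := qP _ ok sub.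
have smono n k : rsub (s (n + k)%N) (s n).
  elim: k => [|k [a1 a2 a3 a4]]; first by rewrite addn0; split.
  by rewrite addnS; have [b1 b2 b3 b4] := sS (n + k)%N; split; lra.
have sx n : rx1 (s n) - rx0 (s n) = (rx1 r - rx0 r) / 2 ^+ n.
  elim: n => [|n IH]; first by rewrite expr0 divr1.
  have [ok sub] := sP n; have [_ _ E _ _] := qP _ ok sub.
  by rewrite /s iterS -/(s n) E IH exprS invfM; ring.
have sy n : ry1 (s n) - ry0 (s n) = (ry1 r - ry0 r) / 2 ^+ n.
  elim: n => [|n IH]; first by rewrite expr0 divr1.
  have [ok sub] := sP n; have [_ _ _ E _] := qP _ ok sub.
  by rewrite /s iterS -/(s n) E IH exprS invfM; ring.
have sc n : `|rcirc P Q r| <= 4 ^+ n * `|rcirc P Q (s n)|.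
  elim: n => [|n IH]; first by rewrite expr0 mul1r.
  have [ok sub] := sP n; have [_ _ _ _ E] := qP _ ok sub.
  by apply: (le_trans IH); rewrite exprSr -mulrA ler_wpM2l ?exprn_ge0.
have xx n m : rx0 (s n) <= rx1 (s m).
  have [a1 a2 _ _] := smono n m; have [b1 b2 _ _] := smono m n; rewrite addnC in b1 b2.
  by have [[h _] _] := sP (n + m)%N; lra.
have yy n m : ry0 (s n) <= ry1 (s m).
  have [_ _ a1 a2] := smono n m; have [_ _ b1 b2] := smono m n; rewrite addnC in b1 b2.
  by have [[_ h] _] := sP (n + m)%N; lra.
pose a := sup (range (fun n => rx0 (s n))); pose b := sup (range (fun n => ry0 (s n))).
have an n : rx0 (s n) <= a <= rx1 (s n).
  apply/andP; split; last by apply: ge_sup; [by exists (rx0 (s 0)); exists 0 | move=> _ [m _ <-]].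
  by apply: ub_le_sup; [by exists (rx1 (s 0)) => _ [m _ <-] | exists n].
have bn n : ry0 (s n) <= b <= ry1 (s n).
  apply/andP; split; last by apply: ge_sup; [by exists (ry0 (s 0)); exists 0 | move=> _ [m _ <-]].
  by apply: ub_le_sup; [by exists (ry1 (s 0)) => _ [m _ <-] | exists n].
pose L := (rx1 r - rx0 r) + (ry1 r - ry0 r).
have Lx0 : 0 <= rx1 r - rx0 r by case: okr; lra.
have Ly0 : 0 <= ry1 r - ry0 r by case: okr; lra.
have L0 : 0 <= L by rewrite /L addr_ge0.
have key e : 0 < e -> `|rcirc P Q r| <= 2 * e * L ^+ 2.
  move=> e0; have [d d0 H] := circ_local (clr _ _ (an 0%N) (bn 0%N)) e0.
  have [n nP] : exists n, L / 2 ^+ n < d.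
    exists (Num.truncn (L / d)).+1.
    rewrite ltr_pdivrMr ?exprn_gt0// mulrC -ltr_pdivrMr//.
    apply: (lt_le_trans (truncnS_gt _)).
    by rewrite -natrX ler_nat ltnW// ltn_expl.
  have p2 : 0 < (2 ^+ n : R)^-1 by rewrite invr_gt0 exprn_gt0.
  have bx : rx1 (s n) - rx0 (s n) < d.
    by rewrite sx; apply: le_lt_trans nP; rewrite ler_wpM2r ?(ltW p2)// /L lerDl.
  have bY : ry1 (s n) - ry0 (s n) < d.
    by rewrite sy; apply: le_lt_trans nP; rewrite ler_wpM2r ?(ltW p2)// /L lerDr.
  have [[okx oky] sub] := sP n; have cls := rsub_closed sub clr.
  have := H _ _ _ _ (an n) (bn n) bx bY; rewrite -/(rcirc P Q (s n)).
  have i0 : ry0 (s n) <= ry0 (s n) <= ry1 (s n) by rewrite lexx.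
  have i1 : ry0 (s n) <= ry1 (s n) <= ry1 (s n) by rewrite lexx andbT.
  have j0 : rx0 (s n) <= rx0 (s n) <= rx1 (s n) by rewrite lexx.
  have j1 : rx0 (s n) <= rx1 (s n) <= rx1 (s n) by rewrite lexx andbT.
  have c1 := @closed_contP P Q _ _ _ (fun x xi => cls x _ xi i0).
  have c2 := @closed_contP P Q _ _ _ (fun x xi => cls x _ xi i1).
  have c3 := @closed_contQ P Q _ _ _ (fun y yi => cls _ y j0 yi).
  have c4 := @closed_contQ P Q _ _ _ (fun y yi => cls _ y j1 yi).
  move=> /(_ c1 c2 c3 c4) h; apply: (le_trans (sc n)).
  rewrite sx sy -mulrDl -/L expr_div_n -exprM mulnC exprM -natrX in h.
  apply: (le_trans (ler_wpM2l _ h)); first by rewrite exprn_ge0.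
  rewrite (_ : (2 ^ 2)%:R = 4 :> R)//.
  have n0 : (4 ^+ n : R) != 0 by rewrite expf_neq0.
  by apply: eqW; field.
apply/eqP; rewrite -normr_le0; apply/ler_addgt0Pl => e e0; rewrite addr0.
have q0 : 0 < 2 * L ^+ 2 + 1 by rewrite ltr_wpDl// mulr_ge0// sqr_ge0.
apply: (le_trans (key (e / (2 * L ^+ 2 + 1)) (divr_gt0 e0 q0))).
rewrite (_ : 2 * _ * _ = e * (2 * L ^+ 2) / (2 * L ^+ 2 + 1)); last by ring.
by rewrite ler_pdivrMr// ler_wpM2l ?(ltW e0)// lerDl.
Qed.

End goursat_theorem.

Ltac box_side := solve [ lra | apply/andP; split; lra | apply/eqP => ?; lra
  | apply/orP; left; apply/eqP => ?; lra | apply/orP; right; apply/eqP => ?; lra ].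

Section circ_hole.
Context {R : realType}.
Implicit Types (P Q : R -> R -> R).

(** A rectangle with a square removed around (a, b) is a union of four rectangles
    that avoid (a, b), and the form has no circulation around them. *)
Lemma circ_hole P Q x0 x1 y0 y1 a b e : 0 < e ->
  x0 <= a - e -> a + e <= x1 -> y0 <= b - e -> b + e <= y1 ->
  (forall x y, x0 <= x <= x1 -> y0 <= y <= y1 -> (x != a) || (y != b) -> closed_at P Q x y) ->
  circ P Q x0 x1 y0 y1 = circ P Q (a - e) (a + e) (b - e) (b + e).
Proof.
move=> e0 h1 h2 h3 h4 cl.
have cP u v y : x0 <= u -> v <= x1 -> y0 <= y <= y1 -> y != b -> cont_on u v (P ^~ y).
  move=> k1 k2 k3 yb; apply: (@closed_contP _ P Q) => x /andP[g1 g2].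
  by apply: cl; rewrite ?yb ?orbT//; apply/andP; split; lra.
have cQ u v x : y0 <= u -> v <= y1 -> x0 <= x <= x1 -> x != a -> cont_on u v (Q x).
  move=> k1 k2 k3 yb; apply: (@closed_contQ _ P Q) => y /andP[g1 g2].
  by apply: cl; rewrite ?yb ?orbT//; apply/andP; split; lra.
have z u1 u2 v1 v2 : u1 <= u2 -> v1 <= v2 -> x0 <= u1 -> u2 <= x1 -> y0 <= v1 -> v2 <= y1 ->
    [|| u2 < a, a < u1, v2 < b | b < v1] -> circ P Q u1 u2 v1 v2 = 0.
  move=> k1 k2 k3 k4 k5 k6 out; apply: (@goursat _ P Q (Rect u1 u2 v1 v2)) => // x y /= /andP[g1 g2] /andP[g3 g4].
  apply: cl; [by apply/andP; split; lra | by apply/andP; split; lra|].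
  by case/or4P: out => o; box_side.
rewrite (@circ_splitx _ P Q x0 x1 y0 y1 (a - e)); try lra; try (by apply: cP; box_side); try (by apply: cQ; box_side).
rewrite (z x0 (a - e) y0 y1); [|lra|lra|lra|lra|lra|lra|by apply/or4P; constructor 1; lra].
rewrite (@circ_splitx _ P Q (a - e) x1 y0 y1 (a + e)); try lra; try (by apply: cP; box_side); try (by apply: cQ; box_side).
rewrite (z (a + e) x1 y0 y1); [|lra|lra|lra|lra|lra|lra|by apply/or4P; constructor 2; lra].
rewrite (@circ_splity _ P Q (a - e) (a + e) y0 y1 (b - e)); try lra; try (by apply: cP; box_side); try (by apply: cQ; box_side).
rewrite (z (a - e) (a + e) y0 (b - e)); [|lra|lra|lra|lra|lra|lra|by apply/or4P; constructor 3; lra].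
rewrite (@circ_splity _ P Q (a - e) (a + e) (b - e) y1 (b + e)); try lra; try (by apply: cP; box_side); try (by apply: cQ; box_side).
rewrite (z (a - e) (a + e) (b + e) y1); [|lra|lra|lra|lra|lra|lra|by apply/or4P; constructor 4; lra].
by rewrite !addr0 !add0r.
Qed.

Lemma circ_bound P Q x0 x1 y0 y1 (M : R) : x0 <= x1 -> y0 <= y1 ->
  cont_on x0 x1 (P ^~ y0) -> cont_on x0 x1 (P ^~ y1) ->
  cont_on y0 y1 (Q x0) -> cont_on y0 y1 (Q x1) ->
  (forall x, x0 <= x <= x1 -> `|P x y0| <= M) -> (forall x, x0 <= x <= x1 -> `|P x y1| <= M) ->
  (forall y, y0 <= y <= y1 -> `|Q x0 y| <= M) -> (forall y, y0 <= y <= y1 -> `|Q x1 y| <= M) ->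
  `|circ P Q x0 x1 y0 y1| <= 2 * M * ((x1 - x0) + (y1 - y0)).
Proof.
move=> x01 y01 c1 c2 c3 c4 b1 b2 b3 b4.
apply: (le_trans (ler_normD _ _)); rewrite mulrDr; apply: lerD; apply: seg_int_bound => //.
- exact: cont_onB.
- by move=> x xi; have := b1 x xi; have := b2 x xi => ? ?; apply: (le_trans (ler_normB _ _)); lra.
- exact: cont_onB.
- by move=> x xi; have := b3 x xi; have := b4 x xi => ? ?; apply: (le_trans (ler_normB _ _)); lra.
Qed.

(** The circulation around a small square is at most a multiple of [M] times its
    side, so it vanishes as the square shrinks. *)
Lemma circ_removable P Q x0 x1 y0 y1 a b (M : R) :
  x0 < a < x1 -> y0 < b < y1 ->
  (forall x y, x0 <= x <= x1 -> y0 <= y <= y1 -> (x != a) || (y != b) -> closed_at P Q x y) ->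
  (exists2 d, 0 < d & forall x y, `|x - a| < d -> `|y - b| < d -> `|P x y| <= M /\ `|Q x y| <= M) ->
  circ P Q x0 x1 y0 y1 = 0.
Proof.
move=> /andP[h1 h2] /andP[h3 h4] cl [d d0 dP].
have M0 : 0 <= M.
  have [] := dP a b; rewrite ?subrr ?normr0// => h _; exact: le_trans (normr_ge0 _) h.
apply/eqP; rewrite -normr_le0; apply/ler_addgt0Pl => e e0; rewrite addr0.
pose t := Num.min (Num.min (Num.min (a - x0) (x1 - a)) (Num.min (b - y0) (y1 - b)))
   (Num.min (d / 2) (e / (8 * M + 1))).
have t0 : 0 < t.
  by rewrite /t !lt_min !subr_gt0 h1 h2 h3 h4 !divr_gt0// ltr_wpDl// mulr_ge0.
have : t <= t by [].
rewrite {2}/t !le_min => /andP[/andP[/andP[t1 t2] /andP[t3 t4]] /andP[t5 t6]].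
rewrite (circ_hole t0 _ _ _ _ cl); [|lra|lra|lra|lra].
have pt (x y : R) : `|x - a| <= t -> `|y - b| <= t -> `|P x y| <= M /\ `|Q x y| <= M.
  by move=> ? ?; apply: dP; lra.
have na (x : R) : a - t <= x <= a + t -> `|x - a| <= t.
  by move=> /andP[? ?]; rewrite ler_norml; apply/andP; split; lra.
have nb (x : R) : b - t <= x <= b + t -> `|x - b| <= t.
  by move=> /andP[? ?]; rewrite ler_norml; apply/andP; split; lra.
have a1 : a - t <= a - t <= a + t by apply/andP; split; lra.
have a2 : a - t <= a + t <= a + t by apply/andP; split; lra.
have b1 : b - t <= b - t <= b + t by apply/andP; split; lra.
have b2 : b - t <= b + t <= b + t by apply/andP; split; lra.
apply: le_trans (_ : 2 * M * ((a + t - (a - t)) + (b + t - (b - t))) <= e); last first.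
  have K0 : 0 < 8 * M + 1 by lra.
  rewrite ler_pdivlMr// in t6.
  have : t * (8 * M + 1) = 8 * M * t + t by ring.
  by move=> E; rewrite (_ : 2 * M * _ = 8 * M * t); [lra | ring].
apply: circ_bound; [lra|lra| | | | | | | |].
- apply: (@closed_contP _ P Q) => x /andP[? ?]; apply: cl; box_side.
- apply: (@closed_contP _ P Q) => x /andP[? ?]; apply: cl; box_side.
- apply: (@closed_contQ _ P Q) => x /andP[? ?]; apply: cl; box_side.
- apply: (@closed_contQ _ P Q) => x /andP[? ?]; apply: cl; box_side.
- by move=> x xi; have [] := pt x (b - t) (na _ xi) (nb _ b1).
- by move=> x xi; have [] := pt x (b + t) (na _ xi) (nb _ b2).
- by move=> x xi; have [] := pt (a - t) x (na _ a1) (nb _ xi).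
- by move=> x xi; have [] := pt (a + t) x (na _ a2) (nb _ xi).
Qed.

End circ_hole.

(** * Cauchy's integral formula on squares *)

Section cauchy.
Context {R : realType}.

(** The contribution of two opposite sides of a square centred at w to the
    imaginary part of the contour integral of 1 / (z - w). *)
Lemma integral_atan (a e : R) : 0 < e ->
  seg_int (a - e) (a + e) (fun x => 2 * e / ((x - a) ^+ 2 + e ^+ 2)) = pi.
Proof.
move=> e0.
have lt : a - e < a + e by lra.
have dF (x : R) : is_derive x 1 (fun x => 2 * atan ((x - a) / e)) (2 * e / ((x - a) ^+ 2 + e ^+ 2)).
  apply: is_derive_eq.
  rewrite !(scaler0, scale0r, add0r, addr0, subr0) /GRing.scale /= ?mulr1.
  by field; rewrite (gt_eqF e0) andbT gt_eqF// ltr_wpDl ?sqr_ge0// exprn_gt0.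
have cf : continuous (fun x : R => 2 * e / ((x - a) ^+ 2 + e ^+ 2)).
  move=> x; apply: cvgM; first exact: cvg_cst.
  apply: cvgV; first by rewrite gt_eqF// ltr_wpDl ?sqr_ge0// exprn_gt0.
  apply: cvgD; last exact: cvg_cst.
  have cs : continuous (fun y : R => y - a) by move=> y; apply: cvgB; [exact: cvg_id|exact: cvg_cst].
  exact: (cvgM (cs x) (cs x)).
have cF : continuous (fun x : R => 2 * atan ((x - a) / e)).
  by move=> x; apply: differentiable_continuous; apply/derivable1_diffP; have [] := dF x.
rewrite /seg_int /Rintegral (continuous_FTC2 lt (continuous_subspaceT cf)
   (F := fun x : R => 2 * atan ((x - a) / e))).
- rewrite /= (_ : a + e - a = e); last by ring.
  rewrite (_ : a - e - a = - e); last by ring.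
  by rewrite mulNr divff ?gt_eqF// atanN atan1; field.
- split.
  + by move=> x _; have [] := dF x.
  + by apply: cvg_at_right_filter; exact: cF.
  + by apply: cvg_at_left_filter; exact: cF.
- by move=> x _; rewrite derive1E; have [_ ->] := dF x.
Qed.
Implicit Types (f g : R[i] -> R[i]) (z w : R[i]).

Definition re_of g (x y : R) := complex.Re (g (Complex x y)).
Definition im_of g (x y : R) := complex.Im (g (Complex x y)).

(** The Cauchy-Riemann equations: on the plane, multiplication by p + i q has the
    rows (p, -q) and (q, p). *)
Lemma holomorphic_dif2 g a b : holomorphic_at g (Complex a b) -> exists p q : R,
  dif2 (re_of g) a b p (- q) /\ dif2 (im_of g) a b q p.
Proof.
move=> [[p q] dP]; exists p, q.
have H (e : R) : 0 < e -> exists2 d : R, 0 < d & forall x y, `|x - a| < d -> `|y - b| < d ->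
    normc (g (Complex x y) - g (Complex a b) - Complex p q * Complex (x - a) (y - b)) <=
    e * (`|x - a| + `|y - b|).
  move=> e0; have [d d0 H] := dP e e0; exists (d / 2); first by rewrite divr_gt0.
  move=> x y xd yd.
  have hn : normc (Complex (x - a) (y - b)) <= `|x - a| + `|y - b| by exact: (normc_le_ReIm (Complex (x - a) (y - b))).
  have := H (Complex (x - a) (y - b)).
  have -> : Complex a b + Complex (x - a) (y - b) = Complex x y.
    by apply/eqP; rewrite eq_complex /=; apply/andP; split; apply/eqP; ring.
  move=> /(_ _)/le_trans-> //; first by lra.
  by rewrite ler_wpM2l// ltW.
split=> e e0; have [d d0 {}H] := H e e0; exists d => // x y xd yd; apply: le_trans (H x y xd yd).
- apply: le_trans (Re_le_normc _); rewrite /re_of.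
  case: (g (Complex x y)) => u v; case: (g (Complex a b)) => u' v' /=.
  by apply: eqW; congr `|_|; ring.
- apply: le_trans (Im_le_normc _); rewrite /im_of.
  case: (g (Complex x y)) => u v; case: (g (Complex a b)) => u' v' /=.
  by apply: eqW; congr `|_|; ring.
Qed.

Lemma dif2N (P : R -> R -> R) a b A B : dif2 P a b A B -> dif2 (fun x y => - P x y) a b (- A) (- B).
Proof.
move=> dP e e0; have [d d0 H] := dP e e0; exists d => // x y xd yd.
by have := H x y xd yd; rewrite -normrN; congr (`|_| <= _); ring.
Qed.

Lemma holomorphic_closed_re g a b : holomorphic_at g (Complex a b) ->
  closed_at (re_of g) (fun x y => - im_of g x y) a b.
Proof.
by move=> /holomorphic_dif2[p [q [d1 /dif2N d2]]]; exists p, (- q), (- p).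
Qed.

Lemma holomorphic_closed_im g a b : holomorphic_at g (Complex a b) ->
  closed_at (im_of g) (re_of g) a b.
Proof.
by move=> /holomorphic_dif2[p [q [d1 d2]]]; exists q, p, (- q).
Qed.

(** If f = u + i v, then f(z) dz = (u dx - v dy) + i (v dx + u dy). *)
Definition contour (s : R) g : R[i] :=
  Complex (circ (re_of g) (fun x y => - im_of g x y) (- s) s (- s) s)
          (circ (im_of g) (re_of g) (- s) s (- s) s).

Definition on_square s z := Num.max `|complex.Re z| `|complex.Im z| = s.
Definition hol_square s g := forall z, on_square s z -> holomorphic_at g z.

Lemma on_square1 s x : 0 < s -> - s <= x <= s ->
  [/\ on_square s (Complex x (- s)), on_square s (Complex x s),
      on_square s (Complex (- s) x) & on_square s (Complex s x)].
Proof.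
move=> s0 /andP[x1 x2]; have xs : `|x| <= s by rewrite ler_norml x1.
by split; rewrite /on_square /= ?normrN (gtr0_norm s0); [apply/max_idPr|apply/max_idPr|apply/max_idPl|apply/max_idPl].
Qed.

Lemma hol_square_cont s g : 0 < s -> hol_square s g ->
  [/\ cont_on (- s) s ((re_of g)^~ (- s)), cont_on (- s) s ((re_of g)^~ s),
      cont_on (- s) s (re_of g (- s)) & cont_on (- s) s (re_of g s)] /\
  [/\ cont_on (- s) s ((im_of g)^~ (- s)), cont_on (- s) s ((im_of g)^~ s),
      cont_on (- s) s (im_of g (- s)) & cont_on (- s) s (im_of g s)].
Proof.
move=> s0 hg; split; split=> x xi; have [k1 k2 k3 k4] := on_square1 s0 xi.
- by have [p [q [d1 d2]]] := holomorphic_dif2 (hg _ k1); exact: dif2_cont1 d1.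
- by have [p [q [d1 d2]]] := holomorphic_dif2 (hg _ k2); exact: dif2_cont1 d1.
- by have [p [q [d1 d2]]] := holomorphic_dif2 (hg _ k3); exact: dif2_cont2 d1.
- by have [p [q [d1 d2]]] := holomorphic_dif2 (hg _ k4); exact: dif2_cont2 d1.
- by have [p [q [d1 d2]]] := holomorphic_dif2 (hg _ k1); exact: dif2_cont1 d2.
- by have [p [q [d1 d2]]] := holomorphic_dif2 (hg _ k2); exact: dif2_cont1 d2.
- by have [p [q [d1 d2]]] := holomorphic_dif2 (hg _ k3); exact: dif2_cont2 d2.
- by have [p [q [d1 d2]]] := holomorphic_dif2 (hg _ k4); exact: dif2_cont2 d2.
Qed.

Lemma cont_onZ a b k (f : R -> R) : cont_on a b f -> cont_on a b (fun x => k * f x).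
Proof. by move=> cf; apply: cont_onM => //; exact: cont_on_cst. Qed.

Lemma cont_onN a b (f : R -> R) : cont_on a b f -> cont_on a b (fun x => - f x).
Proof. by move=> cf x xi; apply: cvgN; exact: cf. Qed.

Lemma circ_lin (P Q P' Q' P'' Q'' : R -> R -> R) k l x0 x1 y0 y1 :
  cont_on x0 x1 (P ^~ y0) -> cont_on x0 x1 (P ^~ y1) -> cont_on y0 y1 (Q x0) -> cont_on y0 y1 (Q x1) ->
  cont_on x0 x1 (P' ^~ y0) -> cont_on x0 x1 (P' ^~ y1) -> cont_on y0 y1 (Q' x0) -> cont_on y0 y1 (Q' x1) ->
  cont_on x0 x1 (P'' ^~ y0) -> cont_on x0 x1 (P'' ^~ y1) -> cont_on y0 y1 (Q'' x0) -> cont_on y0 y1 (Q'' x1) ->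
  circ (fun x y => P x y + (k * P' x y + l * P'' x y)) (fun x y => Q x y + (k * Q' x y + l * Q'' x y)) x0 x1 y0 y1 =
  circ P Q x0 x1 y0 y1 + (k * circ P' Q' x0 x1 y0 y1 + l * circ P'' Q'' x0 x1 y0 y1).
Proof.
move=> p1 p2 q1 q2 p1' p2' q1' q2' p1'' p2'' q1'' q2''; rewrite /circ.
have E a b (f1 f2 g1 g2 h1 h2 : R -> R) : cont_on a b f1 -> cont_on a b f2 -> cont_on a b g1 ->
    cont_on a b g2 -> cont_on a b h1 -> cont_on a b h2 ->
    seg_int a b (fun x => f1 x + (k * g1 x + l * h1 x) - (f2 x + (k * g2 x + l * h2 x))) =
    seg_int a b (fun x => f1 x - f2 x) +
    (k * seg_int a b (fun x => g1 x - g2 x) + l * seg_int a b (fun x => h1 x - h2 x)).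
  move=> c1 c2 c3 c4 c5 c6.
  rewrite (seg_intB (cont_onD c1 (cont_onD (cont_onZ (k := k) c3) (cont_onZ (k := l) c5)))
    (cont_onD c2 (cont_onD (cont_onZ (k := k) c4) (cont_onZ (k := l) c6)))).
  rewrite (seg_intD c1 (cont_onD (cont_onZ (k := k) c3) (cont_onZ (k := l) c5))).
  rewrite (seg_intD c2 (cont_onD (cont_onZ (k := k) c4) (cont_onZ (k := l) c6))).
  rewrite (seg_intD (cont_onZ (k := k) c3) (cont_onZ (k := l) c5)).
  rewrite (seg_intD (cont_onZ (k := k) c4) (cont_onZ (k := l) c6)).
  rewrite (seg_intB c1 c2) (seg_intB c3 c4) (seg_intB c5 c6).
  by rewrite (seg_intZ k c3) (seg_intZ k c4) (seg_intZ l c5) (seg_intZ l c6); ring.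
by rewrite (E x0 x1)// (E y0 y1)//; ring.
Qed.

Lemma eq_circ (P Q P' Q' : R -> R -> R) x0 x1 y0 y1 :
  P =2 P' -> Q =2 Q' -> circ P Q x0 x1 y0 y1 = circ P' Q' x0 x1 y0 y1.
Proof.
by move=> PP QQ; rewrite /circ; congr (_ + _); apply: eq_seg_int => x _; rewrite ?PP ?QQ.
Qed.

Lemma eq_contour s f g : 0 < s -> (forall z, on_square s z -> f z = g z) -> contour s f = contour s g.
Proof.
move=> s0 fg; rewrite /contour /circ; congr (Complex (_ + _) (_ + _)); apply: eq_seg_int => x xi;
  have [k1 k2 k3 k4] := on_square1 s0 xi; rewrite /re_of /im_of ?fg//.
Qed.

Lemma contour_lin s g h c : 0 < s -> hol_square s g -> hol_square s h ->
  contour s (fun z => g z + c * h z) = contour s g + c * contour s h.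
Proof.
move=> s0 /(hol_square_cont s0)[[r1 r2 r3 r4] [i1 i2 i3 i4]].
move=> /(hol_square_cont s0)[[r1' r2' r3' r4'] [i1' i2' i3' i4']].
case: c => k l; apply/eqP; rewrite eq_complex; apply/andP; split; apply/eqP => /=.
- rewrite -(mulNr l) -(@circ_lin (re_of g) (fun x y => - im_of g x y) (re_of h) (fun x y => - im_of h x y)
     (im_of h) (re_of h) k (- l) (- s) s (- s) s)//; try exact: cont_onN.
  apply: eq_circ => x y; rewrite /re_of /im_of;
    case: (g (Complex x y)) => u v; case: (h (Complex x y)) => u' v' /=; ring.
- rewrite -(@circ_lin (im_of g) (re_of g) (im_of h) (re_of h)
     (re_of h) (fun x y => - im_of h x y) k l (- s) s (- s) s)//; try exact: cont_onN.
  apply: eq_circ => x y; rewrite /re_of /im_of;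
    case: (g (Complex x y)) => u v; case: (h (Complex x y)) => u' v' /=; ring.
Qed.

Lemma contour_bound s g (M : R) : 0 < s -> hol_square s g ->
  (forall z, on_square s z -> normc (g z) <= M) -> normc (contour s g) <= 16 * s * M.
Proof.
move=> s0 hg gM; have [[r1 r2 r3 r4] [i1 i2 i3 i4]] := hol_square_cont s0 hg.
apply: (le_trans (normc_le_ReIm _)) => /=.
rewrite (_ : 16 * s * M = 2 * M * (s - - s + (s - - s)) + 2 * M * (s - - s + (s - - s))); last by ring.
have Rb z : on_square s z -> `|complex.Re (g z)| <= M by move=> /gM; exact: le_trans (Re_le_normc _).
have Ib z : on_square s z -> `|complex.Im (g z)| <= M by move=> /gM; exact: le_trans (Im_le_normc _).
apply: lerD; apply: circ_bound; rewrite ?ler_ge_sub_real//; try (exact: cont_onN); try lra;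
  move=> x xi; have [k1 k2 k3 k4] := on_square1 s0 xi; rewrite ?normrN /re_of /im_of; auto.
Qed.

End cauchy.

Section cauchy_formula.
Context {R : realType}.
Implicit Types (f g : R[i] -> R[i]) (z w : R[i]) (s : R).

Lemma holomorphic_div g w z : holomorphic_at g z -> z != w ->
  holomorphic_at (fun u => g u / (u - w)) z.
Proof.
move=> /derivable_holomorphic dg zw; apply/derivable_holomorphic.
apply: (derivableM dg); apply: derivableV; first by rewrite subr_eq0.
apply: derivableB; first exact: derivable_id.
exact: derivable_cst.
Qed.

Lemma holomorphicB_cst g c z : holomorphic_at g z -> holomorphic_at (fun u => g u - c) z.
Proof.
move=> /derivable_holomorphic dg; apply/derivable_holomorphic.
by apply: (derivableB dg); exact: derivable_cst.
Qed.

Lemma neq_Complex (x y a b : R) : (x != a) || (y != b) -> Complex x y != Complex a b.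
Proof. by rewrite eq_complex /= negb_and. Qed.

Definition in_square s w := (- s < complex.Re w < s) && (- s < complex.Im w < s).

Lemma in_square_neq s w z : in_square s w -> on_square s z -> z != w.
Proof.
rewrite /in_square /on_square => /andP[w1 w2] zs; apply/eqP => zw; move: zs; rewrite zw => E.
have : Num.max `|complex.Re w| `|complex.Im w| < s.
  by rewrite gt_max !ltr_norml w1 w2.
by rewrite E ltxx.
Qed.

Lemma hol_square_div s g w : in_square s w -> hol_square s g ->
  hol_square s (fun u => g u / (u - w)).
Proof. by move=> ws hg z zs; apply: holomorphic_div; [exact: hg|exact: in_square_neq ws zs]. Qed.

(** The difference quotient is holomorphic away from [w] and bounded near it, so
    [circ_removable] applies to the two real forms. *)
Lemma contour_quotient s f w : entire f -> in_square s w ->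
  contour s (fun z => (f z - f w) / (z - w)) = 0.
Proof.
move=> /entireP ef ws; set g := fun z => _.
have hg x y : (x != complex.Re w) || (y != complex.Im w) -> holomorphic_at g (Complex x y).
  move=> xy; apply: holomorphic_div; first exact: holomorphicB_cst.
  by move: xy; case: (w) => a b /= /neq_Complex.
have [M [d d0 gM]] : exists M, exists2 d : R, 0 < d & forall x y,
    `|x - complex.Re w| < d -> `|y - complex.Im w| < d -> normc (g (Complex x y)) <= M.
  have [D DP] := ef w; have [d d0 H] := DP 1 ltr01.
  exists (1 + normc D), (d / 2); first by rewrite divr_gt0.
  move=> x y xd yd; pose h := Complex x y - w.
  have hd : normc h < d.
    apply: (le_lt_trans (normc_le_ReIm _)); rewrite /h; move: xd yd.
    by case: (w) => a b /= ? ?; lra.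
  have -> : g (Complex x y) = (f (w + h) - f w) / h by rewrite /g /h subrKC.
  have [->|h0] := eqVneq h 0.
    by rewrite invr0 mulr0 normc0 addr_ge0 ?normc_ge0.
  rewrite normcM normcV ler_pdivrMr ?normc_gt0// mulrDl -normcM.
  have -> : f (w + h) - f w = (f (w + h) - f w - D * h) + D * h by rewrite subrK.
  by apply: (le_trans (le_normcD _ _)); rewrite lerD2r; exact: H.
move: ws => /andP[w1 w2].
rewrite /contour (@circ_removable _ _ _ _ _ _ _ (complex.Re w) (complex.Im w) M)//; first last.
- exists d => // x y xd yd; have h := gM x y xd yd; rewrite normrN; split.
  + exact: le_trans (Re_le_normc _) h.
  + exact: le_trans (Im_le_normc _) h.
- by move=> x y _ _ /hg; exact: holomorphic_closed_re.
rewrite (@circ_removable _ _ _ _ _ _ _ (complex.Re w) (complex.Im w) M)//.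
- by move=> x y _ _ /hg; exact: holomorphic_closed_im.
- exists d => // x y xd yd; have h := gM x y xd yd; split.
  + exact: le_trans (Im_le_normc _) h.
  + exact: le_trans (Re_le_normc _) h.
Qed.

Lemma entire_holomorphic f z : entire f -> holomorphic_at f z.
Proof. by move=> /entireP. Qed.

(** The square can be replaced by one centred at [w]; there, by symmetry, opposite
    sides cancel in the real part and agree in the imaginary part. *)
Lemma contour_inv s w : in_square s w ->
  contour s (fun z => 1 / (z - w)) = Complex 0 (2 * pi).
Proof.
case: w => a b ws; set g := fun z => _.
have hg x y : (x != a) || (y != b) -> holomorphic_at g (Complex x y).
  move=> xy; apply: holomorphic_div; last exact: neq_Complex.
  by apply: entire_holomorphic; exact: entire_cst.
have Eg x y : g (Complex x y) = Complex ((x - a) / ((x - a) ^+ 2 + (y - b) ^+ 2))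
   (- ((y - b) / ((x - a) ^+ 2 + (y - b) ^+ 2))).
  by rewrite /g div1r.
have Er x y : re_of g x y = (x - a) / ((x - a) ^+ 2 + (y - b) ^+ 2) by rewrite /re_of Eg.
have Ei x y : im_of g x y = - ((y - b) / ((x - a) ^+ 2 + (y - b) ^+ 2)) by rewrite /im_of Eg.
move: ws; rewrite /in_square /= => /andP[/andP[w1 w2] /andP[w3 w4]].
pose e := Num.min (Num.min (a + s) (s - a)) (Num.min (b + s) (s - b)).
have e0 : 0 < e by rewrite /e !lt_min; apply/andP; split; apply/andP; split; lra.
have : e <= e by [].
rewrite {2}/e !le_min => /andP[/andP[e1 e2] /andP[e3 e4]].
rewrite /contour (@circ_hole _ _ _ _ _ _ _ a b e)//; [|lra|lra|lra|lra|]; last first.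
  by move=> x y _ _ /hg; exact: holomorphic_closed_re.
rewrite (@circ_hole _ (im_of g) _ _ _ _ _ a b e)//; [|lra|lra|lra|lra|]; last first.
  by move=> x y _ _ /hg; exact: holomorphic_closed_im.
have m1 : b - e - b = - e by ring.
have m2 : b + e - b = e by ring.
have m3 : a - e - a = - e by ring.
have m4 : a + e - a = e by ring.
congr Complex.
- rewrite /circ (eq_seg_int (g := fun=> 0)); last first.
    by move=> x _; rewrite !Er m1 m2 sqrrN subrr.
  rewrite (eq_seg_int (f := fun y => _ - _) (g := fun=> 0)); last first.
    by move=> x _; rewrite !Ei m3 m4 sqrrN subrr.
  by rewrite !seg_int_cst ?mul0r ?addr0//; lra.
- rewrite /circ (eq_seg_int (g := fun x => 2 * e / ((x - a) ^+ 2 + e ^+ 2))); last first.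
    by move=> x _; rewrite !Ei m1 m2 sqrrN; ring.
  rewrite (eq_seg_int (f := fun y => _ - _) (g := fun x => 2 * e / ((x - b) ^+ 2 + e ^+ 2))); last first.
    by move=> x _; rewrite !Er m3 m4 sqrrN [e ^+ 2 + _]addrC; ring.
  by rewrite !integral_atan//; ring.
Qed.

Theorem cauchy_formula s f w : 0 < s -> entire f -> in_square s w ->
  contour s (fun z => f z / (z - w)) = Complex 0 (2 * pi) * f w.
Proof.
move=> s0 ef ws; rewrite mulrC -(contour_inv ws) -[RHS]add0r.
rewrite -(contour_quotient ef ws) -contour_lin//.
- by apply: eq_contour => // z _; rewrite mulrA mulr1 -mulrDl subrK.
- by apply: hol_square_div => // z _; apply: holomorphicB_cst; exact: entire_holomorphic.
- by apply: hol_square_div => // z _; apply: entire_holomorphic; exact: entire_cst.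
Qed.

Lemma hol_square_cst s c : hol_square s (fun=> c).
Proof. by move=> z _; apply: entire_holomorphic; exact: entire_cst. Qed.

Lemma hol_square_lin s g h c : hol_square s g -> hol_square s h ->
  hol_square s (fun z => g z + c * h z).
Proof.
move=> hg hh z zs; have /derivable_holomorphic dg := hg z zs.
have /derivable_holomorphic dh := hh z zs; apply/derivable_holomorphic.
exact: (derivableD dg (derivableM (derivable_cst (c : R[i]^o) (z : R[i]^o) 1) dh)).
Qed.

Lemma contour0 s : 0 < s -> contour s (fun=> 0) = 0.
Proof.
move=> s0; have := @contour_lin _ s _ _ (-1) s0 (@hol_square_cst s 0) (@hol_square_cst s 0).
move=> E; transitivity (contour s (fun=> 0) + -1 * contour s (fun=> 0)); last by rewrite mulN1r subrr.
by rewrite -E; apply: (eq_contour s0) => z _; rewrite mulr0 addr0.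
Qed.

Lemma contourZ s c g : 0 < s -> hol_square s g -> contour s (fun z => c * g z) = c * contour s g.
Proof.
move=> s0 hg; have := contour_lin c s0 (@hol_square_cst s 0) hg.
by rewrite contour0// add0r => <-; apply: eq_contour => // z _; rewrite add0r.
Qed.

Lemma normc_2pi : normc (Complex 0 (2 * pi) : R[i]) = 2 * pi.
Proof.
by rewrite /normc /= expr0n add0r sqrtr_sqr ger0_norm// mulr_ge0// pi_ge0.
Qed.

Lemma in_square0 s : 0 < s -> in_square s 0.
Proof. by move=> s0; rewrite /in_square /= oppr_lt0 s0. Qed.

Lemma on_square_ge s z : on_square s z -> s <= normc z.
Proof. by move=> <-; rewrite ge_max Re_le_normc Im_le_normc. Qed.

Lemma on_square_le s z : on_square s z -> normc z <= 2 * s.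
Proof.
move=> zs; apply: (le_trans (normc_le_ReIm _)); rewrite mulr2n mulrDl mul1r; apply: lerD;
by rewrite -zs le_max lexx ?orbT.
Qed.

Lemma normc_in_square s w : normc w < s -> in_square s w.
Proof.
by move=> ws; rewrite /in_square -!ltr_norml (le_lt_trans (Re_le_normc _))// (le_lt_trans (Im_le_normc _)).
Qed.

(** The differences f(w) - f(0) and f(w) - f(0) - d w are contour integrals with
    the factors w and w^2 taken out. On the square, |z| >= 2 and |z - w| >= 1. The
    factor 8 below is the constant 16 s of [contour_bound] over 4 <= 2 pi. *)
Theorem cauchy_estimates f (M : R) : entire f -> (forall z, on_square 2 z -> normc (f z) <= M) ->
  exists d, normc d <= 4 * M /\ forall w, normc w <= 1 ->
    normc (f w - f 0) <= 4 * M * normc w /\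
    normc (f w - f 0 - d * w) <= 2 * M * normc w ^+ 2.
Proof.
move=> ef fM; have s0 : 0 < 2 :> R by [].
have M0 : 0 <= M.
  apply: le_trans (normc_ge0 _) (fM (Complex 2 2) _).
  by rewrite /on_square /= maxxx gtr0_norm.
have hf : hol_square 2 f by move=> z _; exact: entire_holomorphic.
have i0 := in_square0 s0.
have h0 := hol_square_div i0 hf; have h00 := hol_square_div i0 h0.
have p0 : 0 < 2 * pi :> R by rewrite mulr_gt0// pi_gt0.
have p4 : 4 <= 2 * pi :> R by have := @pi_ge2 R; lra.
pose k := Complex 0 (2 * pi) : R[i].
have k0 : k != 0 by rewrite -normc_gt0 normc_2pi.
have ck g (K : R) : 0 <= K -> hol_square 2 g -> (forall z, on_square 2 z -> normc (g z) <= K) ->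
    normc (k^-1 * contour 2 g) <= 8 * K.
  move=> K0 hg gK; rewrite normcM normcV normc_2pi mulrC ler_pdivrMr//.
  apply: (le_trans (contour_bound s0 hg gK)).
  rewrite (_ : 16 * 2 * K = 8 * K * 4); last by ring.
  by rewrite ler_wpM2l// mulr_ge0.
have F w : in_square 2 w -> f w = k^-1 * contour 2 (fun z => f z / (z - w)).
  by move=> ws; rewrite cauchy_formula// mulKf.
have z2 z : on_square 2 z -> 2 <= normc (z - 0) by rewrite subr0; exact: on_square_ge.
have zn0 z : on_square 2 z -> z != 0 by exact: in_square_neq i0.
have q z (x : R) g : on_square 2 z -> normc (g z) <= x -> normc (g z / (z - 0)) <= x / 2.
  move=> zs gx; rewrite normcM normcV.
  have zz := z2 _ zs; rewrite ler_pM ?normc_ge0 ?invr_ge0 ?normc_ge0// lef_pV2 ?posrE//.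
  exact: lt_le_trans zz.
exists (k^-1 * contour 2 (fun z => f z / (z - 0) / (z - 0))); split.
  apply: (le_trans (ck _ (M / 2 / 2) _ h00 _)); [by rewrite !divr_ge0|  |lra].
  by move=> z zs; apply: (q z (M / 2) (fun z => f z / (z - 0))) => //; apply: q => //; exact: fM.
move=> w w1; have ws : in_square 2 w by apply: normc_in_square; apply: le_lt_trans w1 _; lra.
have hw := hol_square_div ws hf; have hw0 := hol_square_div i0 hw.
have hw00 := hol_square_div i0 hw0.
have zw z : on_square 2 z -> normc (f z / (z - w)) <= M.
  move=> zs; rewrite normcM normcV.
  have zz : 1 <= normc (z - w).
    have := le_normcD (z - w) w; have := on_square_ge zs; rewrite subrK => ? ?; lra.
  rewrite ler_pdivrMr; last exact: lt_le_trans zz.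
  by apply: (le_trans (fM _ zs)); rewrite ler_peMr.
have znw z : on_square 2 z -> z - w != 0 by move=> zs; rewrite subr_eq0; exact: in_square_neq ws zs.
split.
- have -> : f w - f 0 = w * (k^-1 * contour 2 (fun z => f z / (z - w) / (z - 0))).
    rewrite {1}(F w ws) {1}(F 0 i0) mulrCA -mulrBr; congr (_ * _).
    rewrite -mulN1r -contour_lin// -contourZ//.
    apply: eq_contour => // z zs; have := znw _ zs; have := zn0 _ zs; rewrite subr0 => z0 zw0.
    by field; rewrite z0.
  rewrite normcM mulrC ler_wpM2r ?normc_ge0//.
  apply: (le_trans (ck _ (M / 2) _ hw0 _)); [by rewrite divr_ge0|  |lra].
  by move=> z zs; apply: (q z M (fun z => f z / (z - w))) => //; exact: zw.
- have -> : f w - f 0 - k^-1 * contour 2 (fun z => f z / (z - 0) / (z - 0)) * w =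
     w ^+ 2 * (k^-1 * contour 2 (fun z => f z / (z - w) / (z - 0) / (z - 0))).
    rewrite {1}(F w ws) {1}(F 0 i0) mulrCA -mulrA -!mulrBr; congr (_ * _).
    rewrite [contour _ _ * w]mulrC -mulN1r -contour_lin// -mulNr -contour_lin//; last exact: hol_square_lin.
    rewrite -contourZ//.
    apply: eq_contour => // z zs; have := znw _ zs; have := zn0 _ zs; rewrite subr0 => z0 zw0.
    by field; rewrite z0.
  have nw : normc (w ^+ 2) = normc w ^+ 2 by rewrite !expr2 normcM.
  rewrite normcM mulrC nw ler_wpM2r ?sqr_ge0//.
  apply: (le_trans (ck _ (M / 2 / 2) _ hw00 _)); [by rewrite !divr_ge0|  |lra].
  move=> z zs; apply: (q z (M / 2) (fun z => f z / (z - w) / (z - 0))) => //.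
  by apply: (q z M (fun z => f z / (z - w))) => //; exact: zw.
Qed.
End cauchy_formula.

(** * Sub-mean value inequalities for powers of the modulus *)

Section mean_value.
Context {R : realType}.
Notation mu := (@lebesgue_measure R).
Notation TR := (measurableTypeR R).
Implicit Types (f : R[i] -> R[i]).

Definition sq (r : R) : set (plane R) := `[- r, r] `*` `[- r, r].

Lemma measurable_sq r : measurable (sq r).
Proof. exact: measurableX. Qed.

Lemma sqP r (w : plane R) : sq r w <-> `|w.1| <= r /\ `|w.2| <= r.
Proof. by rewrite /sq /= !in_itv /= !ler_norml. Qed.

Definition fnorm f (w : plane R) : R := normc (f (to_C w)).

Lemma fnorm_ge0 f w : 0 <= fnorm f w. Proof. exact: normc_ge0. Qed.

Lemma measurable_fnorm f : entire f -> measurable_fun setT (fnorm f).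
Proof. exact: measurable_normc_entire. Qed.

Lemma fnorm_cont1 f b : entire f -> continuous (fun x => fnorm f (x, b)).
Proof.
move=> ef x; apply: (@continuous_comp _ (R * R)%type _ (fun x => (x, b)) (fnorm f)).
  exact: (@cvg_pair _ _ _ (nbhs x) (nbhs x) (nbhs b) _ _ _ id (cst b) cvg_id (cvg_cst b)).
exact: entire_normc_continuous.
Qed.

Lemma fnorm_cont2 f b : entire f -> continuous (fun x => fnorm f (b, x)).
Proof.
move=> ef x; apply: (@continuous_comp _ (R * R)%type _ (fun x => (b, x)) (fnorm f)).
  exact: (@cvg_pair _ _ _ (nbhs x) (nbhs b) (nbhs x) _ _ _ (cst b) id (cvg_cst b) cvg_id).
exact: entire_normc_continuous.
Qed.

(** The formula of Cauchy at the centre of the square, where |z| >= s on the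
    boundary and 2 pi >= 4. *)
Lemma boundary_bound f s : 0 < s -> entire f ->
  2 * s * fnorm f (0, 0) <=
  seg_int (- s) s (fun x => (fnorm f (x, - s) + fnorm f (x, s)) + (fnorm f (s, x) + fnorm f (- s, x))).
Proof.
move=> s0 ef.
have c1 b : cont_on (- s) s (fun x => fnorm f (x, b)) by move=> x _; exact: fnorm_cont1.
have c2 b : cont_on (- s) s (fun x => fnorm f (b, x)) by move=> x _; exact: fnorm_cont2.
have i0 := in_square0 s0.
pose g (z : R[i]) := f z / (z - 0).
have hg : hol_square s g by apply: hol_square_div => // z _; exact: entire_holomorphic.
have [[r1 r2 r3 r4] [i1 i2 i3 i4]] := hol_square_cont s0 hg.
have gs z : on_square s z -> normc (g z) <= normc (f z) / s.
  move=> zs; rewrite /g subr0 normcM normcV ler_wpM2l ?normc_ge0// lef_pV2 ?posrE//.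
    exact: on_square_ge.
  exact: lt_le_trans (on_square_ge zs).
set V := seg_int _ _ _.
have half (P Q : R -> R -> R) :
    cont_on (- s) s (P ^~ (- s)) -> cont_on (- s) s (P ^~ s) ->
    cont_on (- s) s (Q (- s)) -> cont_on (- s) s (Q s) ->
    (forall x y, `|P x y| <= normc (g (Complex x y))) -> (forall x y, `|Q x y| <= normc (g (Complex x y))) ->
    `|circ P Q (- s) s (- s) s| <= s^-1 * V.
  move=> p1 p2 q1 q2 Pg Qg; apply: (le_trans (ler_normD _ _)).
  have -> : V = seg_int (- s) s (fun x => fnorm f (x, - s) + fnorm f (x, s)) +
      seg_int (- s) s (fun x => fnorm f (s, x) + fnorm f (- s, x)).
    by rewrite /V seg_intD//; exact: cont_onD.
  rewrite mulrDr -!seg_intZ//; try exact: cont_onD.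
  apply: lerD; (apply: le_trans (le_norm_seg_int _) _; first exact: cont_onB); apply: le_seg_int.
  - by apply: cont_on_norm; exact: cont_onB.
  - by apply: cont_onM; [exact: cont_on_cst|exact: cont_onD].
  - move=> x xi; have [k1 k2 k3 k4] := on_square1 s0 xi.
    apply: (le_trans (ler_normB _ _)); rewrite mulrDr; apply: lerD; rewrite mulrC.
      exact: le_trans (Pg _ _) (gs _ k1).
    exact: le_trans (Pg _ _) (gs _ k2).
  - by apply: cont_on_norm; exact: cont_onB.
  - by apply: cont_onM; [exact: cont_on_cst|exact: cont_onD].
  - move=> x xi; have [k1 k2 k3 k4] := on_square1 s0 xi.
    apply: (le_trans (ler_normB _ _)); rewrite mulrDr; apply: lerD; rewrite mulrC.
      exact: le_trans (Qg _ _) (gs _ k4).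
    exact: le_trans (Qg _ _) (gs _ k3).
have : normc (contour s g) <= 2 * (s^-1 * V).
  apply: (le_trans (normc_le_ReIm _)); rewrite mulr2n mulrDl mul1r; apply: lerD; apply: half;
    rewrite ?/re_of ?/im_of; try (exact: cont_onN); try exact => //;
    move=> x y; rewrite ?normrN; first [exact: Re_le_normc | exact: Im_le_normc].
rewrite cauchy_formula// normcM normc_2pi.
have p2 := @pi_ge2 R; have F0 := fnorm_ge0 f (0, 0).
rewrite -[normc (f 0)]/(fnorm f (0, 0)) => H.
have : 4 * fnorm f (0, 0) <= 2 * (s^-1 * V).
  by apply: le_trans H; rewrite ler_wpM2r//; lra.
rewrite mulrCA ler_pdivlMl//.
by move=> H2; have -> : 2 * s * fnorm f (0, 0) = s * (4 * fnorm f (0, 0)) / 2; [by field | lra].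
Qed.

Local Open Scope ereal_scope.

(** Integrate [boundary_bound] over r / 2 <= s <= r. Each of the four sides of the
    boundary sweeps out a part of [sq r], so it contributes at most the integral of
    the modulus over [sq r]. *)
Lemma mean_value_ineq f (r : R) : (0 < r)%R -> entire f ->
  (fnorm f (0, 0)%R)%:E <= (8 / r ^+ 2)%:E * \int[@dA R]_(w in sq r) (fnorm f w)%:E.
Proof.
move=> r0 ef.
pose G (w : plane R) : \bar R := (fnorm f w * \1_(sq r) w)%:E.
have mG : measurable_fun setT G.
  apply/measurable_EFinP; apply: measurable_funM; first exact: measurable_fnorm.
  by apply: measurable_indic; exact: measurable_sq.
have G0 w : 0 <= G w by rewrite lee_fin mulr_ge0// fnorm_ge0.
have IG : \int[@dA R]_(w in sq r) (fnorm f w)%:E = \int[@dA R]_w G w.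
  rewrite integral_mkcond; apply: eq_integral => w _; rewrite patchE /G indicE.
  by case: (w \in sq r); rewrite /= ?mulr1 ?mulr0.
have m1 : measurable_fun setT (fun w : plane R => G (w.1, - w.2)%R).
  apply: (measurableT_comp mG); apply/measurable_fun_pair => //.
  exact: measurableT_comp.
have msw : measurable_fun setT (fun w : plane R => (w.2, w.1) : plane R).
  exact/measurable_fun_pair.
have m3 : measurable_fun setT (fun w : plane R => G (w.2, w.1)).
  exact: (measurableT_comp mG msw).
have m0 : measurable_fun setT (fun w : plane R => G (- w.1, w.2)%R).
  apply: (measurableT_comp mG); apply/measurable_fun_pair => //.
  exact: measurableT_comp.
have m4 : measurable_fun setT (fun w : plane R => G (- w.2, w.1)%R).
  exact: (measurableT_comp m0 msw).
(* one term for each side; [w.1] is the position on the side and [w.2] is the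
   radius [s] *)
pose H (w : plane R) := (G (w.1, - w.2)%R + G w) + (G (w.2, w.1) + G (- w.2, w.1)%R).
have mH : measurable_fun setT H.
  by apply: emeasurable_funD; apply: emeasurable_funD.
have H0 w : 0 <= H w by rewrite /H !adde_ge0.
have n1 : (-1 != 0 :> R)%R by rewrite oppr_eq0 oner_eq0.
have IH : \int[@dA R]_w H w = 4%:E * \int[@dA R]_w G w.
  rewrite ge0_integralD//; last 4 first.
  - by move=> w _; exact: adde_ge0.
  - exact: emeasurable_funD.
  - by move=> w _; exact: adde_ge0.
  - exact: emeasurable_funD.
  rewrite ge0_integralD// ge0_integralD//.
  rewrite (integral_swap_plane mG)//.
  have -> : \int[@dA R]_w G (- w.2, w.1)%R = \int[@dA R]_w G (- w.1, w.2)%R.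
    exact: (integral_swap_plane m0).
  have -> : \int[@dA R]_w G (w.1, - w.2)%R = \int[@dA R]_w G w.
    transitivity (\int[@dA R]_w G (w.1, 0 * w.1 + (-1) * w.2 + 0)%R).
      by apply: eq_integral => w _; rewrite mul0r add0r addr0 mulN1r.
    by rewrite (integral_shear2 mG)// normrN normr1 invr1 mul1e.
  have -> : \int[@dA R]_w G (- w.1, w.2)%R = \int[@dA R]_w G w.
    transitivity (\int[@dA R]_w G ((-1) * w.1 + 0 * w.2 + 0, w.2)%R).
      by apply: eq_integral => w _; rewrite mul0r !addr0 mulN1r.
    by rewrite (integral_shear1 mG)// normrN normr1 invr1 mul1e.
  have -> : 4%:E = 1 + 1 + (1 + 1) :> \bar R by rewrite -!EFinD; congr EFin; lra.
  by rewrite !ge0_muleDl ?adde_ge0// !mul1e.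
rewrite IG.
have r20 : (0 < r ^+ 2)%R by rewrite exprn_gt0.
have key : (r ^+ 2 / 2 * fnorm f (0, 0))%:E <= 4%:E * \int[@dA R]_w G w.
  rewrite -IH /dA (fubini_tonelli2 _ mH H0).
  have -> : (r ^+ 2 / 2 * fnorm f (0, 0))%:E =
      \int[mu]_(s in `[(r / 2)%R, r]) (r * fnorm f (0, 0))%:E.
    rewrite integral_cst// [X in _ * X](_ : _ = (r / 2)%:E).
      by rewrite -EFinM; congr EFin; field.
    rewrite [LHS](lebesgue_measure_itv `[(r / 2)%R, r]) /= lte_fin ifT; last by lra.
    by rewrite -EFinB; congr EFin; field.
  rewrite integral_mkcond; apply: ge0_le_integral => //.
  - by move=> s _; apply: erestrict_ge0 => ? _; rewrite lee_fin mulr_ge0 ?fnorm_ge0// ltW.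
  - apply/(measurable_restrictT (fun=> (r * fnorm f (0, 0))%:E)) => //.
  - exact: measurable_fun_fubini_tonelli_G.
  move=> s _; rewrite patchE; case: ifPn => [|_]; last by rewrite /fubini_G; apply: integral_ge0.
  rewrite inE /= in_itv /= => /andP[s1 s2].
  have s0 : (0 < s)%R by lra.
  apply: (@le_trans _ _ (2 * s * fnorm f (0, 0))%:E).
    by rewrite lee_fin ler_wpM2r ?fnorm_ge0//; lra.
  apply: (@le_trans _ _ (\int[mu]_(x in `[(- s)%R, s]) ((fnorm f (x, - s) + fnorm f (x, s)) +
      (fnorm f (s, x) + fnorm f (- s, x)))%:E)).
    apply: (le_trans _ (_ : (seg_int (- s) s (fun x => (fnorm f (x, - s) + fnorm f (x, s)) +
      (fnorm f (s, x) + fnorm f (- s, x))))%:E <= _)); last first.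
      rewrite /seg_int /Rintegral fineK//; apply: integrable_fin_num => //.
      by apply: cont_on_integrable; apply: cont_onD; apply: cont_onD => x _; first [exact: fnorm_cont1|exact: fnorm_cont2].
    by rewrite lee_fin; exact: boundary_bound.
  rewrite integral_mkcond /fubini_G; apply: ge0_le_integral => //.
  - by move=> x _; apply: erestrict_ge0 => ? _; rewrite lee_fin !addr_ge0 ?fnorm_ge0.
  - apply/(measurable_restrictT (fun x => ((fnorm f (x, - s) + fnorm f (x, s)) +
      (fnorm f (s, x) + fnorm f (- s, x)))%:E)) => //.
    have mf1 (b : R) : measurable_fun setT (fun x : TR => fnorm f (x, b)).
      by apply: (measurableT_comp (measurable_fnorm ef)); exact/measurable_fun_pair.
    have mf2 (b : R) : measurable_fun setT (fun x : TR => fnorm f (b, x)).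
      by apply: (measurableT_comp (measurable_fnorm ef)); exact/measurable_fun_pair.
    apply/measurable_EFinP/measurable_funTS.
    apply: measurable_funD; first exact: measurable_funD (mf1 _) (mf1 _).
    exact: measurable_funD (mf2 _) (mf2 _).
  - by apply: (measurableT_comp mH).
  move=> x _; rewrite patchE; case: ifPn => [|_]; last by [].
  rewrite inE /= in_itv /= => xs; rewrite /H /G /= -!EFinD lee_fin.
  have xr : (`|x| <= r)%R by rewrite ler_norml; move: xs => /andP[? ?]; apply/andP; split; lra.
  have sr : (`|s| <= r)%R by rewrite gtr0_norm.
  have sr' : (`|- s| <= r)%R by rewrite normrN.
  by rewrite !indicE !mem_set ?mulr1//; apply/sqP.
apply: (@le_trans _ _ ((2 / r ^+ 2)%:E * (4%:E * \int[@dA R]_w G w))).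
  apply: le_trans (_ : (2 / r ^+ 2)%:E * (r ^+ 2 / 2 * fnorm f (0, 0))%:E <= _).
    rewrite -EFinM lee_fin; apply: eqW; field.
    by rewrite gt_eqF.
  by apply: lee_wpmul2l => //; rewrite lee_fin divr_ge0// ltW.
rewrite muleA -EFinM; apply: eqW; congr (_%:E * _); field.
by rewrite gt_eqF.
Qed.
End mean_value.

Section submean.
Context {R : realType}.
Implicit Types (f : R[i] -> R[i]).

Lemma powR_mono (q x y : R) : 0 <= q -> 0 <= x -> x <= y -> x `^ q <= y `^ q.
Proof.
by move=> q0 x0 xy; apply: ge0_ler_powR => //; rewrite nnegrE// (le_trans x0).
Qed.

Lemma measurable_affine (a b : R[i]) :
  measurable_fun setT (fun w : plane R => of_C (a * to_C w + b)).
Proof.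
case: a => u v; case: b => e f; apply/measurable_fun_pair => /=.
- apply: measurable_funD => //; apply: measurable_funB; exact: measurable_funM.
- apply: measurable_funD => //; apply: measurable_funD; exact: measurable_funM.
Qed.

Lemma fnorm_bounded f r : entire f -> exists M, forall w, sq r w -> fnorm f w <= M.
Proof.
move=> ef.
have cs : compact (sq r : set (R * R)) by apply: compact_setX; exact: segment_compact.
have : compact (fnorm f @` (sq r : set (R * R))).
  apply: continuous_compact => //; apply: continuous_subspaceT.
  exact: entire_normc_continuous.
move=> /compact_bounded[M [_ /(_ (M + 1))]]; rewrite ltrDl ltr01 => /(_ erefl) H.
exists (M + 1) => w sw; rewrite -[leLHS]ger0_norm ?fnorm_ge0//.
by apply: H; exists w.
Qed.

Lemma fnorm_shift f z w : fnorm (fun u => f (1 * u + z)) w = fnorm f (of_C (to_C w + z)).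
Proof. by rewrite /fnorm of_CK mul1r. Qed.

Local Open Scope ereal_scope.

Lemma measurable_powR_fnorm f (q : R) : entire f ->
  measurable_fun setT (fun w : plane R => (fnorm f w `^ q)%:E).
Proof.
move=> ef; apply/measurable_EFinP.
exact: (measurableT_comp (measurable_powR q) (measurable_fnorm ef)).
Qed.

(** The argument of Hardy and Littlewood. Let |w| be the sup norm,
    and let |f(w)| (1 - |w|)^(2/q) almost attain its supremum over the unit square at
    [ws]. On the square around [ws] whose radius is half the distance to the
    boundary, |f| is then at most a constant times |f(ws)|. There the
    mean value inequality for |f| = |f|^(1-q) |f|^q bounds |f(ws)|^q by a mean of
    |f|^q, and the exponent 2/q is the one for which the radius drops out. *)
Lemma submean_le1 f (q : R) : (0 < q)%R -> (q <= 1)%R -> entire f ->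
  (fnorm f (0, 0)%R `^ q)%:E <= (16 * 2 `^ (2 / q))%:E * \int[@dA R]_(w in sq 1) (fnorm f w `^ q)%:E.
Proof.
move=> q0 q1 ef; set J := integral _ _ _; set c := (2 `^ (2 / q))%R.
have c0 : (0 < c)%R by rewrite powR_gt0.
have J0 : 0 <= J by apply: integral_ge0 => w _; rewrite lee_fin powR_ge0.
have [F0|F0] := eqVneq (fnorm f (0, 0)%R) 0%R.
  by rewrite F0 powR0 ?gt_eqF// mule_ge0// lee_fin mulr_ge0// ltW.
have {}F0 : (0 < fnorm f (0, 0))%R by rewrite lt0r F0 fnorm_ge0.
case EJ : J J0 => [j| |] // J0; last by rewrite gt0_muley ?leey// lte_fin mulr_gt0.
rewrite -EFinM lee_fin.
have [M FM] := fnorm_bounded 1 ef.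
pose N (w : plane R) : R := Num.max `|w.1|%R `|w.2|%R.
pose phi (w : plane R) : R := (fnorm f w * (1 - N w) `^ (2 / q))%R.
pose A := phi @` sq 1.
have A0 : A (fnorm f (0, 0)%R).
  exists ((0%R : R), (0%R : R)); first by apply/sqP; rewrite /= normr0.
  by rewrite /phi /N /= normr0 maxxx subr0 powR1 mulr1.
have q20 : (0 <= 2 / q)%R by rewrite divr_ge0// ltW.
have NP w : sq 1 w -> (0 <= 1 - N w <= 1)%R.
  move=> /sqP[w1 w2]; rewrite subr_ge0 /N ge_max w1 w2 /=.
  by rewrite lerBlDr lerDl le_max normr_ge0.
have sA : has_sup A.
  split; first by eexists; exact: A0.
  exists M => _ [w sw <-]; have /andP[n1 n2] := NP _ sw.
  rewrite -[leRHS]mulr1 ler_pM ?fnorm_ge0 ?powR_ge0 ?FM//.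
  by rewrite -[leRHS](congr1 (fun h => h (2 / q)%R) (@powR1 R)) powR_mono.
pose S := sup A.
have S0 : (fnorm f (0, 0) <= S)%R by apply: sup_upper_bound.
have Sp : (0 < S)%R by exact: lt_le_trans F0 S0.
have [_ [ws sws <-]] : exists2 e, A e & (S - S / 2 < e)%R by apply: sup_adherent => //; rewrite divr_gt0.
rewrite (_ : S - S / 2 = S / 2)%R; last by field.
have /andP[t0 t1] := NP _ sws; rewrite /phi; set t := (1 - N ws)%R in t0 t1 *.
set Fs := fnorm f ws => Sphi.
have {}t0 : (0 < t)%R.
  rewrite lt0r t0 andbT; apply/eqP => t00; move: Sphi; rewrite t00 powR0 ?mulr0; last first.
    by rewrite gt_eqF// divr_gt0.
  by rewrite ltNge divr_ge0// ltW.
pose d := (t / 2)%R; have d0 : (0 < d)%R by rewrite divr_gt0.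
pose D := (d `^ (2 / q))%R; have D0 : (0 < D)%R by rewrite powR_gt0.
have Dq : (D `^ q = d ^+ 2)%R.
  by rewrite /D -powRrM divfK ?gt_eqF// -powR_mulrn ?ltW.
have tD : (t `^ (2 / q) = c * D)%R.
  by rewrite /c /D -powRM ?(ltW d0)//; congr (_ `^ _)%R; rewrite /d; field.
(* [T] bounds |f| on the square of radius [d] around [ws], and [K] turns |f|
   into |f|^q there *)
pose T := (S / D)%R; have T0 : (0 < T)%R by rewrite divr_gt0.
pose K := (T `^ (1 - q))%R; have K0 : (0 < K)%R by rewrite powR_gt0.
have KT : (K * T `^ q = T)%R.
  rewrite /K -powRD; last by rewrite subrK oner_eq0.
  by rewrite subrK powRr1// ltW.
have Sq : (S `^ q = T `^ q * d ^+ 2)%R.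
  by rewrite -Dq -powRM ?ltW// /T divfK ?gt_eqF.
pose g := fun u : R[i] => f (1 * u + to_C ws)%R.
have eg : entire g by exact: entire_affine.
have gE u : fnorm g u = fnorm f ((u.1 + ws.1)%R, (u.2 + ws.2)%R).
  by rewrite fnorm_shift; case: (u); case: (ws).
have g0 : fnorm g (0, 0)%R = Fs by rewrite gE /= !add0r; rewrite /Fs; case: (ws).
have inS u : sq d u -> (N ((u.1 + ws.1)%R, (u.2 + ws.2)%R) <= 1 - d)%R.
  move=> /sqP[u1 u2]; have Nw : (N ws = 1 - d - d)%R by rewrite /d /t; field.
  have n1 : (`|ws.1| <= N ws)%R by rewrite /N le_max lexx.
  have n2 : (`|ws.2| <= N ws)%R by rewrite /N le_max lexx orbT.
  by rewrite {1}/N ge_max /=; apply/andP; split; apply: (le_trans (ler_normD _ _)); lra.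
have inSq u : sq d u -> sq 1 ((u.1 + ws.1)%R, (u.2 + ws.2)%R).
  move=> /inS; rewrite /N ge_max /= => /andP[a1 a2]; apply/sqP => /=; split; lra.
have bd u : sq d u -> (fnorm g u <= T)%R.
  move=> su; rewrite gE; set v := (_, _).
  have : (phi v <= S)%R by apply: sup_upper_bound => //; exists v => //; exact: inSq.
  rewrite /phi /T ler_pdivlMr// => h; apply: le_trans h.
  rewrite ler_wpM2l ?fnorm_ge0// /D powR_mono ?(ltW d0)//.
  by have h1 := inS _ su; rewrite -/v in h1; lra.
have bdK u : sq d u -> (fnorm g u <= K * fnorm g u `^ q)%R.
  move=> su; have [->|n0] := eqVneq (fnorm g u) 0%R; first by rewrite mulr_ge0// ?ltW// powR_ge0.
  have E : (fnorm g u = fnorm g u `^ (1 - q) * fnorm g u `^ q)%R.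
    by rewrite -powRD ?n0 ?implybT// subrK powRr1// fnorm_ge0.
  by rewrite {1}E ler_wpM2r ?powR_ge0// /K powR_mono ?fnorm_ge0 ?bd// subr_ge0.
have trans_int : \int[@dA R]_(u in sq d) (fnorm g u `^ q)%:E <= J.
  pose G (w : plane R) : \bar R := ((fun w => (fnorm f w `^ q)%:E) \_ (sq 1)) w.
  have mG : measurable_fun setT G.
    by apply/(measurable_restrictT _ (measurable_sq 1))/measurable_funTS; exact: measurable_powR_fnorm.
  have G0 w : 0 <= G w by apply: erestrict_ge0 => ? _; rewrite lee_fin powR_ge0.
  rewrite /J [leRHS]integral_mkcond -/G.
  have := integral_affine (to_C ws) (oner_neq0 _) mG G0.
  rewrite normc1 expr1n invr1 mul1e => <-.
  rewrite integral_mkcond; apply: ge0_le_integral => //.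
  - by move=> w _; apply: erestrict_ge0 => ? _; rewrite lee_fin powR_ge0.
  - by apply/(measurable_restrictT _ (measurable_sq d))/measurable_funTS; exact: measurable_powR_fnorm.
  - exact: (measurableT_comp mG (measurable_affine _ _)).
  move=> u _; rewrite patchE; case: ifPn => // /set_mem su.
  have -> : of_C (1 * to_C u + to_C ws)%R = ((u.1 + ws.1)%R, (u.2 + ws.2)%R).
    by rewrite mul1r; case: (u); case: (ws).
  by rewrite /G patchE mem_set; [rewrite gE|exact: inSq].
have key : (Fs <= 8 / d ^+ 2 * (K * j))%R.
  rewrite -lee_fin -g0; apply: (le_trans (mean_value_ineq d0 eg)).
  rewrite [leRHS]EFinM; apply: lee_wpmul2l; first by rewrite lee_fin divr_ge0// sqr_ge0.
  rewrite [leRHS]EFinM -EJ; apply: le_trans (_ : K%:E * \int[@dA R]_(u in sq d) (fnorm g u `^ q)%:E <= _).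
    rewrite -(ge0_integralZl _ (measurable_sq d)); first last.
    - by rewrite lee_fin ltW.
    - by move=> u _; rewrite lee_fin powR_ge0.
    - by apply: measurable_funTS; exact: measurable_powR_fnorm.
    apply: ge0_le_integral; first exact: measurable_sq.
    - by move=> u _; rewrite lee_fin fnorm_ge0.
    - by apply: measurable_funTS; apply/measurable_EFinP; exact: measurable_fnorm.
    - by apply: measurable_funTS; apply: emeasurable_funM => //; exact: measurable_powR_fnorm.
    - by move=> u su; rewrite -EFinM lee_fin bdK.
  by apply: (lee_wpmul2l _ trans_int); rewrite lee_fin ltW.
apply: (@le_trans _ _ (S `^ q)%R).
  by rewrite powR_mono// ?ltW.
rewrite tD in Sphi.
have H1 : (T < 2 * c * Fs)%R.
  rewrite /T ltr_pdivrMr//; lra.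
have d20 : (0 < d ^+ 2)%R by rewrite exprn_gt0.
have H2 : (T <= 16 * c * (K * j) / d ^+ 2)%R.
  apply: (le_trans (ltW H1)); apply: (le_trans (ler_wpM2l _ key)); first by rewrite mulr_ge0// ltW.
  by apply: eqW; field; rewrite gt_eqF.
have H3 : (K * S `^ q <= 16 * c * (K * j))%R by rewrite Sq mulrA KT -ler_pdivlMr.
rewrite -(ler_pM2l K0); apply: (le_trans H3).
by apply: eqW; ring.
Qed.

(** A power f^n is entire, and q / n <= 1 for n large. *)
Lemma submean (q : R) : (0 < q)%R -> exists2 C : R, (0 < C)%R & forall f, entire f ->
  (fnorm f (0, 0)%R `^ q)%:E <= C%:E * \int[@dA R]_(w in sq 1) (fnorm f w `^ q)%:E.
Proof.
move=> q0; pose n := (Num.truncn q).+1.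
have n0 : (0 < n%:R :> R)%R by rewrite ltr0n.
have q10 : (0 < q / n%:R)%R by rewrite divr_gt0.
have q11 : (q / n%:R <= 1)%R by rewrite ler_pdivrMr// mul1r ltW// truncnS_gt.
exists (16 * 2 `^ (2 / (q / n%:R)))%R; first by rewrite mulr_gt0// powR_gt0.
move=> f ef; have E w : (fnorm f w `^ q = fnorm (fun z => f z ^+ n)%R w `^ (q / n%:R))%R.
  have -> : (fnorm (fun z => f z ^+ n) w = fnorm f w ^+ n)%R.
    rewrite /fnorm; elim: (n) => [|k IH]; first by rewrite !expr0 normc1.
    by rewrite !exprS normcM IH.
  by rewrite -powR_mulrn ?fnorm_ge0// -powRrM mulrC divfK// gt_eqF.
have := submean_le1 q10 q11 (@entireX _ f n ef).
rewrite -E (eq_integral (fun w => (fnorm f w `^ q)%:E))// => w _.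
by rewrite E.
Qed.
End submean.

(** * Fock norms as weighted integrals *)

Section fock_basics.
Context {R : realType}.
Implicit Types (f g : R[i] -> R[i]) (p q r : R).

(** The modulus with a Gaussian weight chosen so that the integrand of [fock_norm p]
    is its p-th power, for every p. *)
Definition kf f (w : plane R) : R :=
  normc (f (to_C w)) * expR (- (normc (to_C w) ^+ 2 / 2)).

Lemma kf_ge0 f w : 0 <= kf f w.
Proof. by rewrite mulr_ge0 ?normc_ge0 ?expR_ge0. Qed.

Lemma measurable_kf f : entire f -> measurable_fun setT (kf f).
Proof.
move=> ef; apply: measurable_funM; first exact: measurable_fnorm.
apply: (measurableT_comp (@measurable_expR R)).
apply: measurableT_comp => //; apply: measurable_funM => //.
by apply: measurable_funX; exact: measurable_normc_toC.
Qed.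

Lemma kf_pow f p w :
  normc (f (to_C w)) `^ p * expR (- (p * normc (to_C w) ^+ 2 / 2)) = kf f w `^ p.
Proof.
rewrite /kf powRM ?normc_ge0 ?expR_ge0// -expRM; congr (_ * expR _); ring.
Qed.

Definition ipow p (u : plane R -> R) : \bar R := (\int[@dA R]_w (u w `^ p)%:E)%E.

Local Open Scope ereal_scope.

Lemma ipow_ge0 p u : 0 <= ipow p u.
Proof. by apply: integral_ge0 => w _; rewrite lee_fin powR_ge0. Qed.

Lemma measurable_pow p (u : plane R -> R) : measurable_fun setT u ->
  measurable_fun setT (fun w => (u w `^ p)%:E).
Proof. by move=> mu; apply/measurable_EFinP; exact: (measurableT_comp (measurable_powR p) mu). Qed.

Lemma le_ipow p (u v : plane R -> R) : (0 <= p)%R -> measurable_fun setT u -> measurable_fun setT v ->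
  (forall w, 0 <= u w)%R -> (forall w, u w <= v w)%R -> ipow p u <= ipow p v.
Proof.
move=> p0 mu mv u0 uv; apply: ge0_le_integral => //; try exact: measurable_pow.
  by move=> w _; rewrite lee_fin powR_ge0.
by move=> w _; rewrite lee_fin powR_mono.
Qed.

Lemma ipowZ p (c : R) (u : plane R -> R) : (0 <= c)%R -> measurable_fun setT u ->
  (forall w, 0 <= u w)%R -> ipow p (fun w => c * u w)%R = (c `^ p)%:E * ipow p u.
Proof.
move=> c0 mu u0; rewrite /ipow -ge0_integralZl//.
- by apply: eq_integral => w _; rewrite powRM// EFinM.
- exact: measurable_pow.
- by move=> w _; rewrite lee_fin powR_ge0.
- by rewrite lee_fin powR_ge0.
Qed.

Lemma fock_normE p f : fock_norm p f = ((p / (2 * pi))%:E * ipow p (kf f)) `^ p^-1.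
Proof.
by rewrite /fock_norm /ipow; congr ((_ * _) `^ _); apply: eq_integral => w _; rewrite kf_pow.
Qed.

Lemma kappa_gt0 p : (0 < p)%R -> (0 < p / (2 * pi))%R.
Proof. by move=> p0; rewrite divr_gt0// mulr_gt0// pi_gt0. Qed.

Lemma poweR_mono (x y : \bar R) r : (0 <= r)%R -> 0 <= x -> x <= y -> x `^ r <= y `^ r.
Proof.
move=> r0 x0 xy; apply: gt0_ler_poweR => //; rewrite in_itv /= andbC leey//=.
exact: le_trans xy.
Qed.

Lemma poweRK (x : \bar R) r : (0 < r)%R -> 0 <= x -> (x `^ r^-1) `^ r = x.
Proof. by move=> r0 x0; rewrite -poweRrM mulVf ?gt_eqF// poweRe1. Qed.

Lemma fock_norm_ge0 p f : 0 <= fock_norm p f.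
Proof. exact: poweR_ge0. Qed.

Lemma fock_norm_pow p f : (0 < p)%R -> fock_norm p f `^ p = (p / (2 * pi))%:E * ipow p (kf f).
Proof.
move=> p0; rewrite fock_normE poweRK// mule_ge0 ?ipow_ge0// lee_fin ltW//; exact: kappa_gt0.
Qed.

Lemma ipow_fock p f : (0 < p)%R -> ipow p (kf f) = (2 * pi / p)%:E * fock_norm p f `^ p.
Proof.
move=> p0; rewrite fock_norm_pow// muleA -EFinM (_ : _ * _ = 1)%R ?mul1e//.
have pi0 : (pi != 0 :> R)%R by rewrite gt_eqF ?pi_gt0.
have pn0 : (p != 0)%R by rewrite gt_eqF.
by move: pi0; move: (@pi R) => t t0; field; rewrite t0 pn0.
Qed.

Lemma fock_norm_lty p f : (0 < p)%R -> (fock_norm p f < +oo) <-> (ipow p (kf f) < +oo).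
Proof.
have fin (c : R) (x : \bar R) : (0 < c)%R -> x < +oo -> c%:E * x < +oo.
  by move=> c0 x0; apply: lte_mul_pinfty => //; rewrite lee_fin ltW.
move=> p0; split => [h|h].
  by rewrite ipow_fock//; apply: fin; [rewrite divr_gt0// mulr_gt0// pi_gt0|exact: poweR_lty].
by rewrite fock_normE poweR_lty//; apply: fin => //; exact: kappa_gt0.
Qed.

Lemma Lnorm_ipow r (u : plane R -> R) : (forall w, 0 <= u w)%R ->
  Lnorm (@dA R) r%:E (EFin \o u) = ipow r u `^ r^-1.
Proof.
move=> u0; rewrite Lnorm.unlock; congr (_ `^ _); apply: eq_integral => w _ /=.
by rewrite ?poweR_EFin ger0_norm.
Qed.

Lemma ipow_powR r s (u : plane R -> R) : ipow r (fun w => u w `^ s)%R = ipow (s * r) u.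
Proof. by apply: eq_integral => w _; rewrite powRrM. Qed.

(** Hoelder's inequality for the q-th powers, with the exponents p / (p - q) and
    p / q. *)
Lemma hoelder_ipow p q (u v : plane R -> R) : (0 < q)%R -> (q < p)%R ->
  measurable_fun setT u -> measurable_fun setT v ->
  (forall w, 0 <= u w)%R -> (forall w, 0 <= v w)%R ->
  ipow q (fun w => u w * v w)%R <=
  ipow (p * q / (p - q)) u `^ ((p - q) / p) * ipow p v `^ (q / p).
Proof.
move=> q0 qp mu mv u0 v0.
have p0 : (0 < p)%R by exact: lt_trans qp.
have pq0 : (0 < p - q)%R by rewrite subr_gt0.
have pn0 : (p != 0)%R by rewrite gt_eqF.
have qn0 : (q != 0)%R by rewrite gt_eqF.
have pqn0 : (p - q != 0)%R by rewrite gt_eqF.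
have mU : measurable_fun setT (fun w => u w `^ q)%R by exact: (measurableT_comp (measurable_powR q) mu).
have mV : measurable_fun setT (fun w => v w `^ q)%R by exact: (measurableT_comp (measurable_powR q) mv).
have P0 : (0 < p / (p - q))%R by rewrite divr_gt0.
have Q0 : (0 < p / q)%R by rewrite divr_gt0.
have PQ : ((p / (p - q))^-1 + (p / q)^-1 = 1)%R.
  by field; rewrite ?pn0 ?qn0 ?pqn0.
have := hoelder (@dA R) mU mV P0 Q0 PQ.
rewrite Lnorm1 !Lnorm_ipow; try by move=> w; exact: powR_ge0.
rewrite !ipow_powR.
rewrite (_ : q * (p / (p - q)) = p * q / (p - q))%R; last by ring.
rewrite (_ : q * (p / q) = p)%R; last by field.
rewrite (_ : (p / (p - q))^-1 = (p - q) / p)%R; last by rewrite invf_div.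
rewrite invf_div; congr (_ <= _); apply: eq_integral => w _ /=.
by rewrite powRM// ger0_norm// mulr_ge0 ?powR_ge0.
Qed.

Section weighted.
Variables (psi : R[i] -> R[i]) (a b : R[i]).
Hypothesis epsi : entire psi.
Let phi := fun z : R[i] => (a * z + b)%R.
Let W := weighted_comp psi phi.

Definition mw (w : plane R) : R := m_fun psi phi (to_C w).
Definition aff (w : plane R) : plane R := of_C (a * to_C w + b)%R.

Lemma mw_ge0 w : (0 <= mw w)%R.
Proof. by rewrite mulr_ge0 ?normc_ge0 ?expR_ge0. Qed.

Lemma entire_phi : entire phi.
Proof. exact: (@entire_affine _ (fun z => z) a b (@entire_id R)). Qed.

Lemma entire_W f : entire f -> entire (W f).
Proof. by move=> ef; exact: (entireM epsi (@entire_affine _ f a b ef)). Qed.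

Lemma measurable_mw : measurable_fun setT mw.
Proof.
apply: measurable_funM; first exact: measurable_fnorm.
apply: (measurableT_comp (@measurable_expR R)).
apply: measurable_funM => //; apply: measurable_funB; apply: measurable_funX.
  exact: (measurable_normc_entire entire_phi).
exact: measurable_normc_toC.
Qed.

(** On weighted moduli the operator is multiplication by the function m after
    composition with [phi]: the factor e^(|phi|^2/2) of m undoes the weight of f at
    phi(z), and e^(-|z|^2/2) is the weight at z. *)
Lemma kf_W f w : kf (W f) w = (mw w * kf f (aff w))%R.
Proof.
rewrite /kf /mw /m_fun /W /weighted_comp normcM /aff of_CK -/(phi (to_C w)).
have -> : expR (- (normc (to_C w) ^+ 2 / 2)) =
    (expR ((normc (phi (to_C w)) ^+ 2 - normc (to_C w) ^+ 2) / 2) *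
     expR (- (normc (phi (to_C w)) ^+ 2 / 2)))%R.
  by rewrite -expRD; congr expR; field.
by rewrite /phi; ring.
Qed.

Lemma measurable_kf_aff f : entire f -> measurable_fun setT (fun w => kf f (aff w)).
Proof.
by move=> ef; exact: (measurableT_comp (measurable_kf ef) (measurable_affine a b)).
Qed.

Lemma ipow_aff f p : entire f -> a != 0%R ->
  ipow p (fun w => kf f (aff w)) = (normc a ^- 2)%:E * ipow p (kf f).
Proof.
move=> ef a0; rewrite /ipow; apply: (integral_affine b a0 (g := fun w => (kf f w `^ p)%:E)).
  exact: (measurable_pow p (measurable_kf ef)).
by move=> w; rewrite lee_fin powR_ge0.
Qed.

Lemma ipow_W_le p q f : (0 < q)%R -> (q < p)%R -> entire f -> a != 0%R ->
  ipow q (kf (W f)) <= ipow (p * q / (p - q)) mw `^ ((p - q) / p) *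
    ((normc a ^- 2)%:E * ipow p (kf f)) `^ (q / p).
Proof.
move=> q0 qp ef a0; rewrite -ipow_aff//.
apply: le_trans (hoelder_ipow q0 qp measurable_mw (measurable_kf_aff ef) mw_ge0 (fun=> kf_ge0 _ _)).
by rewrite /ipow; apply: eqW; apply: eq_integral => w _; rewrite kf_W.
Qed.

Lemma Lr_normE r : Lr_norm r (m_fun psi phi) = ipow r mw `^ r^-1.
Proof.
exact: (Lnorm_ipow r mw_ge0).
Qed.

Lemma in_LrE r : (0 < r)%R -> in_Lr r (m_fun psi phi) <-> ipow r mw < +oo.
Proof.
move=> r0; rewrite /in_Lr.
have E : Lr_norm r (m_fun psi phi) < +oo <-> ipow r mw < +oo.
  rewrite Lr_normE; split; last exact: poweR_lty.
  by apply: lty_poweRy; rewrite invr_neq0// gt_eqF.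
split.
  by move=> /andP[_]; rewrite inE /= /finite_norm => /E.
move=> /E h; apply/andP; split; rewrite inE //=.
exact: measurable_mw.
Qed.

(** The upper bound for the operator norm: the inequality of Hoelder for the product
    of m and kf f o phi, and the factor |a|^-2 of the substitution by [phi]. *)
Lemma fock_norm_W_le p q f : (0 < q)%R -> (q < p)%R -> entire f -> a != 0%R ->
  fock_norm q (W f) <=
   (((q / (2 * pi)) `^ q^-1 * (normc a ^- 2 * (2 * pi / p)) `^ p^-1)%R)%:E *
    Lr_norm (p * q / (p - q)) (m_fun psi phi) * fock_norm p f.
Proof.
move=> q0 qp ef a0.
have p0 : (0 < p)%R by exact: lt_trans qp.
have pq0 : (0 < p - q)%R by rewrite subr_gt0.
have pn0 : (p != 0)%R by rewrite gt_eqF.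
have qn0 : (q != 0)%R by rewrite gt_eqF.
have pqn0 : (p - q != 0)%R by rewrite gt_eqF.
have k0 : 0 <= (q / (2 * pi))%:E by rewrite lee_fin ltW// kappa_gt0.
have na : (0 <= normc a ^- 2)%R by rewrite invr_ge0 exprn_ge0// normc_ge0.
have kp : (0 <= 2 * pi / p)%R by rewrite divr_ge0 ?mulr_ge0 ?pi_ge0// ltW.
rewrite fock_normE; apply: (le_trans (poweR_mono _ _ (lee_wpmul2l k0 (ipow_W_le q0 qp ef a0)))).
- by rewrite invr_ge0 ltW.
- by rewrite mule_ge0// ipow_ge0.
rewrite poweRM//; last by rewrite mule_ge0// poweR_ge0.
rewrite poweRM ?poweR_ge0// -!poweRrM.
rewrite ipow_fock//.
have -> : (normc a ^- 2)%:E * ((2 * pi / p)%:E * fock_norm p f `^ p) =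
    (normc a ^- 2 * (2 * pi / p))%:E * fock_norm p f `^ p by rewrite muleA -EFinM.
rewrite [X in _ * (_ * X)]poweRM ?poweR_ge0 ?lee_fin ?mulr_ge0//.
rewrite -poweRrM Lr_normE.
rewrite (_ : (p - q) / p / q = (p * q / (p - q))^-1)%R; last by field; rewrite ?pn0 ?qn0 ?pqn0.
rewrite (_ : q / p / q = p^-1)%R; last by field; rewrite ?pn0 ?qn0 ?pqn0.
rewrite (_ : p * p^-1 = 1)%R; last by rewrite divff// gt_eqF.
rewrite (poweRe1 (fock_norm_ge0 _ _)) !poweR_EFin [in leRHS]EFinM.
apply: eqW.
by rewrite -!muleA; congr (_ * _); rewrite muleCA.
- exact: pi_ge0.
- by rewrite invr_ge0 ltW.
Qed.
End weighted.
End fock_basics.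

(** * Kernel functions at lattice points *)

Section gaussian_kernels.
Context {R : realType}.
Notation TR := (measurableTypeR R).

(** The reproducing kernel of the point s + i t, normalized so that its weighted
    modulus is a Gaussian of height 1. *)
Definition gker (s t : R) : R[i] -> R[i] :=
  fun w => cexp (Complex s (- t) * w + Complex (- ((s ^+ 2 + t ^+ 2) / 2)) 0).

(** The square root of the weighted modulus of [gker s t]. It occurs squared: one
    factor is summed over the lattice, the other one keeps the decay. *)
Definition gauss2 (s t : R) (w : plane R) : R :=
  expR (- (((w.1 - s) ^+ 2 + (w.2 - t) ^+ 2) / 4)).

Lemma entire_gker s t : entire (gker s t).
Proof. exact: entire_affine (@entire_cexp R). Qed.

Lemma gauss2_ge0 s t w : 0 <= gauss2 s t w. Proof. exact: expR_ge0. Qed.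

Lemma kf_gker s t w : kf (gker s t) w = gauss2 s t w ^+ 2.
Proof.
rewrite /kf /gker normc_cexp normcE -expRD /gauss2 [RHS]expr2 -[RHS]expRD; congr expR.
by case: w => x y /=; field.
Qed.

Lemma measurable_gauss2 s t : measurable_fun setT (gauss2 s t).
Proof.
apply: (measurableT_comp (@measurable_expR R)).
apply: measurableT_comp => //; apply: measurable_funM => //.
by apply: measurable_funD; apply: measurable_funX; apply: measurable_funB.
Qed.

(** With increments of [atan] on the right, the sum over the integers telescopes to
    a bound that depends neither on their number nor on the translation. *)
Lemma atan_step (t : R) : expR (- (t ^+ 2 / 4)) <= 8 * (atan (t + 1) - atan t).
Proof.
have lt : t < t + 1 by rewrite ltrDl.
have [c] := @MVT R (@atan R) (fun c => (1 + c ^+ 2)^-1) t (t + 1) lt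
  (fun x _ => is_derive1_atan x) (continuous_subspaceT (fun x => @continuous_atan R x)).
rewrite in_itv /= => /andP[c1 c2] ->.
rewrite (_ : t + 1 - t = 1); last by ring.
have d0 : 0 < 1 + c ^+ 2 by rewrite ltr_pwDl// sqr_ge0.
rewrite mulr1 ler_pdivlMr// expRN ler_pdivrMl ?expR_gt0//.
have h := expR_ge1Dx (t ^+ 2 / 4).
apply: le_trans (_ : (1 + t ^+ 2 / 4) * 8 <= _); last by rewrite ler_wpM2r.
have : c ^+ 2 <= (`|t| + 1) ^+ 2.
  rewrite -(real_normK (num_real c)) lerXn2r ?nnegrE ?addr_ge0//.
  by rewrite ler_norml; have := ler_norm (- t); rewrite normrN; have := ler_norm t => ? ?; apply/andP; split; lra.
have := sqr_ge0 (`|t| - 1); rewrite sqrrB sqrrD !expr1n !mulr1 (real_normK (num_real t)).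
have t2 := sqr_ge0 t => ? ?; lra.
Qed.

Lemma gauss_sum1 (N : nat) (y : R) :
  \sum_(i < N) expR (- ((y - i%:R) ^+ 2 / 4)) <= 8 * pi.
Proof.
apply: le_trans (_ : 8 * (atan (N%:R - y) - atan (- y)) <= _); last first.
  rewrite ler_wpM2l// lerBlDr.
  by have := atan_ltpi2 (N%:R - y); have := atan_gtNpi2 (- y) => ? ?; lra.
elim: N => [|N IH]; first by rewrite big_ord0 sub0r subrr mulr0.
rewrite big_ord_recr /=; have := atan_step (N%:R - y).
rewrite -sqrrN opprB (_ : N%:R - y + 1 = N.+1%:R - y); last by rewrite -natr1; ring.
move=> h.
have := lerD IH h; move=> /le_trans; apply.
by apply: eqW; ring.
Qed.

(** The indices start from 0, and [m] moves the lattice points to a square around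
    the origin. *)
Definition latt (n : nat) (m : R) (j : 'I_n * 'I_n) : R * R := (j.1%:R - m, j.2%:R - m).
Definition lgauss (n : nat) (m : R) (j : 'I_n * 'I_n) := gauss2 (latt m j).1 (latt m j).2.
Definition cA : R := (8 * pi) ^+ 2.

Lemma cA_gt0 : 0 < cA.
Proof. by rewrite exprn_gt0// mulr_gt0// pi_gt0. Qed.

Lemma gauss_sum2 n m w : \sum_(j : 'I_n * 'I_n) lgauss m j w <= cA.
Proof.
rewrite -(pair_bigA _ (fun i k => lgauss m (i, k) w)) /=.
rewrite (eq_bigr (fun i : 'I_n => expR (- ((w.1 + m - i%:R) ^+ 2 / 4)) *
   \sum_(k < n) expR (- ((w.2 + m - k%:R) ^+ 2 / 4)))); last first.
  move=> i _; rewrite mulr_sumr; apply: eq_bigr => k _.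
  by rewrite /lgauss /gauss2 /latt /= -expRD; congr expR; field.
rewrite -mulr_suml /cA expr2 ler_pM ?gauss_sum1// sumr_ge0// => i _; exact: expR_ge0.
Qed.

Local Open Scope ereal_scope.

Lemma gauss_integral1 (c : R) : (0 < c)%R ->
  \int[@lebesgue_measure R]_x (expR (- (c * x ^+ 2)))%:E = (Num.sqrt pi / Num.sqrt c)%:E.
Proof.
move=> c0; have s0 : (0 < Num.sqrt c)%R by rewrite sqrtr_gt0.
transitivity (\int[@lebesgue_measure R]_x (gauss_fun (Num.sqrt c * x + 0))%:E).
  by apply: eq_integral => x _; rewrite /gauss_fun addr0 exprMn sqr_sqrtr// ltW.
rewrite (@ge0_integral_affR R (Num.sqrt c) 0 (fun x => (gauss_fun x)%:E)) ?gt_eqF//.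
- by rewrite integralT_gauss -EFinM ger0_norm ?sqrtr_ge0// mulrC.
- by apply/measurable_EFinP; exact: measurable_gauss_fun.
- by move=> x; rewrite lee_fin gauss_fun_ge0.
Qed.

Lemma gauss_integral2 (p : R) : (0 < p)%R -> exists2 g : R, (0 < g)%R &
  forall s t, ipow p (gauss2 s t) = g%:E.
Proof.
move=> p0; have c0 : (0 < p / 4)%R by rewrite divr_gt0.
have g0 : (0 < Num.sqrt pi / Num.sqrt (p / 4) :> R)%R by rewrite divr_gt0// sqrtr_gt0// pi_gt0.
exists ((Num.sqrt pi / Num.sqrt (p / 4)) ^+ 2)%R; first by rewrite exprn_gt0.
move=> s t; pose u (x : R) := expR (- (p / 4 * x ^+ 2)).
have E (w : plane R) : (gauss2 s t w `^ p = u (w.1 - s) * u (w.2 - t))%R.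
  by rewrite /gauss2 -expRM /u -expRD; congr expR; field.
have mp := measurable_pow p (measurable_gauss2 s t).
rewrite /ipow /dA [LHS](fubini_tonelli1 _ mp); last by move=> w; rewrite lee_fin powR_ge0.
have mu' : measurable_fun setT (u : TR -> R).
  apply: (measurableT_comp (@measurable_expR R)).
  by apply: measurableT_comp => //; apply: measurable_funM => //; exact: measurable_funX.
have Iu (y : R) : \int[@lebesgue_measure R]_x (u (x - y))%:E = (Num.sqrt pi / Num.sqrt (p / 4))%:E.
  transitivity (\int[@lebesgue_measure R]_x (u (1 * x + - y))%:E).
    by apply: eq_integral => x _; rewrite mul1r.
  rewrite (@ge0_integral_affR R 1 (- y) (fun x => (u x)%:E)) ?oner_neq0//.
  - by rewrite normr1 invr1 mul1e gauss_integral1.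
  - by apply/measurable_EFinP.
  - by move=> x; rewrite lee_fin expR_ge0.
have ms (y : R) : measurable_fun setT (fun x : TR => u (x - y)%R).
  by apply: (measurableT_comp mu'); exact: measurable_funB.
rewrite (eq_integral (fun x : TR => (Num.sqrt pi / Num.sqrt (p / 4))%:E * (u (x - s)%R)%:E)).
  rewrite ge0_integralZl//.
  - by rewrite Iu -EFinM expr2.
  - by apply/measurable_EFinP.
  - by move=> x _; rewrite lee_fin expR_ge0.
move=> x _; rewrite /fubini_F -(Iu t) muleC -ge0_integralZl//.
- by apply: eq_integral => y _; rewrite -EFinM E.
- by apply/measurable_EFinP.
- by move=> y _; rewrite lee_fin expR_ge0.
- by rewrite lee_fin expR_ge0.
Qed.
End gaussian_kernels.

(** * Random signs *)

Section test_functions.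
Context {R : realType}.
Variables (n : nat) (m : R).
Let J : finType := ('I_n * 'I_n)%type.
Implicit Types (c : J -> R) (e : {ffun J -> bool}) (w : plane R).

Definition sgnc c e (j : J) : R := if e j then c j else - c j.

Definition tfun c e : R[i] -> R[i] := fun z =>
  \sum_(j : J) ((sgnc c e j)%:C)%C * gker (latt m j).1 (latt m j).2 z.

Lemma normc_real (x : R) : normc ((x%:C)%C) = `|x|.
Proof. by rewrite /normc /= expr0n addr0 sqrtr_sqr. Qed.

Lemma normc_sum (I : Type) (s : seq I) (F : I -> R[i]) :
  normc (\sum_(i <- s) F i) <= \sum_(i <- s) normc (F i).
Proof.
elim: s => [|i s IH]; first by rewrite !big_nil normc0.
by rewrite !big_cons (le_trans (le_normcD _ _))// lerD2l.
Qed.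

Lemma entire_tfun c e : entire (tfun c e).
Proof.
apply: entire_sum => j; apply: (entireM (@entire_cst R _)); exact: entire_gker.
Qed.

Lemma sgnc_abs c e j : (forall j, 0 <= c j) -> `|sgnc c e j| = c j.
Proof. by move=> c0; rewrite /sgnc; case: (e j); rewrite ?normrN ger0_norm. Qed.

Lemma kfZ (a : R[i]) f w : kf (fun z => a * f z) w = normc a * kf f w.
Proof. by rewrite /kf normcM mulrA. Qed.

Lemma kf_tfun_le c e w : (forall j, 0 <= c j) ->
  kf (tfun c e) w <= \sum_(j : J) c j * lgauss m j w ^+ 2.
Proof.
move=> c0; rewrite /kf /tfun.
apply: le_trans (ler_wpM2r (expR_ge0 _) (normc_sum _ _)) _.
rewrite mulr_suml; apply: ler_sum => j _.
by rewrite normcM normc_real sgnc_abs// -mulrA -/(kf _ w) kf_gker.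
Qed.

(** Let G_j be the Gaussians and let L^p be the sum of the c_j^p G_j^p. Every c_j G_j
    is at most L, so the sum of the c_j G_j^2 is at most L times the sum of the G_j,
    which is bounded. *)
Lemma kf_tfun_pow (p : R) c e w : 0 < p -> (forall j, 0 <= c j) ->
  kf (tfun c e) w `^ p <= cA `^ p * \sum_(j : J) c j `^ p * lgauss m j w `^ p.
Proof.
move=> p0 c0; set S := \sum_(j : J) _.
have S0 : 0 <= S by apply: sumr_ge0 => j _; rewrite mulr_ge0 ?powR_ge0.
pose L := S `^ p^-1; have L0 : 0 <= L by exact: powR_ge0.
have G0 j : 0 <= lgauss m j w by exact: gauss2_ge0.
have cL j : c j * lgauss m j w <= L.
  have -> : c j * lgauss m j w = ((c j * lgauss m j w) `^ p) `^ p^-1.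
    by rewrite -powRrM divff ?gt_eqF// powRr1// mulr_ge0.
  apply: powR_mono; [by rewrite invr_ge0 ltW|exact: powR_ge0|].
  rewrite powRM// /S (bigD1 j)//= lerDl; apply: sumr_ge0 => i _.
  by rewrite mulr_ge0 ?powR_ge0.
have : kf (tfun c e) w <= cA * L.
  apply: (le_trans (kf_tfun_le _ _ c0)).
  apply: le_trans (_ : \sum_(j : J) L * lgauss m j w <= _).
    by apply: ler_sum => j _; rewrite expr2 mulrA ler_wpM2r.
  by rewrite -mulr_sumr mulrC ler_wpM2r// gauss_sum2.
move=> /(powR_mono (ltW p0) (kf_ge0 _ _))/le_trans; apply.
rewrite powRM ?(ltW (cA_gt0))// /L -powRrM mulVf ?gt_eqF// powRr1//.
Qed.

Definition flip (j : J) e : {ffun J -> bool} := [ffun i => if i == j then ~~ e i else e i].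

Lemma flipK j : involutive (flip j).
Proof.
move=> e; apply/ffunP => i; rewrite !ffunE; case: eqP => // _; exact: negbK.
Qed.

Lemma kfB f g w : kf (fun z => f z - g z) w <= kf f w + kf g w.
Proof. by rewrite /kf -mulrDl ler_wpM2r ?expR_ge0// normc_sub. Qed.

(** Two functions whose signs differ at [j] alone differ by twice the term of index
    [j], so one of them is at least as large as this term. *)
Lemma kf_flip c e j w : (forall j, 0 <= c j) ->
  2 * (c j * lgauss m j w ^+ 2) <= kf (tfun c e) w + kf (tfun c (flip j e)) w.
Proof.
move=> c0; apply: le_trans (kfB _ _ _).
rewrite (_ : (fun z => _) = (fun z => ((2 * sgnc c e j)%:C)%C * gker (latt m j).1 (latt m j).2 z)).
  by rewrite kfZ kf_gker normc_real normrM sgnc_abs// ger0_norm// mulrA.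
apply/funext => z; rewrite /tfun -sumrB (bigD1 j)//= big1 ?addr0.
  rewrite -mulrBl; congr (_ * _); rewrite /sgnc /flip ffunE eqxx.
  by case: (e j) => /=; apply/eqP; rewrite eq_complex /=; apply/andP; split; apply/eqP; ring.
move=> i ij; rewrite -mulrBl (_ : sgnc c (flip j e) i = sgnc c e i) ?subrr ?mul0r//.
by rewrite /sgnc /flip ffunE (negbTE ij).
Qed.

Definition nsign : R := #|{ffun J -> bool}|%:R.

Lemma nsign_gt0 : 0 < nsign.
Proof. by rewrite /nsign ltr0n; apply/card_gt0P; exists [ffun=> true]. Qed.

(** The patterns of signs are paired by [flip j], and one of each pair is good by
    [kf_flip]. This replaces the inequality of Khinchin, and is enough because the
    terms are localized at separate lattice points. *)
Lemma sign_average (q : R) c j w : 0 < q -> (forall j, 0 <= c j) ->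
  (c j * lgauss m j w ^+ 2) `^ q <= 2 / nsign * \sum_(e : {ffun J -> bool}) kf (tfun c e) w `^ q.
Proof.
move=> q0 c0; set x := c j * _; set S := \sum_(e : {ffun J -> bool}) _.
have x0 : 0 <= x by rewrite mulr_ge0// sqr_ge0.
have ES : S = \sum_(e : {ffun J -> bool}) kf (tfun c (flip j e)) w `^ q.
  by rewrite /S (reindex_inj (inv_inj (flipK j))).
have : nsign * x `^ q <= S + S.
  rewrite {2}ES /S -big_split /= /nsign -sum1_card natr_sum mulr_suml.
  apply: ler_sum => e _; rewrite mul1r.
  have h := kf_flip e j w c0; rewrite -/x in h.
  have [h1|h1] := leP x (kf (tfun c e) w).
    by apply: (le_trans (powR_mono (ltW q0) x0 h1)); rewrite lerDl powR_ge0.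
  have h2 : x <= kf (tfun c (flip j e)) w by lra.
  by apply: (le_trans (powR_mono (ltW q0) x0 h2)); rewrite lerDr powR_ge0.
rewrite -ler_pdivlMl ?nsign_gt0// => /le_trans; apply.
by apply: eqW; ring.
Qed.

(** The last factor makes the bounds of [sign_average] summable over [j]. *)
Definition lweight (q : R) (j : J) w : R := (lgauss m j w ^+ 2) `^ q * lgauss m j w.

Lemma sign_average_sum (q : R) c w : 0 < q -> (forall j, 0 <= c j) ->
  \sum_(j : J) c j `^ q * lweight q j w <=
  2 * cA / nsign * \sum_(e : {ffun J -> bool}) kf (tfun c e) w `^ q.
Proof.
move=> q0 c0; set S := \sum_(e : {ffun J -> bool}) _.
have S0 : 0 <= S by apply: sumr_ge0 => e _; exact: powR_ge0.
apply: le_trans (_ : \sum_(j : J) (2 / nsign * S) * lgauss m j w <= _).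
  apply: ler_sum => j _; rewrite /lweight mulrA -powRM ?sqr_ge0//.
  by rewrite ler_wpM2r ?gauss2_ge0//; exact: sign_average.
rewrite -mulr_sumr (_ : 2 * cA / nsign * S = 2 / nsign * S * cA); last by ring.
rewrite ler_wpM2l ?gauss_sum2// mulr_ge0// divr_ge0// ltW// nsign_gt0//.
Qed.

Lemma lweight_ge0 q j w : 0 <= lweight q j w.
Proof. by rewrite mulr_ge0 ?powR_ge0 ?gauss2_ge0. Qed.

Lemma measurable_lweight q j : measurable_fun setT (lweight q j).
Proof.
apply: measurable_funM; last exact: measurable_gauss2.
apply: (measurableT_comp (measurable_powR q)).
by apply: measurable_funX; exact: measurable_gauss2.
Qed.

Local Open Scope ereal_scope.

Lemma ipow_tfun (p g : R) c e : (0 < p)%R -> (forall s t, ipow p (@gauss2 R s t) = g%:E) ->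
  (forall j, 0 <= c j)%R ->
  ipow p (kf (tfun c e)) <= (cA `^ p * g * \sum_(j : J) c j `^ p)%:E.
Proof.
move=> p0 gP c0.
apply: le_trans (_ : \int[@dA R]_w ((cA `^ p)%:E * \sum_(j : J) (c j `^ p)%:E * (lgauss m j w `^ p)%:E) <= _).
  apply: ge0_le_integral => //.
  - by move=> w _; rewrite lee_fin powR_ge0.
  - by apply: measurable_pow; apply: measurable_kf; exact: entire_tfun.
  - apply: emeasurable_funM => //; apply: emeasurable_sum => j.
    apply: emeasurable_funM => //; exact: (measurable_pow p (measurable_gauss2 _ _)).
  - move=> w _; under eq_bigr do rewrite -EFinM.
    by rewrite sumEFin -EFinM lee_fin kf_tfun_pow.
rewrite ge0_integralZl//; first last.
- by rewrite lee_fin powR_ge0.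
- by move=> w _; apply: sume_ge0 => j _; rewrite mule_ge0// lee_fin powR_ge0.
- apply: emeasurable_sum => j.
  apply: emeasurable_funM => //; exact: (measurable_pow p (measurable_gauss2 _ _)).
rewrite ge0_integral_sum//; first last.
- by move=> j w _; rewrite mule_ge0// lee_fin powR_ge0.
- by move=> j; apply: emeasurable_funM => //; exact: (measurable_pow p (measurable_gauss2 _ _)).
rewrite (eq_bigr (fun j => (c j `^ p * g)%:E)); last first.
  move=> j _; rewrite ge0_integralZl//.
  - by rewrite [X in _ * X](gP (latt m j).1 (latt m j).2) EFinM.
  - exact: (measurable_pow p (measurable_gauss2 _ _)).
  - by move=> w _; rewrite lee_fin powR_ge0.
  - by rewrite lee_fin powR_ge0.
by rewrite sumEFin -EFinM lee_fin -mulr_suml -mulrA [(g * _)%R]mulrC.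
Qed.

End test_functions.

(** * The lower bound for the operator norm *)

Section sign_test.
Context {R : realType}.
Variables (p q : R) (psi : R[i] -> R[i]) (a b : R[i]).
Hypotheses (q0 : 0 < q) (qp : q < p) (epsi : entire psi).
Let phi := fun z : R[i] => a * z + b.
Let W := weighted_comp psi phi.
Notation mw := (mw psi a b).
Notation aff := (aff a b).
Let p0 : 0 < p. Proof. exact: lt_trans qp. Qed.
Let kW f w : kf (W f) w = mw w * kf f (aff w).
Proof. exact: kf_W. Qed.

Local Open Scope ereal_scope.

(** Boundedness of [W] with powers of the norms: [X] stands for the p-th power of
    the norm of f, and then [N] for the q-th power of the norm of [W]. *)
Definition bounded_pow (N : R) := forall f, entire f -> forall X : R, (0 <= X)%R ->
  ipow p (kf f) <= X%:E -> ipow q (kf (W f)) <= (N * X `^ (q / p))%:E.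

(** The mass of m^q on the part of the plane that [phi] sends near the lattice point
    of index [j]. *)
Definition cell_mass (n : nat) (m : R) (j : 'I_n * 'I_n) : \bar R :=
  \int[@dA R]_w (mw w `^ q * lweight m q j (aff w))%:E.

Lemma measurable_cell n m (j : 'I_n * 'I_n) :
  measurable_fun setT (fun w : plane R => (mw w `^ q * lweight m q j (aff w))%:E).
Proof.
apply/measurable_EFinP; apply: measurable_funM.
  exact: (measurableT_comp (measurable_powR q) (measurable_mw a b epsi)).
exact: (measurableT_comp (measurable_lweight m q j) (measurable_affine a b)).
Qed.

Lemma cell_mass_ge0 n m (j : 'I_n * 'I_n) : 0 <= cell_mass m j.
Proof.
by apply: integral_ge0 => w _; rewrite lee_fin mulr_ge0 ?powR_ge0 ?lweight_ge0.
Qed.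

Definition cB (g : R) : R := 2 * cA * (cA `^ p * g) `^ (q / p).

(** The operator is applied to the functions with all the patterns of signs, and the
    resulting inequalities are averaged. *)
Lemma test_inequality (N g : R) n m (c : 'I_n * 'I_n -> R) : bounded_pow N -> (0 <= N)%R ->
  (0 < g)%R -> (forall s t, ipow p (@gauss2 R s t) = g%:E) -> (forall j, 0 <= c j)%R ->
  \sum_(j : 'I_n * 'I_n) (c j `^ q)%:E * cell_mass m j <=
  (cB g * N * (\sum_(j : 'I_n * 'I_n) c j `^ p) `^ (q / p))%:E.
Proof.
move=> BN N0 g0 gP c0; set X := (\sum_(j : 'I_n * 'I_n) c j `^ p)%R.
have X0 : (0 <= X)%R by apply: sumr_ge0 => j _; exact: powR_ge0.
have K0 := @nsign_gt0 R n.
have A0 : (0 <= cA :> R)%R by exact: ltW (@cA_gt0 R).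
have k0 : (0 <= 2 * cA / nsign n :> R)%R.
  by apply: divr_ge0; [exact: mulr_ge0|exact: ltW].
have mt (e : {ffun 'I_n * 'I_n -> bool}) : measurable_fun setT (fun w => (kf (W (tfun m c e)) w `^ q)%:E).
  by apply: measurable_pow; apply: measurable_kf; exact: (@entire_W R psi a b epsi _ (@entire_tfun R n m c e)).
have -> : \sum_(j : 'I_n * 'I_n) (c j `^ q)%:E * cell_mass m j =
    \int[@dA R]_w (\sum_(j : 'I_n * 'I_n) (c j `^ q)%:E * (mw w `^ q * lweight m q j (aff w))%:E).
  rewrite ge0_integral_sum//; first last.
  - by move=> j w _; rewrite mule_ge0 ?lee_fin ?powR_ge0// mulr_ge0 ?powR_ge0 ?lweight_ge0.
  - by move=> j; apply: emeasurable_funM => //; exact: measurable_cell.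
  apply: eq_bigr => j _; rewrite ge0_integralZl//.
  - exact: measurable_cell.
  - by move=> w _; rewrite lee_fin mulr_ge0 ?powR_ge0 ?lweight_ge0.
  - by rewrite lee_fin powR_ge0.
apply: le_trans (_ : \int[@dA R]_w ((2 * cA / nsign n)%:E *
    \sum_(e : {ffun 'I_n * 'I_n -> bool}) (kf (W (tfun m c e)) w `^ q)%:E) <= _).
  apply: ge0_le_integral => //.
  - move=> w _; apply: sume_ge0 => j _.
    by rewrite mule_ge0 ?lee_fin ?powR_ge0// mulr_ge0 ?powR_ge0 ?lweight_ge0.
  - apply: emeasurable_sum => j; apply: emeasurable_funM => //; exact: measurable_cell.
  - by apply: emeasurable_funM => //; exact: emeasurable_sum.
  - move=> w _.
    rewrite (eq_bigr (fun j => (c j `^ q * (mw w `^ q * lweight m q j (aff w)))%:E)); last first.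
      by move=> j _; rewrite EFinM.
    rewrite !sumEFin -EFinM lee_fin.
    rewrite (eq_bigr (fun j => mw w `^ q * (c j `^ q * lweight m q j (aff w))))%R; last first.
      by move=> j _; rewrite mulrCA.
    rewrite [in leRHS](eq_bigr (fun e => mw w `^ q * kf (tfun m c e) (aff w) `^ q))%R; last first.
      by move=> e _; rewrite (kW (tfun m c e) w); exact: (powRM q (mw_ge0 psi a b w) (kf_ge0 _ _)).
    rewrite -!mulr_sumr [leRHS]mulrCA ler_wpM2l ?powR_ge0//.
    exact: sign_average_sum.
rewrite ge0_integralZl//; first last.
- by move=> w _; apply: sume_ge0 => e _; rewrite lee_fin powR_ge0.
- exact: emeasurable_sum.
rewrite ge0_integral_sum//; last by move=> e w _; rewrite lee_fin powR_ge0.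
apply: le_trans (_ : (2 * cA / nsign n)%:E *
   \sum_(e : {ffun 'I_n * 'I_n -> bool}) (N * (cA `^ p * g * X) `^ (q / p))%:E <= _).
  apply: lee_wpmul2l; first by rewrite lee_fin.
  apply: lee_sum => e _; apply: BN; first exact: entire_tfun.
    by rewrite !mulr_ge0 ?powR_ge0// ltW.
  exact: ipow_tfun.
rewrite sumEFin -EFinM lee_fin sumr_const -[X in (_ * X)%R]mulr_natl -/(nsign n).
rewrite powRM ?mulr_ge0 ?powR_ge0 ?(ltW g0)//.
apply: eqW; rewrite /cB; field.
by rewrite gt_eqF.
Qed.

(** Finiteness comes from [test_inequality] with a single kernel function. *)
Lemma cell_mass_fin (N g : R) n m (j : 'I_n * 'I_n) : bounded_pow N -> (0 <= N)%R ->
  (0 < g)%R -> (forall s t, ipow p (@gauss2 R s t) = g%:E) ->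
  cell_mass m j = (fine (cell_mass m j))%:E.
Proof.
move=> BN N0 g0 gP; rewrite fineK// ge0_fin_numE ?cell_mass_ge0//.
pose c i : R := if i == j then 1%R else 0%R.
have c0 i : (0 <= c i)%R by rewrite /c; case: eqP.
apply: le_lt_trans (ltry _).
apply: le_trans (test_inequality m BN N0 g0 gP c0).
rewrite (bigD1 j)//= /c eqxx powR1 mul1e leeDl// sume_ge0// => i _.
by rewrite mule_ge0 ?cell_mass_ge0// lee_fin powR_ge0.
Qed.

(** Duality between sequences: if I_j are the masses, then c_j = I_j^(1/(p-q))
    makes c_j^p equal to c_j^q I_j, so that the sum of these numbers occurs on both
    sides of [test_inequality]. *)
Lemma cell_mass_sum (N g : R) n m : bounded_pow N -> (0 <= N)%R ->
  (0 < g)%R -> (forall s t, ipow p (@gauss2 R s t) = g%:E) ->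
  (\sum_(j : 'I_n * 'I_n) fine (cell_mass m j) `^ (p / (p - q)) <= (cB g * N) `^ (p / (p - q)))%R.
Proof.
move=> BN N0 g0 gP; pose i (j : 'I_n * 'I_n) := fine (cell_mass m j).
have pq0 : (0 < p - q)%R by rewrite subr_gt0.
have i0 j : (0 <= i j)%R by rewrite /i fine_ge0// cell_mass_ge0.
pose c j := (i j `^ (p - q)^-1)%R.
have c0 j : (0 <= c j)%R by exact: powR_ge0.
have := test_inequality m BN N0 g0 gP c0.
under eq_bigr => j _ do rewrite (cell_mass_fin m j BN N0 g0 gP) -EFinM.
rewrite sumEFin lee_fin.
have pn0 : (p != 0)%R by rewrite gt_eqF.
have qn0 : (q != 0)%R by rewrite gt_eqF.
have pqn0 : (p - q != 0)%R by rewrite gt_eqF.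
have cp j : (c j `^ p = i j `^ (p / (p - q)))%R by rewrite /c -powRrM mulrC.
have cqi j : (c j `^ q * fine (cell_mass m j) = i j `^ (p / (p - q)))%R.
  transitivity (i j `^ ((p - q)^-1 * q) * i j `^ 1)%R; first by rewrite /c -powRrM (powRr1 (i0 j)).
  rewrite -powRD.
    by congr (_ `^ _)%R; field.
  apply/implyP => h; exfalso; move: h; rewrite (_ : _ + _ = p / (p - q))%R; last by field.
  by rewrite mulf_eq0 invr_eq0 (negbTE pn0) (negbTE pqn0).
rewrite (eq_bigr _ (fun j _ => cqi j)) [in leRHS](eq_bigr _ (fun j _ => cp j)).
rewrite -/i; set T := (\sum_j _)%R => TT.
have T0 : (0 <= T)%R by apply: sumr_ge0 => j _; exact: powR_ge0.
have B0 : (0 <= cB g * N)%R.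
  have A0 : (0 <= cA :> R)%R by exact: ltW (@cA_gt0 R).
  by apply: mulr_ge0 => //; rewrite /cB; apply: mulr_ge0; [exact: mulr_ge0|exact: powR_ge0].
have [->|Tn0] := eqVneq T 0%R; first exact: powR_ge0.
have Tp : (0 < T)%R by rewrite lt0r Tn0.
have h : (T `^ ((p - q) / p) <= cB g * N)%R.
  rewrite -(ler_pM2r (powR_gt0 (q / p) Tp)) -powRD.
    rewrite (_ : _ + _ = 1)%R; last by field.
    by rewrite powRr1.
  by rewrite Tn0 implybT.
have -> : (T = (T `^ ((p - q) / p)) `^ (p / (p - q)))%R.
  rewrite -powRrM (_ : _ * _ = 1)%R ?powRr1//; field.
  by rewrite pn0 pqn0.
by apply: powR_mono => //; [rewrite divr_ge0// ltW|exact: powR_ge0].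
Qed.

End sign_test.

Section local_comparison.
Context {R : realType}.
Implicit Types (psi : R[i] -> R[i]) (a b : R[i]).

Definition padd (z u : plane R) : plane R := (z.1 + u.1, z.2 + u.2).

Lemma padd_affine z u : padd z u = of_C (1 * to_C u + to_C z).
Proof.
rewrite mul1r; case: z => s t; case: u => x y; rewrite /padd /of_C /=.
by congr (_, _); exact: addrC.
Qed.

Lemma of_CD (x y : R[i]) : of_C (x + y) = padd (of_C x) (of_C y).
Proof. by case: x; case: y. Qed.

Lemma to_CD z u : to_C (padd z u) = to_C z + to_C u.
Proof. by case: z; case: u. Qed.

Lemma measurable_padd z : measurable_fun setT (padd z).
Proof.
rewrite (_ : padd z = (fun u => of_C (1 * to_C u + to_C z))); first exact: measurable_affine.
by apply/funext => u; rewrite padd_affine.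
Qed.

(** The exponent |a (z + u) + b|^2 - |z + u|^2 is a constant, plus the real part of a
    linear function of u, plus (|a|^2 - 1) |u|^2. The linear part goes into a
    holomorphic factor, so m is near z comparable to the modulus of this function. *)
Definition local_fun psi a b (z : plane R) : R[i] -> R[i] := fun u =>
  psi (1 * u + to_C z) * cexp ((((a * to_C z + b)^*%C * a) - (to_C z)^*%C) * u + 0).

Lemma entire_local psi a b z : entire psi -> entire (local_fun psi a b z).
Proof.
move=> ep; exact: (entireM (@entire_affine _ psi 1 (to_C z) ep)
   (@entire_affine _ (@cexp R) _ 0 (@entire_cexp R))).
Qed.

Definition local_cst a b (z : plane R) : R :=
  expR ((normc (a * to_C z + b) ^+ 2 - normc (to_C z) ^+ 2) / 2).

Lemma mw_local psi a b z u : mw psi a b (padd z u) =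
  local_cst a b z * fnorm (local_fun psi a b z) u *
  expR (((normc a ^+ 2 - 1) * normc (to_C u) ^+ 2) / 2).
Proof.
rewrite /mw /m_fun padd_affine of_CK /fnorm /local_fun normcM normc_cexp /local_cst.
move: (normc (psi _)) => P.
rewrite [RHS](_ : _ = P * (expR ((normc (a * to_C z + b) ^+ 2 - normc (to_C z) ^+ 2) / 2) *
   expR (complex.Re (((a * to_C z + b)^*%C * a - (to_C z)^*%C) * to_C u + 0)) *
   expR ((normc a ^+ 2 - 1) * normc (to_C u) ^+ 2 / 2))); last by ring.
congr (_ * _); rewrite -!expRD; congr expR; rewrite !normcE.
by case: a => a1 a2; case: b => b1 b2; case: z => z1 z2; case: u => u1 u2 /=; field.
Qed.

Lemma mw_local0 psi a b z : mw psi a b z = local_cst a b z * fnorm (local_fun psi a b z) (0, 0).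
Proof.
have := mw_local psi a b z (0, 0).
have -> : padd z (0, 0) = z by case: (z) => x y; rewrite /padd /= !addr0.
by move=> ->; rewrite (_ : to_C (0, 0) = 0)// normc0 expr0n mulr0 mul0r expR0 mulr1.
Qed.

(** The quadratic part of the exponent is at least -1, as |u|^2 <= 2. *)
Lemma mw_local_ge psi a b z u : normc a <= 1 -> sq 1 u ->
  local_cst a b z * fnorm (local_fun psi a b z) u <= expR 1 * mw psi a b (padd z u).
Proof.
move=> a1 su; rewrite mw_local mulrCA -[leLHS]mulr1 ler_wpM2l//.
  by rewrite mulr_ge0 ?expR_ge0 ?fnorm_ge0.
rewrite -expRD -[leLHS]expR0 ler_expR.
have : normc (to_C u) ^+ 2 <= 2.
  move: su => /sqP[u1 u2]; rewrite normcE /=.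
  rewrite -(real_normK (num_real u.1)) -(real_normK (num_real u.2)).
  have := @exprn_ile1 _ 2 _ (normr_ge0 u.1) u1.
  by have := @exprn_ile1 _ 2 _ (normr_ge0 u.2) u2 => ? ?; lra.
have := sqr_ge0 (normc (to_C u)).
have : 0 <= normc a ^+ 2 by exact: sqr_ge0.
have : normc a ^+ 2 <= 1 by apply: exprn_ile1 => //; exact: normc_ge0.
move: (normc a ^+ 2) (normc (to_C u) ^+ 2) => s t h1 h2 h3 h4.
have : 0 <= (s - 0) * t by rewrite mulr_ge0// subr0.
by move=> ?; lra.
Qed.

Local Open Scope ereal_scope.

Lemma mw_submean (q : R) : (0 < q)%R -> exists2 C : R, (0 < C)%R & forall psi a b z,
  entire psi -> (normc a <= 1)%R ->
  (mw psi a b z `^ q)%:E <= C%:E * \int[@dA R]_(u in sq 1) (mw psi a b (padd z u) `^ q)%:E.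
Proof.
move=> q0; have [C C0 CP] := @submean R q q0.
exists (C * expR 1 `^ q)%R; first by rewrite mulr_gt0// powR_gt0// expR_gt0.
move=> psi a b z ep a1; set K := local_cst a b z.
have K0 : (0 <= K)%R by exact: expR_ge0.
have el := @entire_local psi a b z ep.
have mm : measurable_fun setT (fun u => (mw psi a b (padd z u) `^ q)%:E).
  exact: (measurable_pow q (measurableT_comp (measurable_mw a b ep) (measurable_padd z))).
rewrite mw_local0 powRM ?fnorm_ge0// EFinM.
apply: le_trans (lee_wpmul2l _ (CP _ el)) _; first by rewrite lee_fin powR_ge0.
rewrite muleCA EFinM -muleA; apply: lee_wpmul2l; first by rewrite lee_fin ltW.
rewrite -(ge0_integralZl _ (measurable_sq 1)); first last.
- by rewrite lee_fin powR_ge0.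
- by move=> w _; rewrite lee_fin powR_ge0.
- by apply: measurable_funTS; exact: measurable_powR_fnorm.
rewrite -(ge0_integralZl _ (measurable_sq 1)); first last.
- by rewrite lee_fin powR_ge0.
- by move=> w _; rewrite lee_fin powR_ge0.
- exact: measurable_funTS.
apply: ge0_le_integral; first exact: measurable_sq.
- by move=> u _; rewrite -EFinM lee_fin mulr_ge0 ?powR_ge0.
- by apply: measurable_funTS; apply: emeasurable_funM => //; exact: measurable_powR_fnorm.
- by apply: measurable_funTS; exact: emeasurable_funM.
- move=> u su; rewrite -!EFinM lee_fin -(powRM q K0 (fnorm_ge0 _ _)).
  rewrite -(powRM q (expR_ge0 1) (mw_ge0 _ _ _ _)).
  apply: powR_mono; [exact: ltW|by rewrite mulr_ge0 ?fnorm_ge0|].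
  exact: mw_local_ge.
Qed.

Lemma lgauss_ge n (m s : R) (j : 'I_n * 'I_n) (w : plane R) :
  (((w.1 - (latt m j).1) ^+ 2 + (w.2 - (latt m j).2) ^+ 2) <= 4 * s)%R ->
  (expR (- s) <= lgauss m j w)%R.
Proof. by move=> h; rewrite /lgauss /gauss2 ler_expR lerN2; lra. Qed.

Lemma integral_padd z (g : plane R -> \bar R) : measurable_fun setT g -> (forall w, 0 <= g w) ->
  \int[@dA R]_u g (padd z u) = \int[@dA R]_w g w.
Proof.
move=> mg g0; have := integral_affine (to_C z) (oner_neq0 _) mg g0.
rewrite normc1 expr1n invr1 mul1e => <-.
by apply: eq_integral => u _; rewrite padd_affine.
Qed.

(** If phi(z) is within distance 1 of the lattice point of index [j] in both
    coordinates, then phi(z + u) is still near it for u in the unit square, because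
    |a| <= 1. So the Gaussian of [cell_mass] is bounded below on the square where
    [mw_submean] takes the mean. *)
Lemma mw_le_cell (q : R) : (0 < q)%R -> exists2 C : R, (0 < C)%R & forall psi a b n m (j : 'I_n * 'I_n) z,
  entire psi -> (normc a <= 1)%R ->
  (`|(aff a b z).1 - (latt m j).1| <= 1)%R -> (`|(aff a b z).2 - (latt m j).2| <= 1)%R ->
  (mw psi a b z `^ q)%:E <= C%:E * cell_mass q psi a b m j.
Proof.
move=> q0; have [C C0 CP] := mw_submean q0.
pose k := ((expR (- (3 : R)) ^+ 2) `^ q * expR (- (3 : R)))%R.
have k0 : (0 < k)%R by rewrite mulr_gt0 ?powR_gt0 ?exprn_gt0 ?expR_gt0.
exists (C / k)%R; first by rewrite divr_gt0.
move=> psi a b n m j z ep a1 z1 z2; apply: (le_trans (CP psi a b z ep a1)).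
rewrite EFinM -muleA; apply: lee_wpmul2l; first by rewrite lee_fin ltW.
pose g (w : plane R) := (mw psi a b w `^ q * lweight m q j (aff a b w))%:E.
have mg : measurable_fun setT g by exact: measurable_cell.
have g0 w : 0 <= g w by rewrite lee_fin mulr_ge0 ?powR_ge0 ?lweight_ge0.
rewrite /cell_mass -/g -(integral_padd z mg g0).
have mgp : measurable_fun setT (fun u => g (padd z u)).
  exact: (measurableT_comp mg (measurable_padd z)).
rewrite -(ge0_integralZl _ measurableT mgp); first last.
- by rewrite lee_fin invr_ge0 ltW.
- by move=> u _; exact: g0.
rewrite [leLHS]integral_mkcond; apply: ge0_le_integral => //.
- by move=> u _; apply: erestrict_ge0 => ? _; rewrite lee_fin powR_ge0.
- apply/(measurable_restrictT _ (measurable_sq 1))/measurable_funTS.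
  exact: (measurable_pow q (measurableT_comp (measurable_mw a b ep) (measurable_padd z))).
- exact: emeasurable_funM.
move=> u _; rewrite patchE; case: ifPn => [/set_mem su|_]; last first.
  by rewrite mule_ge0// lee_fin invr_ge0 ltW.
rewrite /g -EFinM lee_fin ler_pdivlMl// mulrC ler_wpM2l ?powR_ge0//.
have h : (expR (- 3) <= lgauss m j (aff a b (padd z u)))%R.
  have n2 : (normc (a * to_C u) ^+ 2 <= 2)%R.
    rewrite normcM exprMn.
    apply: le_trans (_ : 1 * normc (to_C u) ^+ 2 <= _)%R.
      by rewrite ler_wpM2r ?sqr_ge0// exprn_ile1 ?normc_ge0.
    move: su => /sqP[u1 u2].
    rewrite mul1r normcE /= -(real_normK (num_real u.1)) -(real_normK (num_real u.2)).
    have := @exprn_ile1 _ 2 _ (normr_ge0 u.1) u1.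
    by have := @exprn_ile1 _ 2 _ (normr_ge0 u.2) u2 => ? ?; lra.
  have E : aff a b (padd z u) = padd (aff a b z) (of_C (a * to_C u)%R).
    by rewrite /aff -of_CD to_CD mulrDr addrAC.
  apply: lgauss_ge; rewrite E; move: n2; rewrite normcE; move: (a * to_C u)%R => [v1 v2] /= n2.
  have := @exprn_ile1 _ 2 _ (normr_ge0 _) z1; have := @exprn_ile1 _ 2 _ (normr_ge0 _) z2.
  rewrite !real_normK ?num_real//.
  set x := ((aff a b z).1 - _)%R; set y := ((aff a b z).2 - _)%R => h1 h2.
  have e1 : ((aff a b z).1 + v1 - (latt m j).1 = x + v1)%R by rewrite /x; ring.
  have e2 : ((aff a b z).2 + v2 - (latt m j).2 = y + v2)%R by rewrite /y; ring.
  rewrite e1 e2.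
  have := sqr_ge0 (x - v1)%R; have := sqr_ge0 (y - v2)%R.
  rewrite (_ : (x + v1) ^+ 2 = 2 * x ^+ 2 + 2 * v1 ^+ 2 - (x - v1) ^+ 2)%R; last by ring.
  rewrite (_ : (y + v2) ^+ 2 = 2 * y ^+ 2 + 2 * v2 ^+ 2 - (y - v2) ^+ 2)%R; last by ring.
  move: (x ^+ 2)%R (y ^+ 2)%R (v1 ^+ 2)%R (v2 ^+ 2)%R ((x - v1) ^+ 2)%R ((y - v2) ^+ 2)%R h1 h2 n2.
  by move=> ? ? ? ? ? ? ? ? ? ? ?; lra.
rewrite /k /lweight; apply: (ler_pM (powR_ge0 _ _) (expR_ge0 _) _ h).
apply: powR_mono; [exact: ltW|exact: sqr_ge0|].
by rewrite lerXn2r ?nnegrE ?expR_ge0 ?gauss2_ge0.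
Qed.
End local_comparison.

Section lattice_bound.
Context {R : realType}.
Local Open Scope ereal_scope.

Lemma truncn_cell (n : nat) (x : R) : (`|x| <= n%:R)%R ->
  exists i : 'I_(n + n).+1, (`|x - (i%:R - n%:R)| <= 1)%R.
Proof.
rewrite ler_norml => /andP[x1 x2]; have y0 : (0 <= x + n%:R)%R by lra.
have := truncn_itv y0; set k := Num.truncn _ => /andP[k1 k2].
have kn : (k < (n + n).+1)%N.
  by rewrite ltnS -(ler_nat R) natrD; lra.
exists (Ordinal kn) => /=; rewrite -natr1 in k2.
by rewrite ler_norml; apply/andP; split; lra.
Qed.

(** By [mw_le_cell], m^r = (m^q)^(p/(p-q)) is at most a multiple of I_j^(p/(p-q)) on
    the part of the plane that [phi] sends to the cell of index [j]; [cell_mass_sum]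
    bounds the sum of these numbers. The squares of the lattice exhaust the plane. *)
Lemma Lr_lower (p q : R) : (0 < q)%R -> (q < p)%R -> exists2 C : R, (0 < C)%R &
  forall (psi : R[i] -> R[i]) (a b : R[i]) (N : R), entire psi -> a != 0%R -> (normc a <= 1)%R ->
  (0 <= N)%R -> bounded_pow p q psi a b N ->
  ipow (p * q / (p - q)) (mw psi a b) <= (C * normc a ^- 2 * N `^ (p / (p - q)))%:E.
Proof.
move=> q0 qp; have p0 : (0 < p)%R by exact: lt_trans qp.
have pq0 : (0 < p - q)%R by rewrite subr_gt0.
have [C C0 CP] := @mw_le_cell R q q0.
have [g g0 gP] := @gauss_integral2 R p p0.
pose s := (p / (p - q))%R; have s0 : (0 < s)%R by rewrite divr_gt0.
pose K := (C `^ s * expR (p / 2) * g)%R.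
have K0 : (0 < K)%R by rewrite !mulr_gt0 ?powR_gt0 ?expR_gt0.
have B0 : (0 < cB p q g)%R.
  have A0 := @cA_gt0 R; rewrite /cB; apply: mulr_gt0; first exact: mulr_gt0.
  by apply: powR_gt0; apply: mulr_gt0 => //; exact: powR_gt0.
exists (K * cB p q g `^ s)%R; first by rewrite mulr_gt0 ?powR_gt0.
move=> psi a b N ep a0 a1 N0 BN; rewrite -/s.
have na0 : (0 < normc a)%R by rewrite normc_gt0.
set r := (p * q / (p - q))%R.
have rqs : (q * s = r)%R by rewrite /r /s; ring.
pose D (n : nat) : set (plane R) := aff a b @^-1` (sq n%:R).
have mD n : measurable (D n).
  by rewrite /D -[X in measurable X]setTI; apply: measurable_affine => //; exact: measurable_sq.
have mm : measurable_fun setT (fun w => (mw psi a b w `^ r)%:E).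
  exact: (measurable_pow r (measurable_mw a b ep)).
have main n : \int[@dA R]_(w in D n) (mw psi a b w `^ r)%:E <=
    (K * cB p q g `^ s * normc a ^- 2 * N `^ s)%:E.
  (* up to a constant, a Gaussian majorizes the indicator of each cell, so that the
   area of its preimage is given by [integral_affine] *)
  pose m : R := n%:R; pose J : finType := ('I_(n + n).+1 * 'I_(n + n).+1)%type.
  pose i (j : J) := fine (cell_mass q psi a b m j).
  have iP (j : J) : cell_mass q psi a b m j = (i j)%:E.
    exact: (cell_mass_fin q0 qp ep m j BN N0 g0 gP).
  have i0 (j : J) : (0 <= i j)%R by rewrite /i fine_ge0// cell_mass_ge0.
  pose G (j : J) (w : plane R) : \bar R := (lgauss m j (aff a b w) `^ p)%:E.
  have mG j : measurable_fun setT (G j).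
    apply: (@measurable_pow _ p (fun w => lgauss m j (aff a b w))).
    exact: (measurableT_comp (measurable_gauss2 _ _) (measurable_affine a b)).
  have G0 j w : 0 <= G j w by rewrite lee_fin powR_ge0.
  have IG j : \int[@dA R]_w G j w = (normc a ^- 2 * g)%:E.
    rewrite (integral_affine b a0 (g := fun w => (lgauss m j w `^ p)%:E)).
    - by rewrite EFinM -(gP (latt m j).1 (latt m j).2).
    - exact: (measurable_pow p (measurable_gauss2 _ _)).
    - by move=> w; rewrite lee_fin powR_ge0.
  pose k (j : J) : R := ((C * i j) `^ s * expR (p / 2))%R.
  have k0 j : 0 <= (k j)%:E by rewrite lee_fin mulr_ge0 ?powR_ge0 ?expR_ge0.
  apply: (@le_trans _ _ (\int[@dA R]_w (\sum_(j : J) (k j)%:E * G j w))).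
    rewrite [leLHS]integral_mkcond; apply: ge0_le_integral => //.
    - by move=> w _; apply: erestrict_ge0 => ? _; rewrite lee_fin powR_ge0.
    - by apply/(measurable_restrictT _ (mD n))/measurable_funTS.
    - by apply: emeasurable_sum => j; apply: emeasurable_funM.
    move=> w _; rewrite patchE; case: ifPn => [/set_mem Dw|_]; last first.
      by apply: sume_ge0 => j _; rewrite mule_ge0.
    have [/truncn_cell[j1 h1] /truncn_cell[j2 h2]] := (sqP _ _).1 Dw.
    pose j : J := (j1, j2).
    apply: (@le_trans _ _ ((k j)%:E * G j w)); last first.
      by rewrite (bigD1 j)//= leeDl// sume_ge0// => ? _; rewrite mule_ge0.
    rewrite /G -EFinM lee_fin -rqs powRrM /k -mulrA -[leLHS]mulr1.
    apply: ler_pM => //; first exact: powR_ge0.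
      apply: powR_mono; [exact: ltW|exact: powR_ge0|].
      by rewrite -lee_fin EFinM -iP; apply: CP.
    have h : (expR (- (1 / 2)) <= lgauss m j (aff a b w))%R.
      apply: lgauss_ge; rewrite -!(real_normK (num_real (_ - _))).
      have := @exprn_ile1 _ 2 _ (normr_ge0 _) h1; have := @exprn_ile1 _ 2 _ (normr_ge0 _) h2.
      by rewrite /latt /= => ? ?; lra.
    apply: le_trans (_ : expR (p / 2) * expR (- (1 / 2)) `^ p <= _)%R.
      by rewrite -expRM -expRD -[leLHS]expR0 ler_expR; apply: eqW; field.
    by rewrite ler_wpM2l ?expR_ge0// powR_mono ?expR_ge0// ltW.
  rewrite ge0_integral_sum//; first last.
  - by move=> j w _; rewrite mule_ge0.
  - by move=> j; apply: emeasurable_funM.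
  rewrite (eq_bigr (fun j => (k j * (normc a ^- 2 * g))%:E)); last first.
    by move=> j _; rewrite ge0_integralZl// IG.
  rewrite sumEFin lee_fin -mulr_suml.
  have -> : (\sum_j k j = C `^ s * expR (p / 2) * \sum_(j : J) i j `^ s)%R.
    rewrite mulr_sumr; apply: eq_bigr => j _.
    by rewrite /k powRM// ?(ltW C0)//; ring.
  have := cell_mass_sum q0 qp ep (n + n).+1 m BN N0 g0 gP.
  rewrite -/s -/(i _) powRM ?(ltW B0)// => h.
  have h2 : (0 <= K * normc a ^- 2)%R by rewrite mulr_ge0 ?(ltW K0)// invr_ge0 exprn_ge0// ltW.
  have := ler_wpM2l h2 h; rewrite /K.
  rewrite (_ : C `^ s * expR (p / 2) * g * normc a ^- 2 * (\sum_j fine (cell_mass q psi a b m j) `^ s) =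
    C `^ s * expR (p / 2) * (\sum_(j : J) i j `^ s) * (normc a ^- 2 * g))%R; last by ring.
  move/le_trans; apply; apply: eqW; ring.
have ndD : nondecreasing_seq D.
  move=> x y xy; apply/subsetPset => w; rewrite /D /= => /sqP[w1 w2].
  by apply/sqP; split; rewrite (le_trans w1, le_trans w2)// ler_nat.
have UD : \bigcup_n D n = setT.
  apply/seteqP; split => // w _; pose k := (Num.truncn (`|(aff a b w).1| + `|(aff a b w).2|)%R).+1.
  exists k => //; apply/sqP.
  have : (`|(aff a b w).1| + `|(aff a b w).2| < k%:R)%R by exact: truncnS_gt.
  have := normr_ge0 (aff a b w).1; have := normr_ge0 (aff a b w).2 => ? ? ?; split; lra.
have cvg := @ge0_nondecreasing_set_cvg_integral _ _ _ D (fun w => (mw psi a b w `^ r)%:E) (@dA R)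
  ndD mD (fun n => measurable_funTS mm) (fun n x _ => (powR_ge0 _ _ : 0 <= (_ : R)%:E)).
rewrite UD in cvg; rewrite /ipow -(cvg_lim _ cvg)//.
by apply: lime_le; [apply: cvgP cvg|apply: nearW].
Qed.
End lattice_bound.

(** * The metric of the Fock spaces *)

Section fock_metric.
Context {R : realType}.
Implicit Types (f g h : R[i] -> R[i]) (p q : R).

Local Open Scope ereal_scope.

Lemma mw00 f w : mw f 0%R 0%R w = kf f w.
Proof.
by rewrite /mw /m_fun /kf mul0r addr0 normc0 expr0n sub0r mulNr.
Qed.

(** For psi = f and phi = 0, the function m is the weighted modulus of f. *)
Lemma kf_pointwise q : (0 < q)%R -> exists2 C : R, (0 < C)%R & forall f z, entire f ->
  (kf f z `^ q)%:E <= C%:E * ipow q (kf f).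
Proof.
move=> q0; have [C C0 CP] := @mw_submean R q q0; exists C => // f z ef.
have a1 : (normc (0 : R[i]) <= 1)%R by rewrite normc0.
have := CP f 0%R 0%R z ef a1; rewrite mw00 => /le_trans; apply.
apply: lee_wpmul2l; first by rewrite lee_fin ltW.
have mp := measurable_pow q (measurable_kf ef).
have p0 w : 0 <= (kf f w `^ q)%:E by rewrite lee_fin powR_ge0.
rewrite /ipow -(integral_padd z mp p0).
apply: le_trans (_ : \int[@dA R]_(u in sq 1) (kf f (padd z u) `^ q)%:E <= _).
  by apply: eqW; apply: eq_integral => u _; rewrite mw00.
have mpp := measurableT_comp mp (measurable_padd z).
apply: (ge0_subset_integral _ (measurable_sq 1) measurableT mpp); last exact: subsetT.
by move=> u _; exact: p0.
Qed.

Lemma kf_eq0 f z : kf f (of_C z) = 0%R -> f z = 0%R.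
Proof.
rewrite /kf of_CK => /eqP; rewrite mulf_eq0 => /orP[/eqP/eq0_normc//|].
by rewrite gt_eqF// expR_gt0.
Qed.

Lemma kf_subC f g w : kf (fun z => f z - g z)%R w = kf (fun z => g z - f z)%R w.
Proof. by rewrite /kf normc_subC. Qed.

Lemma kf_sub_triangle f g h w :
  (kf (fun z => f z - h z) w <= kf (fun z => f z - g z) w + kf (fun z => g z - h z) w)%R.
Proof.
rewrite /kf -mulrDl ler_wpM2r ?expR_ge0//.
rewrite (_ : f _ - h _ = (f (to_C w) - g (to_C w)) + (g (to_C w) - h (to_C w)))%R; last by rewrite addrA subrK.
exact: le_normcD.
Qed.

Lemma powR_subadd p (x y : R) : (0 < p)%R -> (p <= 1)%R -> (0 <= x)%R -> (0 <= y)%R ->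
  ((x + y) `^ p <= x `^ p + y `^ p)%R.
Proof.
move=> p0 p1 x0 y0; have [s0|s0] := eqVneq (x + y)%R 0%R.
  by rewrite s0 powR0 ?gt_eqF// addr_ge0 ?powR_ge0.
have sp : (0 < x + y)%R by rewrite lt0r s0 addr_ge0.
have key t : (0 <= t)%R -> (t <= x + y)%R -> (t / (x + y) * (x + y) `^ p <= t `^ p)%R.
  rewrite le_eqVlt => /predU1P[<-|t0] ts; first by rewrite !mul0r powR_ge0.
  have -> : (t `^ p = (t / (x + y)) `^ p * (x + y) `^ p)%R.
    by rewrite -powRM ?divfK// ?divr_ge0 ?(ltW t0) ?(ltW sp).
  rewrite ler_wpM2r ?powR_ge0// ger1_powR// divr_gt0//=.
  by rewrite ler_pdivrMr// mul1r.
apply: le_trans (lerD (key x x0 _) (key y y0 _)); rewrite ?lerDl ?lerDr//.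
by rewrite -mulrDl -mulrDl divff// mul1r.
Qed.

Lemma ipow_add_le p (u v : plane R -> R) : (0 < p)%R -> (p <= 1)%R ->
  measurable_fun setT u -> measurable_fun setT v -> (forall w, 0 <= u w)%R -> (forall w, 0 <= v w)%R ->
  ipow p (fun w => u w + v w)%R <= ipow p u + ipow p v.
Proof.
move=> p0 p1 mu mv u0 v0; rewrite /ipow -ge0_integralD//; first last.
- exact: measurable_pow.
- by move=> w _; rewrite lee_fin powR_ge0.
- exact: measurable_pow.
- by move=> w _; rewrite lee_fin powR_ge0.
apply: ge0_le_integral => //.
- by move=> w _; rewrite lee_fin powR_ge0.
- by apply: measurable_pow; exact: measurable_funD.
- by apply: emeasurable_funD; exact: measurable_pow.
- by move=> w _; rewrite -EFinD lee_fin powR_subadd.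
Qed.

Lemma ipow_norm_add_le p (u v : plane R -> R) : (1 <= p)%R ->
  measurable_fun setT u -> measurable_fun setT v -> (forall w, 0 <= u w)%R -> (forall w, 0 <= v w)%R ->
  ipow p (fun w => u w + v w)%R `^ p^-1 <= ipow p u `^ p^-1 + ipow p v `^ p^-1.
Proof.
move=> p1 mu mv u0 v0; have := minkowski_EFin (@dA R) mu mv p1.
rewrite (Lnorm_ipow p u0) (Lnorm_ipow p v0).
by rewrite [X in X <= _](@Lnorm_ipow R p (fun w => u w + v w)%R)// => w; rewrite addr_ge0.
Qed.

Lemma measurable_kfB f g : entire f -> entire g ->
  measurable_fun setT (kf (fun z => f z - g z)%R).
Proof. by move=> ef eg; exact: (measurable_kf (@entireB _ f g ef eg)). Qed.

#[local] Opaque fock_norm.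

Lemma fock_distE p f g : (0 < p)%R -> fock_dist p f g =
  let x := (p / (2 * pi))%:E * ipow p (kf (fun z => f z - g z)%R) in
  if (1 <= p)%R then x `^ p^-1 else x.
Proof.
move=> p0; have e1 := fock_normE p (fun z => f z - g z)%R.
have e2 := fock_norm_pow (fun z => f z - g z)%R p0.
by rewrite /fock_dist /=; have [_|_] := leP 1%R p; [exact: e1|exact: e2].
Qed.

(** The inequality of Minkowski if p >= 1, and the subadditivity of t^p if p <= 1. *)
Lemma fock_dist_triangle p f g h : (0 < p)%R -> entire f -> entire g -> entire h ->
  fock_dist p f h <= fock_dist p f g + fock_dist p g h.
Proof.
move=> p0 ef eg eh; have k0 : 0 <= (p / (2 * pi))%:E by rewrite lee_fin ltW// kappa_gt0.
have mfg := measurable_kfB ef eg; have mgh := measurable_kfB eg eh.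
have le1 : ipow p (kf (fun z => f z - h z)%R) <=
    ipow p (fun w => kf (fun z => f z - g z) w + kf (fun z => g z - h z) w)%R.
  apply: le_ipow; [exact: ltW|exact: measurable_kfB|exact: measurable_funD| |].
    by move=> w; exact: kf_ge0.
  by move=> w; exact: kf_sub_triangle.
clear ef eg eh.
rewrite (fock_distE f h p0) (fock_distE f g p0) (fock_distE g h p0) /=.
have x0 := ipow_ge0 p (kf (fun z => f z - g z)%R).
have y0 := ipow_ge0 p (kf (fun z => g z - h z)%R).
have z0 := ipow_ge0 p (kf (fun z => f z - h z)%R).
have [p1|p1] := leP 1%R p.
  have pV : (0 <= p^-1)%R by rewrite invr_ge0 ltW.
  have := le_trans (poweR_mono pV z0 le1)
    (ipow_norm_add_le p1 mfg mgh (fun=> kf_ge0 _ _) (fun=> kf_ge0 _ _)).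
  move: (ipow p _) (ipow p _) (ipow p _) x0 y0 z0 {le1} => z x y x0 y0 z0 h1.
  rewrite (poweRM _ k0 x0) (poweRM _ k0 y0) (poweRM _ k0 z0).
  rewrite -(ge0_muleDr _ (poweR_ge0 _ _) (poweR_ge0 _ _)).
  apply: lee_wpmul2l; [exact: poweR_ge0|exact: h1].
have := le_trans le1 (ipow_add_le p0 (ltW p1) mfg mgh (fun=> kf_ge0 _ _) (fun=> kf_ge0 _ _)).
move: (ipow p _) (ipow p _) (ipow p _) x0 y0 z0 {le1} => z x y x0 y0 z0 h1.
rewrite -(ge0_muleDr _ x0 y0). apply: lee_wpmul2l; [exact: k0|exact: h1].
Qed.

Lemma fock_distC p f g : fock_dist p f g = fock_dist p g f.
Proof.
have E : fock_norm p (fun z => f z - g z)%R = fock_norm p (fun z => g z - f z)%R.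
  by rewrite !fock_normE (_ : kf _ = kf (fun z => g z - f z)%R)//; apply/funext => w; rewrite kf_subC.
by rewrite /fock_dist E.
Qed.

Lemma fock_dist_lt p (e : R) : (0 < p)%R -> (0 < e)%R -> exists2 d : R, (0 < d)%R & forall f g,
  ipow p (kf (fun z => f z - g z)%R) <= d%:E -> fock_dist p f g < e%:E.
Proof.
move=> p0 e0; have kap := kappa_gt0 p0; rewrite /fock_dist.
have e20 : (0 < e / 2)%R by rewrite divr_gt0.
have e2 : (e / 2 < e)%R by lra.
have [p1|p1] := leP 1%R p.
  exists ((p / (2 * pi))^-1 * (e / 2) `^ p)%R; first by rewrite mulr_gt0 ?invr_gt0 ?powR_gt0.
  move=> f g h; apply: (@le_lt_trans _ _ (e / 2)%:E); last by rewrite lte_fin.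
  have -> : (e / 2)%:E = (((e / 2) `^ p)%:E) `^ p^-1.
    by rewrite poweR_EFin -powRrM divff ?gt_eqF// powRr1// ltW.
  rewrite fock_normE; apply: poweR_mono; first by rewrite invr_ge0 ltW.
    by rewrite mule_ge0 ?ipow_ge0// lee_fin ltW.
  apply: le_trans (lee_wpmul2l _ h) _; first by rewrite lee_fin ltW.
  by rewrite -EFinM mulVKf// gt_eqF.
exists ((p / (2 * pi))^-1 * (e / 2))%R; first by rewrite mulr_gt0 ?invr_gt0.
move=> f g h; apply: (@le_lt_trans _ _ (e / 2)%:E); last by rewrite lte_fin.
rewrite fock_norm_pow//; apply: le_trans (lee_wpmul2l _ h) _; first by rewrite lee_fin ltW.
by rewrite -EFinM mulVKf// gt_eqF.
Qed.

Lemma fock_dist_ge0 p f g : 0 <= fock_dist p f g.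
Proof. by rewrite /fock_dist; have [_|_] := leP 1%R p; exact: poweR_ge0. Qed.

Lemma fock_dist_eq0 p f g : (0 < p)%R -> entire f -> entire g -> fock_dist p f g = 0 -> f = g.
Proof.
move=> p0 ef eg d0.
have n0 : fock_norm p (fun z => f z - g z)%R = 0.
  move: d0; rewrite /fock_dist; have [_|_] := leP 1%R p => //; apply: poweR_eq0_eq0; exact: fock_norm_ge0.
have i0 : ipow p (kf (fun z => f z - g z)%R) = 0.
  by rewrite ipow_fock// n0 poweR0r ?gt_eqF// mule0.
have [C C0 CP] := @kf_pointwise p p0.
apply/funext => z; apply/eqP; rewrite -subr_eq0; apply/eqP.
apply: (@kf_eq0 (fun z => f z - g z)%R).
have := CP _ (of_C z) (@entireB _ f g ef eg); rewrite i0 mule0 lee_fin => h.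
by apply: (@powR_eq0_eq0 _ _ p); apply/eqP; rewrite eq_le h powR_ge0.
Qed.

Lemma fock_ball_nbhs p (f : fockType p) (e : R) : (0 < p)%R -> (0 < e)%R ->
  nbhs f [set g : fockType p | fock_dist p f g < e%:E].
Proof.
move=> p0 e0; rewrite nbhsE; exists [set g : fockType p | fock_dist p f g < e%:E] => //.
split.
  move=> g /= fg; have fin : fock_dist p f g \is a fin_num.
    by rewrite ge0_fin_numE ?fock_dist_ge0// (lt_le_trans fg)// leey.
  exists (e - fine (fock_dist p f g))%R; first by rewrite subr_gt0 -lte_fin fineK.
  move=> h gh /=; apply: le_lt_trans (fock_dist_triangle p0 (fock_funP f).1 (fock_funP g).1 (fock_funP h).1) _.
  by rewrite -(fineK fin) -lteBrDl// -EFinB.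
rewrite /= (_ : fock_dist p f f = 0) ?lte_fin//.
have n0 : fock_norm p (fun z => f z - f z)%R = 0.
  rewrite fock_normE (_ : ipow _ _ = 0) ?mule0 ?poweR0r ?invr_neq0 ?gt_eqF//.
  rewrite /ipow (eq_integral (cst 0)) ?integral0// => w _.
  by rewrite /kf subrr normc0 mul0r powR0 ?gt_eqF.
by rewrite /fock_dist n0; have [_|_] := leP 1%R p => //; rewrite poweR0r ?gt_eqF.
Qed.

(** Separation is what makes compact sets closed, as precompactness asks. *)
Lemma fock_hausdorff p : (0 < p)%R -> hausdorff_space (fockType p).
Proof.
move=> p0 f g cl.
have fgE : fock_fun f = fock_fun g.
  apply: (fock_dist_eq0 p0 (fock_funP f).1 (fock_funP g).1).
  apply/eqP; rewrite eq_le fock_dist_ge0 andbT; apply/lee_addgt0Pr => e e0.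
  have e20 : (0 < e / 2)%R by rewrite divr_gt0.
  have [h [/= fh gh]] := cl _ _ (fock_ball_nbhs f p0 e20) (fock_ball_nbhs g p0 e20).
  apply: le_trans (fock_dist_triangle p0 (fock_funP f).1 (fock_funP h).1 (fock_funP g).1) _.
  have -> : 0 + e%:E = (e / 2)%:E + (e / 2)%:E by rewrite add0e -EFinD -splitr.
  by apply: (leeD (ltW fh)); rewrite fock_distC; exact: ltW.
case: f g fgE {cl} => f fP [g gP] /= E; subst g; congr FockType; exact: Prop_irrelevance.
Qed.
End fock_metric.

(** * Locally small functions have small images *)

Section tail_smallness.
Context {R : realType}.
Variables (p q : R) (psi : R[i] -> R[i]) (a b : R[i]).
Hypotheses (q0 : 0 < q) (qp : q < p).
Hypothesis epsi : entire psi.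
Hypothesis a0 : a != 0.
Let r := p * q / (p - q).
Let W := weighted_comp psi (fun z => a * z + b).

Local Open Scope ereal_scope.

Let D (n : nat) : set (plane R) := aff a b @^-1` (sq n%:R).
Let u (n : nat) (w : plane R) : R := (mw psi a b w * \1_(~` D n) w)%R.

Let measD n : measurable (D n).
Proof.
by rewrite /D -[X in measurable X]setTI; apply: measurable_affine => //; exact: measurable_sq.
Qed.

Let measu n : measurable_fun setT (u n).
Proof.
apply: measurable_funM; first exact: measurable_mw.
by apply: measurable_indic; exact: measurableC.
Qed.

Let u_ge0 n w : (0 <= u n w)%R.
Proof. by rewrite mulr_ge0// mw_ge0. Qed.

Lemma weight_tail : ipow r (mw psi a b) < +oo -> forall d : R, (0 < d)%R ->
  exists n, ipow r (u n) <= d%:E.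
Proof.
move=> fin d d0.
have r0 : (0 < r)%R by rewrite divr_gt0 ?subr_gt0// mulr_gt0// (lt_trans q0).
pose h w : \bar R := (mw psi a b w `^ r)%:E.
have h0 w : 0 <= h w by rewrite lee_fin powR_ge0.
have mh : measurable_fun setT h by exact: (measurable_pow r (measurable_mw a b epsi)).
have ndD : nondecreasing_seq D.
  move=> x y xy; apply/subsetPset => w; rewrite /D /= => /sqP[w1 w2].
  by apply/sqP; split; rewrite (le_trans w1, le_trans w2)// ler_nat.
have UD : \bigcup_n D n = setT.
  apply/seteqP; split => // w _; pose k := (Num.truncn (`|(aff a b w).1| + `|(aff a b w).2|)%R).+1.
  exists k => //; apply/sqP.
  have : (`|(aff a b w).1| + `|(aff a b w).2| < k%:R)%R by exact: truncnS_gt.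
  have := normr_ge0 (aff a b w).1; have := normr_ge0 (aff a b w).2 => ? ? ?; split; lra.
have cvg := @ge0_nondecreasing_set_cvg_integral _ _ _ D h (@dA R)
  ndD measD (fun n => measurable_funTS mh) (fun n x _ => h0 x).
rewrite UD in cvg.
have finh : \int[@dA R]_w h w \is a fin_num by rewrite ge0_fin_numE// integral_ge0.
have lt1 : \int[@dA R]_w h w - d%:E < \int[@dA R]_w h w.
  by rewrite lteBlDr// lteDl// lte_fin.
have [n hn] : exists n, \int[@dA R]_w h w - d%:E < \int[@dA R]_(w in D n) h w.
  apply: contrapT => no.
  suff : \int[@dA R]_w h w <= \int[@dA R]_w h w - d%:E by rewrite leNgt lt1.
  rewrite -[leLHS](cvg_lim _ cvg)//; apply: lime_le; first exact: cvgP cvg.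
  by apply: nearW => n; rewrite leNgt; apply/negP => hn; apply: no; exists n.
exists n; move: hn.
have E : \int[@dA R]_w h w = \int[@dA R]_(w in D n) h w + \int[@dA R]_(w in ~` D n) h w.
  rewrite -(setUv (D n)) ge0_integral_setU//.
  - exact: measurableC.
  - by rewrite setUv.
  - by rewrite disj_set2E setICr.
have -> : ipow r (u n) = \int[@dA R]_(w in ~` D n) h w.
  rewrite /ipow [RHS]integral_mkcond; apply: eq_integral => w _.
  rewrite patchE /u indicE; case: ifPn => _; first by rewrite mulr1.
  by rewrite mulr0 powR0// gt_eqF.
have F : \int[@dA R]_(w in D n) h w \is a fin_num.
  rewrite ge0_fin_numE ?integral_ge0//; apply: le_lt_trans fin.
  by rewrite /ipow [leRHS]E leeDl// integral_ge0.
rewrite E lteBlDr// => /ltW; rewrite leeD2lE//.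
Qed.

(** Where [phi] takes values in [sq n], |W f| <= eta |psi|, and psi is in F^q.
    Elsewhere the inequality of Hoelder gives a bound by the tail of m^r. *)
Lemma W_small : ipow q (kf psi) < +oo -> ipow r (mw psi a b) < +oo ->
  forall X e : R, (0 <= X)%R -> (0 < e)%R -> exists n, exists2 eta : R, (0 < eta)%R &
  forall f, entire f -> ipow p (kf f) <= X%:E ->
    (forall w, sq n%:R w -> (normc (f (to_C w)) <= eta)%R) ->
  ipow q (kf (W f)) <= e%:E.
Proof.
move=> finpsi finm X e X0 e0.
have p0 : (0 < p)%R by exact: lt_trans qp.
have pq0 : (0 < p - q)%R by rewrite subr_gt0.
have e20 : (0 < e / 2)%R by rewrite divr_gt0.
have na : (0 <= normc a ^- 2)%R by rewrite invr_ge0 exprn_ge0// normc_ge0.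
pose S := fine (ipow q (kf psi)).
have Sfin : ipow q (kf psi) \is a fin_num.
  by rewrite ge0_fin_numE; [exact: finpsi|exact: ipow_ge0].
have SE : ipow q (kf psi) = S%:E := esym (fineK Sfin).
have S0 : (0 <= S)%R := fine_ge0 (ipow_ge0 _ _).
pose K := ((normc a ^- 2 * X) `^ (q / p))%R.
have K0 : (0 <= K)%R by exact: powR_ge0.
pose s := ((p - q) / p)%R.
have s0 : (0 < s)%R by rewrite divr_gt0.
have [n hn] := weight_tail finm (powR_gt0 s^-1 (divr_gt0 e20 (ltr_pwDr ltr01 K0))).
exists n; exists ((e / 2 / (S + 1)) `^ q^-1)%R; first by rewrite powR_gt0 ?divr_gt0// ltr_wpDl.
set eta := powR _ _ => f ef fX fsmall.
have eta0 : (0 <= eta)%R by exact: powR_ge0.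
have maff := measurable_kf_aff a b ef.
have mW := measurable_kf (@entire_W R psi a b epsi f ef).
have mpsi := measurable_kf epsi.
have affE := ipow_aff b p ef a0.
have kW w : kf (W f) w = (mw psi a b w * kf f (aff a b w))%R by exact: kf_W.
clear ef.
apply: (@le_trans _ _ (ipow q (fun w => eta * kf psi w)%R +
   ipow q (fun w => u n w * kf f (aff a b w))%R)).
  have m1 : measurable_fun setT (fun w => ((eta * kf psi w) `^ q)%:E).
    exact: (measurable_pow q (measurable_funM (measurable_cst eta) mpsi)).
  have m2 : measurable_fun setT (fun w => ((u n w * kf f (aff a b w)) `^ q)%:E).
    exact: (measurable_pow q (measurable_funM (measu n) maff)).
  rewrite /ipow -(ge0_integralD _ measurableT _ m1 _ m2); first last.
  - by move=> w _; rewrite lee_fin powR_ge0.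
  - by move=> w _; rewrite lee_fin powR_ge0.
  apply: ge0_le_integral.
  - exact: measurableT.
  - by move=> w _; rewrite lee_fin powR_ge0.
  - exact: (measurable_pow q mW).
  - exact: (emeasurable_funD m1 m2).
  move=> w _; rewrite -EFinD lee_fin.
  have [Dw|Dw] := pselect (D n w).
    apply: (@le_trans _ _ ((eta * kf psi w) `^ q)%R); last by rewrite lerDl powR_ge0.
    apply: powR_mono; [exact: ltW|exact: kf_ge0|].
    rewrite /kf mulrA ler_wpM2r ?expR_ge0// /W /weighted_comp normcM mulrC.
    by rewrite ler_wpM2r ?normc_ge0//; have := fsmall _ Dw; rewrite /aff of_CK.
  apply: (@le_trans _ _ ((u n w * kf f (aff a b w)) `^ q)%R); last by rewrite lerDr powR_ge0.
  apply: powR_mono; [exact: ltW|exact: kf_ge0|].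
  by rewrite kW /u indicE mem_set// mulr1.
rewrite (splitr e) EFinD; apply: leeD.
  rewrite (ipowZ _ eta0 mpsi); last by move=> w; exact: kf_ge0.
  rewrite SE -EFinM lee_fin /eta -powRrM mulVf ?gt_eqF// powRr1; last first.
    by rewrite divr_ge0 ?(ltW e20)// addr_ge0.
  by rewrite mulrAC ler_pdivrMr ?ltr_wpDl// ler_wpM2l ?(ltW e20)// lerDl.
apply: le_trans (hoelder_ipow q0 qp (measu n) maff (u_ge0 n) (fun=> kf_ge0 _ _)) _.
rewrite affE.
apply: (@le_trans _ _ ((((e / 2 / (K + 1)) `^ s^-1)%:E) `^ s * K%:E)).
  apply: lee_pmul; rewrite ?poweR_ge0//.
    by apply: poweR_mono => //; [exact: ltW|exact: ipow_ge0].
  rewrite /K -poweR_EFin; apply: poweR_mono.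
  - by rewrite divr_ge0// ltW.
  - by rewrite mule_ge0 ?lee_fin// ipow_ge0.
  - by rewrite EFinM lee_wpmul2l ?lee_fin.
rewrite poweR_EFin -powRrM mulVf ?gt_eqF// powRr1; last first.
  by rewrite divr_ge0 ?(ltW e20)// addr_ge0.
rewrite -EFinM lee_fin.
by rewrite mulrAC ler_pdivrMr ?ltr_wpDl// ler_wpM2l ?(ltW e20)// lerDl.
Qed.
End tail_smallness.

(** * Limits along ultrafilters and Montel's theorem *)

Section ultrafilter_limits.
Context {R : realType} {T : Type} (U : set_system T) {UU : UltraFilter U}.
Implicit Types (x y z w : R[i]).

Let PU : ProperFilter U. Proof. exact: ultra_proper. Qed.

Definition ulim (s : T -> R[i]) (l : R[i]) :=
  forall e : R, 0 < e -> U [set t | normc (s t - l) <= e].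

Lemma ulim_real (u : T -> R) (M : R) : (forall t, `|u t| <= M) ->
  exists l, forall e, 0 < e -> U [set t | `|u t - l| <= e].
Proof.
move=> uM.
have FI : (u @ U) `[- M, M]%classic.
  apply: (@filterS _ U _ setT _ _ filterT) => t _.
  by rewrite /= in_itv /= -ler_norml.
have [l [_ cl]] := segment_compact (fmap_proper_filter u PU) FI.
exists l => e e0; have [//|nU] := in_ultra_setVsetC [set t | `|u t - l| <= e] UU.
have nF : (u @ U) [set v | e < `|v - l|].
  by apply: (filterS _ nU) => t /= h; rewrite /= ltNge; apply/negP; exact: h.
have [v [/= h1]] := cl _ _ nF (nbhsx_ballx l e e0).
by rewrite /ball /= distrC => h2; have := lt_trans h1 h2; rewrite ltxx.
Qed.

Lemma ulim_bounded (s : T -> R[i]) (M : R) : (forall t, normc (s t) <= M) ->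
  exists l, ulim s l.
Proof.
move=> sM.
have [x xP] := @ulim_real (fun t => complex.Re (s t)) M
  (fun t => le_trans (Re_le_normc _) (sM t)).
have [y yP] := @ulim_real (fun t => complex.Im (s t)) M
  (fun t => le_trans (Im_le_normc _) (sM t)).
exists (Complex x y) => e e0; have e20 : 0 < e / 2 by rewrite divr_gt0.
apply: (filterS _ (filterI (xP _ e20) (yP _ e20))) => t [/= h1 h2].
apply: le_trans (normc_le_ReIm _) _; move: h1 h2; case: (s t) => c d /= h1 h2; lra.
Qed.

Lemma ulim_normc_le (s : T -> R[i]) l (M : R) :
  ulim s l -> (forall t, normc (s t) <= M) -> normc l <= M.
Proof.
move=> sl sM; apply/ler_addgt0Pr => e e0.
have [t /= ht] := filter_ex (sl e e0).
have -> : l = s t - (s t - l) by ring.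
by apply: le_trans (normc_sub _ _) _; exact: lerD.
Qed.
End ultrafilter_limits.

Lemma powR_cvg {R : realType} (u : nat -> R) (p x : R) : 0 < p -> (forall n, 0 <= u n) ->
  u n @[n --> \oo] --> x -> u n `^ p @[n --> \oo] --> x `^ p.
Proof.
move=> p0 u0 ux.
have x0 : 0 <= x by rewrite -(cvg_lim _ ux)//; apply: limr_ge; [exact: cvgP ux|exact: nearW].
move: x0 ux; rewrite le_eqVlt => /predU1P[<-|x0] ux.
  rewrite powR0 ?gt_eqF//; apply/cvgrPdist_le => e e0.
  have /cvgrPdist_le/(_ _ (powR_gt0 p^-1 e0)) := ux.
  apply: filterS => n; rewrite !sub0r !normrN !ger0_norm ?powR_ge0// => h.
  rewrite -[leRHS](powRr1 (ltW e0)) -(mulVf (lt0r_neq0 p0)) powRrM.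
  by apply: powR_mono => //; exact: ltW.
have up : \forall n \near \oo, 0 < u n by exact: cvgr_gt ux _ x0.
rewrite /powR (gt_eqF x0).
apply: cvg_trans (_ : expR (p * ln (u n)) @[n --> \oo] --> _).
  by apply: near_eq_cvg; apply: filterS up => n un; rewrite (gt_eqF un).
apply: continuous_cvg; first exact: continuous_expR.
by apply: cvgMr; apply: continuous_cvg => //; exact: continuous_ln.
Qed.

Section montel.
Context {R : realType} (p : R) (p0 : 0 < p).
Variable (X : R).
Implicit Types (f : R[i] -> R[i]) (x y z : R[i]).

Lemma locally_bounded (rho : R) : exists2 M : R, 0 <= M & forall f z, entire f ->
  (ipow p (kf f) <= X%:E)%E -> normc z <= rho -> normc (f z) <= M.
Proof.
have [C C0 CP] := @kf_pointwise R p p0.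
exists ((C * X) `^ p^-1 * expR (rho ^+ 2 / 2)); first by rewrite mulr_ge0 ?powR_ge0 ?expR_ge0.
move=> f z ef fX zr; have h := CP f (of_C z) ef; clear ef.
have {}h : kf f (of_C z) `^ p <= C * X.
  rewrite -lee_fin; apply: le_trans h _.
  by rewrite EFinM; apply: lee_wpmul2l => //; rewrite lee_fin ltW.
have k1 : kf f (of_C z) <= (C * X) `^ p^-1.
  rewrite -[leLHS]powRr1 ?kf_ge0// -(divff (lt0r_neq0 p0)) powRrM.
  by apply: powR_mono => //; [rewrite invr_ge0 ltW|exact: powR_ge0].
have -> : normc (f z) = kf f (of_C z) * expR (normc z ^+ 2 / 2).
  by rewrite /kf of_CK -mulrA -expRD addNr expR0 mulr1.
apply: ler_pM (kf_ge0 _ _) (expR_ge0 _) k1 _.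
rewrite ler_expR ler_wpM2r// lerXn2r ?nnegrE ?normc_ge0//.
exact: le_trans (normc_ge0 z) zr.
Qed.

(** Bounds for the first-order behaviour that are uniform over a ball of F^p and
    over a disc, from [cauchy_estimates] on squares of fixed size. *)
Lemma local_estimates (rho : R) : exists2 M : R, 0 <= M & forall f z, entire f ->
  (ipow p (kf f) <= X%:E)%E -> normc z <= rho ->
  exists d, normc d <= M /\ forall w, normc w <= 1 ->
    normc (f (z + w) - f z) <= M * normc w /\
    normc (f (z + w) - f z - d * w) <= M * normc w ^+ 2.
Proof.
have [M M0 MP] := locally_bounded (rho + 4).
exists (4 * M); first by rewrite mulr_ge0.
move=> f z ef fX zr; have ef1 := @entire_affine _ f 1 z ef.
have bd y : on_square 2 y -> normc (f (1 * y + z)) <= M.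
  move=> /on_square_le y4; apply: MP => //.
  by rewrite mul1r; apply: le_trans (le_normcD _ _) _; lra.
have [d [dM dP]] := cauchy_estimates ef1 bd; clear ef ef1.
exists d; split => // w w1; have := dP w w1.
rewrite !mul1r add0r [w + z]addrC => -[h1 h2]; split => //.
apply: le_trans h2 _; rewrite ler_wpM2r ?exprn_ge0 ?normc_ge0//; lra.
Qed.

Section limit.
Context {T : Type} (U : set_system T) {UU : UltraFilter U}.
Variable s : T -> R[i] -> R[i].
Hypothesis es : forall t, entire (s t).
Hypothesis sX : forall t, (ipow p (kf (s t)) <= X%:E)%E.

Let PU : ProperFilter U. Proof. exact: ultra_proper. Qed.

Section pointwise.
Variable G : R[i] -> R[i].
Hypothesis GP : forall z, ulim U (s^~ z) (G z).

(** The bounds of [local_estimates] are common to all the functions, so they hold for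
    the pointwise limit, whose derivative is a limit of the derivatives. *)
Lemma limit_estimates (rho : R) : exists2 M : R, 0 <= M &
  (forall t z w, normc z <= rho -> normc w <= 1 ->
     normc (s t (z + w) - s t z) <= M * normc w) /\
  (forall z, normc z <= rho -> exists d, forall w, normc w <= 1 ->
    normc (G (z + w) - G z) <= M * normc w /\
    normc (G (z + w) - G z - d * w) <= M * normc w ^+ 2).
Proof.
have [M M0 MP] := local_estimates rho; exists M => //; split => [t z w zr w1|z zr].
  by have [d [_ /(_ w w1)[]]] := MP _ z (@es t) (sX t) zr.
have [D DP] := choice (fun t => MP (s t) z (@es t) (sX t) zr).
have [d dP] := ulim_bounded (fun t => (DP t).1).
exists d => w w1; split; apply/ler_addgt0Pr => e e0.
  have e20 : 0 < e / 2 by rewrite divr_gt0.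
  have [t [/= h1 h2]] := filter_ex (filterI (GP (z + w) e20) (GP z e20)).
  have -> : G (z + w) - G z = (s t (z + w) - s t z) - (s t (z + w) - G (z + w)) + (s t z - G z).
    by ring.
  apply: le_trans (le_normcD _ _) _; apply: le_trans (lerD (normc_sub _ _) (lexx _)) _.
  have := ((DP t).2 w w1).1; lra.
have e30 : 0 < e / 3 by rewrite divr_gt0.
have [t [/= [/= h1 h2] h3]] :=
  filter_ex (filterI (filterI (GP (z + w) e30) (GP z e30)) (dP _ e30)).
have -> : G (z + w) - G z - d * w = (s t (z + w) - s t z - D t * w)
    - (s t (z + w) - G (z + w)) + (s t z - G z) + (D t - d) * w by ring.
apply: le_trans (le_normcD _ _) _; apply: le_trans (lerD (le_normcD _ _) (lexx _)) _.
apply: le_trans (lerD (lerD (normc_sub _ _) (lexx _)) (lexx _)) _.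
have h4 : normc ((D t - d) * w) <= e / 3.
  rewrite normcM -[leRHS]mulr1; apply: ler_pM => //; exact: normc_ge0.
have := ((DP t).2 w w1).2; lra.
Qed.

Lemma limit_entire : entire G.
Proof.
apply/entireP => z; have [M M0 [_ /(_ z (lexx _))[d dP]]] := limit_estimates (normc z).
have M1 : 0 < M + 1 by rewrite ltr_wpDl.
exists d => e e0; exists (Num.min 1 (e / (M + 1))); first by rewrite lt_min ltr01 divr_gt0.
move=> h; rewrite lt_min => /andP[h1 h2]; apply: le_trans (dP h (ltW h1)).2 _.
rewrite expr2 mulrA ler_wpM2r ?normc_ge0//.
apply: (@le_trans _ _ (M * (e / (M + 1)))); first by rewrite ler_wpM2l// ltW.
by rewrite mulrA ler_pdivrMr// [leRHS]mulrC ler_wpM2r ?(ltW e0)// lerDl.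
Qed.

(** Otherwise there are points of the square where the distance exceeds [eta]; they
    have a limit along [U], and there the pointwise limit contradicts the common
    Lipschitz bound. *)
Lemma limit_uniform (n : nat) (eta : R) : 0 < eta ->
  U [set t | forall w : plane R, sq n%:R w -> normc (s t (to_C w) - G (to_C w)) <= eta].
Proof.
move=> eta0; have [//|nU] := in_ultra_setVsetC
  [set t | forall w : plane R, sq n%:R w -> normc (s t (to_C w) - G (to_C w)) <= eta] UU.
have exw t : exists w : plane R, sq n%:R w /\
    ((exists2 w' : plane R, sq n%:R w' & eta < normc (s t (to_C w') - G (to_C w'))) ->
     eta < normc (s t (to_C w) - G (to_C w))).
  have [[w' w'n h]|no] := pselect (exists2 w' : plane R, sq n%:R w' & eta < normc (s t (to_C w') - G (to_C w'))).
    by exists w'.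
  by exists (0, 0); split => //; apply/sqP; rewrite /= normr0.
have [v vP] := choice exw.
have sqn (w : plane R) : sq n%:R w -> normc (to_C w) <= n%:R + n%:R.
  by move=> /sqP[w1 w2]; apply: le_trans (normc_le_ReIm _) _; exact: lerD.
have vn t : normc (to_C (v t)) <= n%:R + n%:R by apply: sqn; exact: (vP t).1.
have [z0 z0P] := ulim_bounded vn.
have z0n : normc z0 <= n%:R + n%:R by exact: (ulim_normc_le z0P vn).
have [M M0 [sM GM]] := limit_estimates (n%:R + n%:R).
have [d dP] := GM z0 z0n.
have M1 : 0 < M + 1 by rewrite ltr_wpDl.
have del0 : 0 < Num.min 1 (eta / 4 / (M + 1)) by rewrite lt_min ltr01 !divr_gt0.
have e20 : 0 < eta / 2 by rewrite divr_gt0.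
have [t [/= [/= h1 h2] h3]] := filter_ex (filterI (filterI (z0P _ del0) (GP z0 e20)) nU).
exfalso.
have : eta < normc (s t (to_C (v t)) - G (to_C (v t))).
  apply: (vP t).2; apply: contrapT => no; apply: h3 => w wn.
  by rewrite leNgt; apply/negP => h; apply: no; exists w.
apply/negP; rewrite -leNgt.
have -> : to_C (v t) = z0 + (to_C (v t) - z0) by ring.
move: (to_C (v t) - z0) h1 => w; rewrite le_min => /andP[w1 w2].
have -> : s t (z0 + w) - G (z0 + w) = (s t (z0 + w) - s t z0) - (G (z0 + w) - G z0) + (s t z0 - G z0).
  by ring.
apply: le_trans (le_normcD _ _) _; apply: le_trans (lerD (normc_sub _ _) (lexx _)) _.
have := sM t z0 w z0n w1; have := (dP w w1).1.
have : M * normc w <= eta / 4.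
  apply: (@le_trans _ _ (M * (eta / 4 / (M + 1)))); first by rewrite ler_wpM2l.
  by rewrite mulrA ler_pdivrMr// [leRHS]mulrC ler_wpM2r ?divr_ge0 ?(ltW eta0)// lerDl.
lra.
Qed.

(** Fatou's lemma for a sequence of indices along which the functions converge. *)
Lemma limit_ipow : (ipow p (kf G) <= X%:E)%E.
Proof.
have [t tP] := choice (fun n : nat => filter_ex (limit_uniform n (harmonic_gt0 n))).
have eG := limit_entire.
have cvgG (w : plane R) : kf (s (t n)) w @[n --> \oo] --> kf G w.
  pose m := (Num.truncn (`|w.1| + `|w.2|)).+1.
  have wm n : (m <= n)%N -> sq n%:R w.
    move=> mn; have : `|w.1| + `|w.2| < m%:R by exact: truncnS_gt.
    have : m%:R <= n%:R :> R by rewrite ler_nat.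
    by have := normr_ge0 w.1; have := normr_ge0 w.2 => ? ? ? ?; apply/sqP; split; lra.
  apply: cvgMl; apply/cvgrPdist_le => e e0.
  have /cvgrPdist_le/(_ e e0) [N _ NP] := @cvg_harmonic R.
  exists (maxn m N) => // n; rewrite /= geq_max => /andP[mn Nn].
  have h1 := tP n w (wm n mn).
  have := NP n Nn; rewrite sub0r normrN ger0_norm ?harmonic_ge0// => h2.
  have h3 : normc (s (t n) (to_C w)) <= normc (s (t n) (to_C w) - G (to_C w)) + normc (G (to_C w)).
    by rewrite -[X in normc X <= _](subrK (G (to_C w))); exact: le_normcD.
  have h4 : normc (G (to_C w)) <= normc (s (t n) (to_C w)) + normc (s (t n) (to_C w) - G (to_C w)).
    rewrite (_ : G (to_C w) = s (t n) (to_C w) - (s (t n) (to_C w) - G (to_C w))); last by ring.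
    by rewrite [X in _ <= _ + normc X](_ : _ = s (t n) (to_C w) - G (to_C w)) ?normc_sub//; ring.
  by rewrite ler_norml; apply/andP; split; lra.
have mf n : measurable_fun setT (fun w => (kf (s (t n)) w `^ p)%:E).
  exact: (measurable_pow p (measurable_kf (@es (t n)))).
have f0 n (w : plane R) : setT w -> (0 <= (kf (s (t n)) w `^ p)%:E)%E by rewrite lee_fin powR_ge0.
have := @fatou _ _ _ (@dA R) setT measurableT _ mf f0.
rewrite /ipow (eq_integral (fun w => (kf G w `^ p)%:E)); last first.
  move=> w _; apply: (cvg_limn_einf_sup _).1; apply/cvg_EFin; first by apply: nearW.
  exact: (powR_cvg p0 (fun n => kf_ge0 _ _) (cvgG w)).
move/le_trans; apply.
rewrite limn_einf_lim; apply: lime_le; first exact: is_cvg_einfs.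
apply: nearW => n; apply: le_trans (sX (t n)).
by apply: ereal_inf_lbound; exists n => /=.
Qed.
End pointwise.

(** Along an ultrafilter all bounded numerical limits exist, so no subsequences have
    to be extracted. *)
Theorem montel : exists G : R[i] -> R[i],
  [/\ entire G, (ipow p (kf G) <= X%:E)%E & forall (n : nat) (eta : R), 0 < eta ->
  U [set t | forall w : plane R, sq n%:R w -> normc (s t (to_C w) - G (to_C w)) <= eta]].
Proof.
have ex z : exists l, ulim U (s^~ z) l.
  have [M _ MP] := locally_bounded (normc z).
  by apply: (@ulim_bounded _ _ _ _ _ M) => t; apply: MP (@es t) (sX t) (lexx _).
have [G GP] := choice ex; exists G.
by split; [exact: limit_entire GP|exact: limit_ipow GP|move=> n eta; exact: (limit_uniform GP n)].
Qed.
End limit.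
End montel.

(** * Compactness *)

Section compactness.
Context {R : realType}.
Implicit Types (f : R[i] -> R[i]) (p q : R).

Local Open Scope ereal_scope.

Lemma kf0 w : kf (fun=> 0%R : R[i]) w = 0%R.
Proof. by rewrite /kf normc0 mul0r. Qed.

Lemma ipow_kf0 p : (0 < p)%R -> ipow p (kf (fun=> 0%R : R[i])) = 0.
Proof.
move=> p0; rewrite /ipow (eq_integral (cst 0)) ?integral0// => w _.
by rewrite kf0 powR0// gt_eqF.
Qed.

Lemma ipow_sub_le p f (g : R[i] -> R[i]) : (0 < p)%R -> entire f -> entire g ->
  ipow p (kf (fun z => f z - g z)%R) <= (2 `^ p)%:E * (ipow p (kf f) + ipow p (kf g)).
Proof.
move=> p0 ef eg.
have mf := measurable_pow p (measurable_kf ef); have mg := measurable_pow p (measurable_kf eg).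
have mfg := measurable_pow p (measurable_kfB ef eg); clear ef eg.
have f0 (h : R[i] -> R[i]) (w : plane R) : setT w -> 0 <= (kf h w `^ p)%:E by rewrite lee_fin powR_ge0.
rewrite /ipow -(ge0_integralD _ measurableT (f0 f) mf (f0 g) mg).
rewrite -(ge0_integralZl _ measurableT (emeasurable_funD mf mg)); first last.
- by rewrite lee_fin powR_ge0.
- by move=> w _; rewrite -EFinD lee_fin addr_ge0 ?powR_ge0.
apply: ge0_le_integral.
- exact: measurableT.
- exact: f0.
- exact: mfg.
- exact: (emeasurable_funM (measurable_cst _) (emeasurable_funD mf mg)).
move=> w _; rewrite -EFinD -EFinM lee_fin.
have h1 : (kf (fun z => f z - g z)%R w <= 2 * Num.max (kf f w) (kf g w))%R.
  apply: (@le_trans _ _ (kf f w + kf g w)%R); first exact: kfB.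
  by rewrite mulr2n mulrDl mul1r lerD// le_max lexx ?orbT.
apply: (le_trans (powR_mono (ltW p0) (kf_ge0 _ _) h1)).
rewrite powRM// ?le_max ?kf_ge0// ler_wpM2l ?powR_ge0//.
by rewrite maxEle; case: ifP => _; rewrite ?lerDl ?lerDr powR_ge0.
Qed.

Section weighted_comp_op.
Variables (p q : R) (psi : R[i] -> R[i]) (a b : R[i]).
Hypotheses (q0 : (0 < q)%R) (qp : (q < p)%R) (a0 : a != 0%R).
Hypothesis psiF : fock q psi.
Let r := (p * q / (p - q))%R.
Let W := weighted_comp psi (fun z => a * z + b)%R.
Let p0 : (0 < p)%R. Proof. exact: lt_trans qp. Qed.

Section in_Lr.
Hypothesis finm : ipow r (mw psi a b) < +oo.

Lemma fock_W f : entire f -> ipow p (kf f) < +oo -> fock q (W f).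
Proof.
move=> ef finf; split; first exact: (@entire_W R psi a b psiF.1 f ef).
apply/(fock_norm_lty _ q0); apply: le_lt_trans (ipow_W_le b psiF.1 q0 qp ef a0) _; clear ef.
have fin1 (x : \bar R) (t : R) : 0 <= x -> x < +oo -> x `^ t \is a fin_num.
  by move=> x0 xy; rewrite ge0_fin_numE ?poweR_ge0// poweR_lty.
have m1 : (normc a ^- 2)%:E * ipow p (kf f) < +oo.
  by apply: lte_mul_pinfty => //; rewrite lee_fin invr_ge0 exprn_ge0// normc_ge0.
have m0 : 0 <= (normc a ^- 2)%:E * ipow p (kf f).
  by apply: mule_ge0; [rewrite lee_fin invr_ge0 exprn_ge0// normc_ge0|exact: ipow_ge0].
by rewrite ltey_eq (fin_numM (fin1 _ _ (ipow_ge0 _ _) finm) (fin1 _ _ m0 m1)).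
Qed.

Definition image_ball (X : R) : set (fockType q) :=
  [set g | exists f, [/\ entire f, ipow p (kf f) <= X%:E & fock_fun g = W f]].

(** Along an ultrafilter on this set, the preimages converge locally uniformly to
    some G in the ball. Then [W_small], for the differences with G, turns this into
    convergence of the images to W G. *)
Lemma image_ball_compact (X : R) : (0 <= X)%R -> compact (image_ball X).
Proof.
move=> X0; rewrite compact_ultra => F UF FK.
have sel (g : fockType q) : exists f, [/\ entire f, ipow p (kf f) <= X%:E &
    image_ball X g -> fock_fun g = W f].
  have [[f [ef fX gW]]|no] := pselect (image_ball X g); first by exists f; split.
  exists (fun=> 0%R); split; [exact: entire_cst|by rewrite ipow_kf0|by move=> /no].
have [s sP] := choice sel.
have es (g : fockType q) : entire (s g) by have [h _ _] := sP g; exact: h.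
have sX (g : fockType q) : ipow p (kf (s g)) <= X%:E by have [_ h _] := sP g; exact: h.
have sW (g : fockType q) : image_ball X g -> fock_fun g = W (s g) by have [_ _ h] := sP g; exact: h.
have [G [eG GX Gu]] := @montel R p p0 X _ F UF s es sX.
have WG := fock_W eG (le_lt_trans GX (ltry X)).
pose g0 := FockType WG; exists g0; split; first by exists G; split; [exact: eG|exact: GX|].
move=> A; rewrite nbhsE => -[B [oB Bg0] BA].
have [e e0 eB] := oB g0 Bg0.
have [d d0 dP] := fock_dist_lt q0 e0.
have Y0 : (0 <= 2 `^ p * (X + X))%R by rewrite mulr_ge0 ?powR_ge0// addr_ge0.
have [n [eta eta0 nP]] := W_small q0 qp psiF.1 a0 ((fock_norm_lty _ q0).1 psiF.2) finm Y0 d0.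
apply: (filterS _ (filterI FK (Gu n eta eta0))) => g [Kg hg].
apply: BA; apply: eB; apply: dP; rewrite /g0 /= (sW _ Kg).
have -> : (fun z => W G z - W (s g) z)%R = W (fun z => G z - s g z)%R.
  by apply/funext => z; rewrite /W /weighted_comp mulrBr.
apply: nP; first exact: (@entireB _ G (s g) eG (@es g)).
  apply: le_trans (ipow_sub_le p0 eG (@es g)) _.
  rewrite (EFinM (2 `^ p)%R (X + X)%R) (EFinD X X).
  by apply: lee_wpmul2l; [rewrite lee_fin powR_ge0|exact: (leeD GX (sX g))].
by move=> w wn; rewrite normc_subC; exact: hg.
Qed.

Lemma weighted_comp_compact : compact_op p q W.
Proof.
split=> [f [ef ff]|B [M BM]]; first exact: fock_W ef ((fock_norm_lty _ p0).1 ff).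
pose X := (2 * pi / p * (Num.max M 0) `^ p)%R.
have X0 : (0 <= X)%R by rewrite mulr_ge0 ?powR_ge0// divr_ge0 ?mulr_ge0 ?pi_ge0// ltW.
exists (image_ball X); last first.
  have cX := image_ball_compact X0.
  by split => //; apply: compact_closed => //; exact: fock_hausdorff.
move=> g [f Bf gW]; exists f; split; [exact: (fock_funP f).1| |exact: gW].
rewrite (ipow_fock _ p0) /X (EFinM (2 * pi / p)%R) -poweR_EFin; apply: lee_wpmul2l.
  by rewrite lee_fin divr_ge0 ?mulr_ge0 ?pi_ge0// ltW.
apply: poweR_mono; [exact: ltW|exact: fock_norm_ge0|].
by apply: le_trans (BM f Bf) _; rewrite lee_fin le_max lexx.
Qed.
End in_Lr.
End weighted_comp_op.
End compactness.

(** * From compactness to boundedness, and homogeneity *)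

Section boundedness.
Context {R : realType}.
Implicit Types (f : R[i] -> R[i]).

Local Open Scope ereal_scope.

Lemma entireZ (c : R[i]) f : entire f -> entire (fun z => c * f z)%R.
Proof. by move=> ef; exact: (@entireM _ (fun=> c) f (@entire_cst _ c) ef). Qed.

Section weighted_comp_op.
Variables (p q : R) (psi : R[i] -> R[i]) (a b : R[i]).
Hypotheses (q0 : (0 < q)%R) (qp : (q < p)%R).
Hypothesis psiF : fock q psi.
Let W := weighted_comp psi (fun z => a * z + b)%R.
Let p0 : (0 < p)%R. Proof. exact: lt_trans qp. Qed.

(** If the unit ball had images of arbitrarily large norm, a sequence of them would
    have a cluster point, at distance less than 1 from infinitely many of its terms. *)
Lemma compact_op_bounded : compact_op p q W -> bounded_op p q W.
Proof.
move=> [mapsW cW]; split => //.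
pose B : set (fockType p) := [set f | fock_norm p f <= 1].
have Bb : fock_bounded B by exists 1%R => f Bf; exact: Bf.
have [U WU [cU _]] := cW B Bb.
rewrite ltNge; apply/negP => big.
(* the norm of the elements at distance n from 0 *)
pose c (n : nat) : R := if (1 <= q)%R then n%:R else (n%:R `^ q^-1)%R.
have large n : exists g : fockType q, U g /\ n%:R%:E <= fock_dist q (fun=> 0%R) g.
  have [[f [[Ff f1] fc]]|no] := pselect (exists f, (fock p f /\ fock_norm p f <= 1) /\
      (c n)%:E <= fock_norm q (W f)).
    pose g := FockType (mapsW f Ff); exists g; split.
      by apply: WU; exists (FockType Ff).
    rewrite fock_distC /fock_dist /=.
    have -> : (fun z => W f z - 0)%R = W f by apply/funext => z; rewrite subr0.
    move: fc; rewrite /c; have [_|_] := leP 1%R q => // fc.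
    apply: le_trans (poweR_mono (ltW q0) _ fc); last by rewrite lee_fin powR_ge0.
    by rewrite poweR_EFin -powRrM mulVf ?gt_eqF// powRr1.
  exfalso; move: big; apply/negP; rewrite -ltNge.
  apply: (@le_lt_trans _ _ (c n)%:E); last exact: ltry.
  apply: ge_ereal_sup => _ [f [Ff f1] <-].
  by rewrite leNgt; apply/negP => h; apply: no; exists f; split => //; exact: ltW.
have [g gP] := choice large.
have FU : (g @ \oo) U by exists 0%N => // n _; exact: (gP n).1.
have [h [_ clh]] := cU _ (fmap_proper_filter g _) FU.
pose d := fock_dist q (fun=> 0%R) h.
have dfin : d \is a fin_num.
  rewrite ge0_fin_numE ?fock_dist_ge0// /d fock_distC /fock_dist.
  have -> : (fun z => h z - 0)%R = fock_fun h by apply/funext => z; rewrite subr0.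
  by have [_|_] := leP 1%R q; [exact: (fock_funP h).2|exact: poweR_lty (fock_funP h).2].
pose N := (Num.truncn (fine d + 1)%R).+1.
have gN : (g @ \oo) [set g' | N%:R%:E <= fock_dist q (fun=> 0%R) g'].
  exists N => // n /= Nn; apply: le_trans (gP n).2.
  by rewrite lee_fin ler_nat.
have [g' [/= h1 h2]] := clh _ _ gN (fock_ball_nbhs h q0 ltr01).
have := fock_dist_triangle q0 (@entire_cst R 0%R) (fock_funP h).1 (fock_funP g').1.
move=> /(le_trans h1); apply/negP; rewrite -ltNge.
apply: (@le_lt_trans _ _ (d + 1)); first exact: (leeD (lexx d) (ltW h2)).
by rewrite -(fineK dfin) -EFinD lte_fin /N truncnS_gt.
Qed.

Lemma opnorm_ge0 : 0 <= opnorm p q W.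
Proof.
apply: (le_trans (fock_norm_ge0 q (W (fun=> 0%R)))); apply: ereal_sup_ubound.
exists (fun=> 0%R) => //; split.
  split; first exact: entire_cst.
  by apply/(fock_norm_lty _ p0); rewrite ipow_kf0.
by rewrite fock_normE ipow_kf0// mule0 poweR0r ?invr_neq0 ?gt_eqF.
Qed.

(** By homogeneity: dividing f by s = ((p / 2 pi) X)^(1/p) brings it to the unit
    ball. When X = 0, the function f itself vanishes. *)
Lemma bounded_op_pow (O : R) : opnorm p q W = O%:E -> (0 <= O)%R ->
  bounded_pow p q psi a b ((2 * pi / q) * (p / (2 * pi)) `^ (q / p) * O `^ q)%R.
Proof.
move=> OE O0 f ef X X0 fX.
have kp := kappa_gt0 p0; have kq := kappa_gt0 q0.
have pi0 : (0 < 2 * pi :> R)%R by rewrite mulr_gt0// pi_gt0.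
move: X0; rewrite le_eqVlt => /predU1P[X00|X0].
  have [C C0 CP] := @kf_pointwise R p p0.
  have fz z : f z = 0%R.
    apply: kf_eq0; apply: (@powR_eq0_eq0 _ _ p); apply/eqP.
    rewrite eq_le powR_ge0 andbT -lee_fin; apply: le_trans (CP f (of_C z) ef) _.
    have -> : 0%R%:E = C%:E * X%:E :> \bar R by rewrite -X00 mule0.
    by apply: lee_wpmul2l => //; rewrite lee_fin ltW.
  have -> : weighted_comp psi (fun z : R[i] => (a * z + b)%R) f = (fun=> 0%R).
    by apply/funext => z; rewrite /weighted_comp fz mulr0.
  rewrite ipow_kf0// lee_fin mulr_ge0 ?powR_ge0// mulr_ge0 ?powR_ge0// mulr_ge0 ?powR_ge0//.
  by rewrite divr_ge0 ?(ltW pi0)// ltW.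
pose s := ((p / (2 * pi) * X) `^ p^-1)%R.
have s0 : (0 < s)%R by apply: powR_gt0; rewrite mulr_gt0.
pose g := (fun z => (s^-1)%:C%C * f z)%R.
have eg : entire g by exact: (@entireZ (s^-1)%:C%C f ef).
have mf := measurable_kf ef.
have gE : ipow p (kf g) = ((s^-1) `^ p)%:E * ipow p (kf f).
  have sV0 : (0 <= s^-1)%R by rewrite invr_ge0 ltW.
  rewrite -(ipowZ p sV0 mf); last by move=> w; exact: kf_ge0.
  by congr (ipow p _); apply/funext => w; rewrite /g kfZ normc_real ger0_norm.
have g1 : (p / (2 * pi))%:E * ipow p (kf g) <= 1.
  rewrite gE; apply: (@le_trans _ _ ((p / (2 * pi))%:E * (((s^-1) `^ p)%:E * X%:E))).
    by rewrite !lee_wpmul2l ?lee_fin ?powR_ge0 ?(ltW kp).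
  rewrite -!EFinM lee_fin mulrCA.
  have <- : (s `^ p = p / (2 * pi) * X)%R.
    by rewrite -powRrM mulVf ?gt_eqF// powRr1// mulr_ge0 ?(ltW kp) ?(ltW X0).
  by rewrite -powRM ?invr_ge0 ?(ltW s0)// mulVf ?gt_eqF// powR1.
have gn : fock_norm p g <= 1.
  have -> : 1 = 1%:E `^ p^-1 :> \bar R by rewrite poweR_EFin powR1.
  rewrite fock_normE; apply: poweR_mono; last exact: g1.
    by rewrite invr_ge0 ltW.
  by apply: mule_ge0; [rewrite lee_fin ltW|exact: ipow_ge0].
have gF : fock p g by split; [exact: eg|exact: (le_lt_trans gn (ltry 1))].
have Wg : fock_norm q (W g) <= O%:E.
  by rewrite -OE; apply: ereal_sup_ubound; exists g.
have mWg := measurable_kf (@entire_W R psi a b psiF.1 g eg).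
have -> : ipow q (kf (W f)) = (s `^ q)%:E * ipow q (kf (W g)).
  rewrite -(ipowZ q (ltW s0) mWg); last by move=> w; exact: kf_ge0.
  congr (ipow q _); apply/funext => w; rewrite -[X in (X * _)%R](ger0_norm (ltW s0)) -normc_real -kfZ; congr (kf _ w).
  apply/funext => z; rewrite /W /weighted_comp /g mulrCA; congr (_ * _)%R.
  by rewrite mulrA -rmorphM/= divff ?gt_eqF// mul1r.
have h : (2 * pi / q)%:E * fock_norm q (W g) `^ q <= (2 * pi / q * O `^ q)%:E.
  rewrite (EFinM (2 * pi / q)%R) -poweR_EFin; apply: lee_wpmul2l.
    by rewrite lee_fin divr_ge0 ?(ltW pi0)// ltW.
  by apply: poweR_mono => //; [exact: ltW|exact: fock_norm_ge0].
rewrite (ipow_fock _ q0).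
apply: (le_trans (lee_wpmul2l _ h)); first by rewrite lee_fin powR_ge0.
rewrite -EFinM lee_fin /s -powRrM (mulrC p^-1%R) -/(q / p)%R powRM ?(ltW kp) ?(ltW X0)//.
by apply: eqW; ring.
Qed.
End weighted_comp_op.
End boundedness.

(** * Equivalence of the norms *)

Section norm_equivalence.
Context {R : realType}.
Variables (p q : R).
Hypotheses (q0 : 0 < q) (qp : q < p).
Let r := p * q / (p - q).
Let p0 : 0 < p. Proof. exact: lt_trans qp. Qed.

Definition upper_const (rho : R) : R :=
  (q / (2 * pi)) `^ q^-1 * (rho ^- 2 * (2 * pi / p)) `^ p^-1.

Lemma upper_const_gt0 rho : 0 < rho -> 0 < upper_const rho.
Proof.
move=> rho0; rewrite mulr_gt0// powR_gt0// ?kappa_gt0//.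
by rewrite mulr_gt0 ?invr_gt0 ?exprn_gt0// divr_gt0// mulr_gt0// pi_gt0.
Qed.

Lemma opnorm_le (psi : R[i] -> R[i]) (a b : R[i]) : fock q psi -> a != 0 ->
  (opnorm p q (weighted_comp psi (fun z => a * z + b)%R) <=
   (upper_const (normc a))%:E * Lr_norm r (m_fun psi (fun z => a * z + b)%R))%E.
Proof.
move=> psiF a0; apply: ge_ereal_sup => _ [f [[ef _] f1] <-].
apply: le_trans (fock_norm_W_le b psiF.1 q0 qp ef a0) _.
rewrite -[leRHS]mule1; apply: lee_wpmul2l; last exact: f1.
apply: mule_ge0; last by rewrite (Lr_normE psi a b r); exact: poweR_ge0.
by rewrite lee_fin ltW// upper_const_gt0// normc_gt0.
Qed.

(** The q-th power of the operator norm, in the estimate [Lr_lower], is raised to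
    p / (p - q), and q p / (p - q) = r. *)
Lemma bounded_op_ipow : exists2 C : R, 0 < C &
  forall (psi : R[i] -> R[i]) (a b : R[i]), fock q psi -> a != 0 -> normc a <= 1 ->
  let W := weighted_comp psi (fun z => a * z + b) in
  bounded_op p q W -> exists2 O : R, 0 <= O & opnorm p q W = O%:E /\
    (ipow r (mw psi a b) <= (C * normc a ^- 2 * O `^ r)%:E)%E.
Proof.
have [C C0 CP] := Lr_lower q0 qp.
pose k : R := 2 * pi / q * (p / (2 * pi)) `^ (q / p).
have k0 : 0 < k.
  by rewrite mulr_gt0 ?powR_gt0 ?kappa_gt0// divr_gt0// mulr_gt0// pi_gt0.
exists (C * k `^ (p / (p - q))); first by rewrite mulr_gt0// powR_gt0.
move=> psi a b psiF a0 a1 W [_ Wfin].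
have W0 := @opnorm_ge0 R p q psi a b q0 qp.
have OE : opnorm p q W = (fine (opnorm p q W))%:E by rewrite fineK// ge0_fin_numE.
have O0 : 0 <= fine (opnorm p q W) by exact: fine_ge0.
move: (fine _) OE O0 => O OE O0; exists O => //; split => //.
have kO : 0 <= k * O `^ q by rewrite mulr_ge0 ?powR_ge0// ltW.
apply: le_trans (CP psi a b _ psiF.1 a0 a1 kO (bounded_op_pow q0 qp psiF OE O0)) _.
rewrite lee_fin powRM ?powR_ge0 ?(ltW k0)// -powRrM.
rewrite (_ : q * (p / (p - q)) = r); last by rewrite /r; ring.
by apply: eqW; ring.
Qed.

End norm_equivalence.

Theorem theorem3p3 (R : realType) (p q : R) (hq : 0 < q) (hqp : q < p) :
  (forall (psi : R[i] -> R[i]) (a b : R[i]),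
     fock q psi -> psi <> (fun=> 0) -> 0 < normc a <= 1 ->
     let phi := fun z : R[i] => a * z + b in
     let W := weighted_comp psi phi in
     (bounded_op p q W <-> compact_op p q W) /\
     (compact_op p q W <-> in_Lr (p * q / (p - q)) (m_fun psi phi)))
  /\
  (forall r : R, 0 < r <= 1 ->
     exists c1 c2 : R, 0 < c1 /\ 0 < c2 /\
     forall (psi : R[i] -> R[i]) (a b : R[i]),
       fock q psi -> psi <> (fun=> 0) -> normc a = r ->
       let phi := fun z : R[i] => a * z + b in
       let W := weighted_comp psi phi in
       bounded_op p q W ->
       (opnorm p q W <= c1%:E * Lr_norm (p * q / (p - q)) (m_fun psi phi))%E /\
       (Lr_norm (p * q / (p - q)) (m_fun psi phi) <= c2%:E * opnorm p q W)%E).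
Proof.
have p0 : 0 < p by exact: lt_trans hqp.
have s0 : 0 < p * q / (p - q) by rewrite divr_gt0 ?subr_gt0// mulr_gt0.
have [C C0 CP] := bounded_op_ipow hq hqp.
split=> [psi a b psiF _ /andP[]|rho /andP[rho0 rho1]].
  rewrite normc_gt0 => a0 a1 phi W.
  have i_iii : bounded_op p q W -> in_Lr (p * q / (p - q)) (m_fun psi phi).
    move=> /(CP psi a b psiF a0 a1)[t _ [_ h]].
    by apply/(in_LrE a b psiF.1 s0); exact: le_lt_trans h (ltry _).
  have iii_ii : in_Lr (p * q / (p - q)) (m_fun psi phi) -> compact_op p q W.
    by move=> /(in_LrE a b psiF.1 s0); exact: weighted_comp_compact.
  have ii_i := @compact_op_bounded R p q psi a b hq.
  by split; split; [move/i_iii/iii_ii|exact: ii_i|move/ii_i/i_iii|exact: iii_ii].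
exists (upper_const p q rho); exists ((C * rho ^- 2) `^ (p * q / (p - q))^-1).
have c0 : 0 < C * rho ^- 2 by rewrite mulr_gt0// invr_gt0 exprn_gt0.
split; first exact: upper_const_gt0.
split; first exact: powR_gt0.
move=> psi a b psiF _ aE phi W bW.
have a0 : a != 0 by rewrite -normc_gt0 aE.
have a1 : normc a <= 1 by rewrite aE.
split; first by rewrite -aE; exact: opnorm_le.
have [t t0 [tE h]] := CP psi a b psiF a0 a1 bW.
rewrite (Lr_normE psi a b) tE; move: h; rewrite aE => h.
apply: (le_trans (poweR_mono _ (ipow_ge0 _ _) h)); first by rewrite invr_ge0 ltW.
rewrite poweR_EFin powRM ?powR_ge0 ?(ltW c0)// -powRrM divff ?gt_eqF// powRr1//.
Qed.
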